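(* Let $X$ be a connected open oriented manifold of dimension greater than one that is the interior of a compact manifold with boundary, let $\lambda$ be a partition of an integer $n$, and let $i\geq 0$. Then the Betti numbers $b_i(j) := \dim H_i(\bar{w}^c_{1^j \lambda}(X) ; \mathbb{Q})$ stabilise as $j \rightarrow \infty$, i.e., the limit $\lim_{j \rightarrow \infty} b_i(j)$ exists.
   Context: $\mathrm{Sym}^mX=X^m/\Sigma_m$ is the $m$-th symmetric product, whose elements are unordered $m$-tuples of points of $X$ with multiplicity. For a partition $\mu$ of $m$, $w_\mu(X)\subset\mathrm{Sym}^mX$ is the subspace of elements whose multiplicities are prescribed by $\mu$ (e.g. for $\mu=1+4+4$, one point of multiplicity $1$ and two points of multiplicity $4$, all distinct). $\bar w_\mu(X)$ is the closure of $w_\mu(X)$ in $\mathrm{Sym}^mX$, and $\bar w^c_\mu(X)=\mathrm{Sym}^mX\setminus\bar w_\mu(X)$ is its complement. For $\lambda$ a partition of $n$, $1^j\lambda$ denotes the partition of $n+j$ obtained from $\lambda$ by adding $j$ further parts equal to $1$. *)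

(* Defs.v *)
From HB Require Import structures.
From mathcomp.multinomials Require Import freeg.
From mathcomp Require Import all_boot all_order all_algebra all_fingroup.
From mathcomp Require Import generic_quotient ring_quotient.
From mathcomp Require Import all_classical all_reals.
From mathcomp Require Import topology normedtype.

Set Implicit Arguments.
Unset Strict Implicit.
Unset Printing Implicit Defensive.

Import Order.TTheory GRing.Theory Num.Theory.
Import numFieldNormedType.Exports.

Local Open Scope classical_set_scope.
Local Open Scope ring_scope.
Local Open Scope quotient_scope.

Section LmodQuotient.
Variables (K : pzRingType) (V : lmodType K) (B : submodClosed V).

(* submodClosed does not inherit from zmodClosed, which Quotient.quot
   requires; hence this copy of B. *)
Definition submod_pred : {pred V} := [pred v | v \in B].

Lemma submod_pred_zmod : zmod_closed submod_pred.
Proof.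
split=> [|u v]; rewrite !inE; first exact: rpred0.
by move=> Bu Bv; rewrite -scaleN1r rpredD ?rpredZ.
Qed.

HB.instance Definition _ := GRing.isZmodClosed.Build V submod_pred
  submod_pred_zmod.

Local Notation Q := (Quotient.quot submod_pred).

Definition quot_scale (a : K) (q : Q) : Q := \pi_Q (a *: repr q).

Lemma pi_scale a : {morph \pi_Q : x / a *: x >-> quot_scale a x}.
Proof.
move=> x; rewrite /quot_scale; apply/eqP; rewrite -Quotient.idealrBE -scalerBr.
have : x - repr (\pi_Q x) \in submod_pred by rewrite Quotient.idealrBE reprK.
by rewrite !inE; exact: rpredZ.
Qed.

Lemma piD (x y : V) : \pi_Q (x + y) = \pi_Q x + \pi_Q y.
Proof. exact: Quotient.pi_add. Qed.

Lemma quot_scaleA a b q : quot_scale a (quot_scale b q) = quot_scale (a * b) q.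
Proof.
by elim/quotW: q => q; rewrite -(pi_scale b q) -2!(pi_scale _ _) scalerA.
Qed.

Lemma quot_scale1 : left_id 1 quot_scale.
Proof. by elim/quotW => q; rewrite -pi_scale scale1r. Qed.

Lemma quot_scaleDr : right_distributive quot_scale +%R.
Proof.
move=> a; elim/quotW=> p; elim/quotW=> q.
by rewrite -piD -(pi_scale a p) -(pi_scale a q) -piD -pi_scale scalerDr.
Qed.

Lemma quot_scaleDl q : {morph quot_scale^~ q : a b / a + b}.
Proof.
move=> a b; elim/quotW: q => q.
by rewrite -!(pi_scale _ q) -piD scalerDl.
Qed.

HB.instance Definition _ := GRing.Zmodule_isLmodule.Build K Q
  quot_scaleA quot_scale1 quot_scaleDr quot_scaleDl.

End LmodQuotient.

Definition has_dim (K : fieldType) (V : lmodType K) (b : nat) : Prop :=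
  exists e : 'I_b -> V, forall v,
    exists! a : 'rV[K]_b, v = \sum_i a ord0 i *: e i.

Definition std_simplex (R : realType) (n : nat) : set 'rV[R]_n.+1 :=
  [set v | (forall i, 0 <= v ord0 i) /\ \sum_i v ord0 i = 1].
Arguments std_simplex : clear implicits.

Section Face.
Variables (R : realType) (n : nat) (k : 'I_n.+2).

Definition insert0 (v : 'rV[R]_n.+1) : 'rV[R]_n.+2 :=
  \row_i oapp (v ord0) 0 (unlift k i).

Lemma insert0_simplex (v : std_simplex R n) :
  insert0 (\val v) \in std_simplex R n.+1.
Proof.
case: v => v /= /set_mem[v0 v1]; apply/mem_set; split.
  by move=> i; rewrite mxE; case: unliftP => [j ?|?] /=.
rewrite (bigD1_ord k) //= mxE unlift_none /= add0r -[RHS]v1.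
by apply: eq_bigr => i _; rewrite mxE liftK.
Qed.

Definition face (v : std_simplex R n) : std_simplex R n.+1 :=
  exist (fun w => w \in std_simplex R n.+1) _ (insert0_simplex v).

Lemma insert0_continuous : continuous insert0.
Proof.
move=> v W [P Pn PW]; exists (fun i j => P i (lift k j)).
  by move=> i j; have := Pn i (lift k j); rewrite mxE liftK /= (ord1 i).
move=> w Pw; apply: PW => i j; rewrite mxE (ord1 i).
case: unliftP => [j' ->|jk] /=; first exact: Pw.
by have /nbhs_singleton := Pn ord0 j; rewrite mxE jk unlift_none.
Qed.

Lemma face_continuous : continuous face.
Proof.
apply: continuous_comp_initial.
change (continuous (insert0 \o (set_val : std_simplex R n -> _))) => v.
apply: continuous_comp; first exact: initial_continuous.
exact: insert0_continuous.
Qed.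

HB.instance Definition _ := isContinuous.Build _ _ face face_continuous.
End Face.

Section Homology.
Variables (R : realType) (K : nzRingType) (X : topologicalType).

Definition singular n := continuousType (std_simplex R n) X.
HB.instance Definition _ n := Choice.on (singular n).

Definition chain n := {freeg (singular n) / K}.
HB.instance Definition _ n := GRing.Lmodule.on (chain n).

Definition face_map n (k : 'I_n.+2) (s : singular n.+1) : singular n :=
  s \o face k.

Definition boundary_succ n : chain n.+1 -> chain n :=
  fglift (fun s => \sum_(k < n.+2) (-1) ^+ k *: (<< face_map k s >> : chain n)).

Definition boundary n : chain n -> chain n.-1 :=
  match n with
  | 0 => fun=> 0
  | n'.+1 => @boundary_succ n'
  end.

Lemma boundary0 n : boundary (0 : chain n) = 0.
Proof.
case: n => [|n] //=; rewrite /boundary_succ.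
by rewrite -(subrr (0 : chain n.+1)) lift_is_additive subrr.
Qed.

Lemma boundaryD n : {morph @boundary n : c c' / c + c'}.
Proof.
have boundaryB m (c c' : chain m) : boundary (c - c') = boundary c - boundary c'.
  by case: m c c' => [|m] c c' /=; [rewrite subrr | exact: lift_is_additive].
move=> c c'; rewrite -[c' in LHS]opprK -[- c' in LHS]sub0r.
by rewrite !boundaryB boundary0 sub0r opprK.
Qed.

Lemma boundaryZ n (a : K) : {morph @boundary n : c / a *: c}.
Proof.
move=> c; have sumE (I : Type) (r : seq I) (F : I -> chain n) :
  boundary (\sum_(x <- r) F x) = \sum_(x <- r) boundary (F x).
  exact: (big_morph _ (@boundaryD n) (boundary0 n)).
rewrite -[c in RHS]freeg_sumE [_ *: _ in LHS]/(fgscale a c) !sumE scaler_sumr.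
apply: eq_bigr => x _; case: n c x {sumE} => [|n] c x /=; first by rewrite scaler0.
by rewrite /boundary_succ !liftU scalerA.
Qed.

Variable A : set X.

Definition chains_in n : {pred chain n} :=
  [pred c | `[< forall s : singular n, coeff s c != 0 -> forall x, A (s x) >]].

Lemma chains_in_submod n : GRing.subsemimod_closed (@chains_in n).
Proof.
split; [split|] => [|c c' /asboolP cA /asboolP c'A|a c /asboolP cA]; apply/asboolP => s.
- by rewrite coeff0 eqxx.
- rewrite coeffD; have [->|/cA //] := eqVneq (coeff s c) 0.
  by rewrite add0r; exact: c'A.
- rewrite coeffZ; have [->|/cA //] := eqVneq (coeff s c) 0.
  by rewrite mulr0 eqxx.
Qed.
HB.instance Definition _ n := GRing.isSubSemiModClosed.Build K (chain n)
  (@chains_in n) (@chains_in_submod n).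

(* Relative cycles of (X, A): the homology of the chain complex C(X) / C(A) is
   computed on representatives in C(X). *)
Definition rel_cycles n : {pred chain n} :=
  [pred c : chain n | `[< boundary c \in @chains_in n.-1 >]].

Lemma rel_cycles_submod n : GRing.subsemimod_closed (@rel_cycles n).
Proof.
split; [split|] => [|c c' /asboolP cA /asboolP c'A|a c /asboolP cA];
  apply/asboolP.
- by rewrite boundary0; exact: rpred0.
- by rewrite boundaryD; exact: rpredD.
- by rewrite boundaryZ; exact: rpredZ.
Qed.
HB.instance Definition _ n := GRing.isSubSemiModClosed.Build K (chain n)
  (@rel_cycles n) (@rel_cycles_submod n).

Definition cycle n := {c : chain n | c \in @rel_cycles n}.
HB.instance Definition _ n := [isSub of cycle n for sval].
HB.instance Definition _ n := [Choice of cycle n by <:].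
HB.instance Definition _ n := [SubChoice_isSubLmodule of cycle n by <:].

Definition rel_boundaries n : {pred cycle n} :=
  [pred c : cycle n |
     `[< exists b : chain n.+1, \val c - boundary b \in @chains_in n >]].

Lemma rel_boundaries_submod n : GRing.subsemimod_closed (@rel_boundaries n).
Proof.
split; [split|] => [|c c' /asboolP[b bA] /asboolP[b' b'A]|a c /asboolP[b bA]].
- by apply/asboolP; exists 0; rewrite boundary0 subr0 rpred0.
- apply/asboolP; exists (b + b').
  by rewrite boundaryD opprD addrACA rpredD.
- by apply/asboolP; exists (a *: b); rewrite boundaryZ -scalerBr rpredZ.
Qed.
HB.instance Definition _ n := GRing.isSubSemiModClosed.Build K (cycle n)
  (@rel_boundaries n) (@rel_boundaries_submod n).

Definition rel_homology n : Type :=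
  Quotient.quot (submod_pred (@rel_boundaries n)).
HB.instance Definition _ n := GRing.Lmodule.on (rel_homology n).

(* Meaningful when c is a relative cycle; the class of any other chain is 0. *)
Definition homology_class n (c : chain n) : rel_homology n :=
  \pi_(Quotient.quot (submod_pred (@rel_boundaries n)))
    (insubd (0 : cycle n) c).

End Homology.

Arguments rel_cycles {R K X} A n _.
Arguments rel_homology R K {X} A n.
Arguments homology_class {R K X} A {n} c.

Definition homology (R : realType) (K : nzRingType) (X : topologicalType)
  (n : nat) := rel_homology R K (set0 : set X) n.
Arguments homology : clear implicits.

(* b = dim H_i(X; Q); this relation entails that the dimension is finite. *)
Definition has_betti (R : realType) (X : topologicalType) (i b : nat) : Prop :=
  has_dim (homology R rat X i) b.

Definition homeomorphic (T U : topologicalType) : Prop :=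
  exists (f : T -> U) (g : U -> T),
    [/\ continuous f, continuous g, cancel f g & cancel g f].

Section Manifold.
Variables (R : realType) (d : nat).

Definition half_space : set 'rV[R]_d :=
  [set v | forall i : 'I_d, i = 0%N :> nat -> 0 <= v ord0 i].

Definition euclidean_at (X : topologicalType) (x : X) : Prop :=
  exists (U : set X) (V : set 'rV[R]_d),
    [/\ open_nbhs x U, open V & homeomorphic (set_type U) (set_type V)].

Definition half_euclidean_at (X : topologicalType) (x : X) : Prop :=
  exists (U : set X) (V : set 'rV[R]_d),
    [/\ open_nbhs x U, open V &
        homeomorphic (set_type U) (set_type (V `&` half_space))].

Definition manifold (X : topologicalType) : Prop :=
  [/\ hausdorff_space X, @second_countable X & forall x : X, euclidean_at x].

Definition manifold_with_boundary (M : topologicalType) : Prop :=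
  [/\ hausdorff_space M, @second_countable M &
      forall x : M, half_euclidean_at x].

(* By invariance of domain, the complement of the boundary. *)
Definition manifold_interior (M : topologicalType) : set M :=
  [set x | euclidean_at x].

Definition interior_of_compact (X : topologicalType) : Prop :=
  exists M : topologicalType,
    [/\ manifold_with_boundary M, compact [set: M] &
        homeomorphic X (set_type (@manifold_interior M))].

(* "Open" as opposed to "closed": without boundary and not compact. *)
Definition open_manifold (X : topologicalType) : Prop :=
  manifold X /\ ~ compact [set: X].

Definition local_homology (X : topologicalType) (x : X) : Type :=
  rel_homology R int (~` [set x]) d.
HB.instance Definition _ X x := GRing.Lmodule.on (@local_homology X x).

(* A choice of a generator of H_d(X, X \ x; Z) for every x which is locally
   induced by a single class of H_d(X, X \ U; Z), U a neighbourhood of x. *)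
Definition orientation (X : topologicalType)
    (mu : forall x : X, local_homology x) : Prop :=
  (forall (x : X) (h : local_homology x), exists k : int, h = k *: mu x) /\
  (forall x : X, exists2 U : set X, nbhs x U &
     exists2 c : chain R int X d, c \in rel_cycles (~` U) d &
       forall y, U y -> mu y = homology_class (~` [set y]) c).

End Manifold.

Section Sym.
Variables (X : topologicalType) (m : nat).

(* X^m is the type of row vectors over X, with the product topology, and
   'S_m acts on it by permuting the columns. *)
Definition sym_rel (u v : 'rV[X]_m) : bool :=
  [exists s : 'S_m, v == col_perm s u].

Lemma sym_rel_equiv : equiv_class_of sym_rel.
Proof.
split=> [u|u v|v u w].
- by apply/existsP; exists 1%g; rewrite col_perm1.
- by apply/existsP/existsP => -[s /eqP ->]; exists s^-1%g;
    rewrite -col_permM ?(mulVg, mulgV) col_perm1.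
- move=> /existsP[s /eqP ->] /existsP[t /eqP ->].
  by apply/existsP; exists (t * s)%g; rewrite col_permM.
Qed.

Canonical sym_rel_equivRel := EquivRelPack sym_rel_equiv.
Canonical sym_rel_encModRel := defaultEncModRel sym_rel.

Definition Sym : Type := quotient_topology {eq_quot sym_rel}.
HB.instance Definition _ := Topological.on Sym.

Definition multiplicities (u : 'rV[X]_m) : seq nat :=
  let s := [seq u ord0 i | i <- enum 'I_m] in
  [seq count_mem x s | x <- undup s].

Definition stratum (mu : seq nat) : set Sym :=
  [set \pi_(quotient_topology {eq_quot sym_rel}) u |
     u in [set u | perm_eq (multiplicities u) mu]].

Definition stratum_closure_compl (mu : seq nat) : Type :=
  set_type (~` closure (stratum mu)).
HB.instance Definition _ mu := Topological.on (stratum_closure_compl mu).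

End Sym.

Definition is_partition (n : nat) (lambda : seq nat) : bool :=
  [&& sorted geq lambda, all (leq 1) lambda & sumn lambda == n].

(* The partition 1^j lambda of n + j. *)
Definition add_ones (j : nat) (lambda : seq nat) : seq nat :=
  lambda ++ nseq j 1%N.

(* Main.v *)
(* Let U_m be the complement of the closed stratum in Sym^m X, where m = n + j,
   and let V_m be its preimage in X^m: the complement of a finite family of
   diagonals which is invariant under S_m.  Pushing X into the interior of a
   compact set gives an isotopy e_t of X from the identity to an embedding e_1
   whose image misses a point pt.  Let E_s : V_m -> V_m apply e_1 to all the
   coordinates and then replace the s-th one by pt, and let
   sigma : U_(m-1) -> U_m apply e_1 to all points and add pt; on quotients E_s
   is sigma after forgetting the s-th point.

   For i small with respect to m, some product of operators 1 - E_s kills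
   H_i(V_m; Q), which is thus the sum of the images of the E_s.  Indeed the pair
   (X^m, complement of the diagonal of a set partition P) has no homology below
   degree d * rank P, and every singleton block s of P allows for one more degree
   after applying 1 - E_s, which is homotopic to the difference between the
   identity and setting the s-th coordinate to pt.  Several diagonals are handled
   by Mayer-Vietoris: each step loses one degree, but joining with a diagonal of
   minimal rank increases the rank.

   Since H_i(V_m; Q) -> H_i(U_m; Q) is onto, sigma induces a surjection from
   H_i(U_(m-1); Q) to H_i(U_m; Q) for m large.  These spaces are finite
   dimensional, so the Betti numbers are eventually nonincreasing, hence
   eventually constant. *)

Require Import Defs.
From HB Require Import structures.
From mathcomp.multinomials Require Import freeg.
From mathcomp Require Import all_boot all_order all_algebra all_fingroup.
From mathcomp Require Import generic_quotient ring_quotient.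
From mathcomp Require Import all_classical all_reals.
From mathcomp Require Import topology normedtype sequences.
From mathcomp Require Import ring lra zify.

Set Implicit Arguments.
Unset Strict Implicit.
Unset Printing Implicit Defensive.

Import Order.TTheory GRing.Theory Num.Theory.
Import numFieldNormedType.Exports.

Local Open Scope classical_set_scope.
Local Open Scope ring_scope.

(** * Linear algebra in free modules *)

(** Homology groups enter only through the predicates of being a cycle and being a boundary, and are
    controlled by finite lists of generators. Vanishing is the case of the empty list, so one gluing
    argument over compact sets yields both vanishing and finite dimension; the latter uses that the
    isotopy deforms X^m into a neighbourhood of a compact set. The range of degrees comes from a
    count: the rank k of a set partition plus the number of its singleton blocks is at least m/2. As
    d is at least 2, k times d plus the number of singletons is at least k + m/2, and the summand k
    pays for the degrees lost when diagonals are joined. The delicate point is that H_i(V_m; Q) maps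
    onto H_i(U_m; Q): a singular simplex of Sym^m X need not lift to X^m, so there is no evident
    transfer on chains. Two local facts replace it: chains of the quotient modulo liftable chains
    are locally acyclic, and so are the invariant chains of X^m that vanish in the quotient. Both
    come from an equivariant contraction of a small box, and averaging over S_m is where rational
    coefficients enter. *)

Section FreeModule.
Variables (K : nzRingType) (T : choiceType).
Local Notation F := {freeg T / K}.

(** Chains lying in a subspace, small chains and chains of affine simplices in a standard simplex
    are all of this form, so a single set of closure lemmas serves them. *)
Definition suppt (Q : T -> Prop) (c : F) := forall x, coeff x c != 0 -> Q x.

Lemma supp0 Q : suppt Q 0.
Proof. by move=> x; rewrite coeff0 eqxx. Qed.

Lemma suppD Q c c' : suppt Q c -> suppt Q c' -> suppt Q (c + c').
Proof.
move=> Qc Qc' x; rewrite coeffD; have [->|/Qc //] := eqVneq (coeff x c) 0.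
by rewrite add0r; exact: Qc'.
Qed.

Lemma suppZ Q (a : K) c : suppt Q c -> suppt Q (a *: c).
Proof.
move=> Qc x; rewrite coeffZ; have [->|/Qc //] := eqVneq (coeff x c) 0.
by rewrite mulr0 eqxx.
Qed.

Lemma suppN Q c : suppt Q c -> suppt Q (- c).
Proof. by rewrite -scaleN1r; exact: suppZ. Qed.

Lemma suppB Q c c' : suppt Q c -> suppt Q c' -> suppt Q (c - c').
Proof. by move=> Qc Qc'; apply: suppD => //; exact: suppN. Qed.

Lemma supp_sum (Q : T -> Prop) (I : Type) (r : seq I) (P : pred I) (G : I -> F) :
  (forall i, P i -> suppt Q (G i)) -> suppt Q (\sum_(i <- r | P i) G i).
Proof.
move=> QG; elim/big_ind: _ => [|c c'|i Pi]; first exact: supp0.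
  exact: suppD.
exact: QG.
Qed.

Lemma suppU (Q : T -> Prop) x : Q x -> suppt Q (<< x >> : F).
Proof.
move=> Qx y; rewrite coeffU; have [<-//|_] := eqVneq x y.
by rewrite mulr0 eqxx.
Qed.

Lemma sub_supp (Q Q' : T -> Prop) c :
  (forall x, Q x -> Q' x) -> suppt Q c -> suppt Q' c.
Proof. by move=> QQ' Qc x /Qc /QQ'. Qed.

Lemma suppI (Q Q' : T -> Prop) c :
  suppt Q c -> suppt Q' c -> suppt (fun x => Q x /\ Q' x) c.
Proof. by move=> Qc Q'c x cx; split; [exact: Qc | exact: Q'c]. Qed.

Lemma suppT (Q : T -> Prop) c : (forall x, Q x) -> suppt Q c.
Proof. by move=> QT x _. Qed.

Lemma supp_false c : suppt (fun _ => False) c -> c = 0.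
Proof.
move=> c0; apply/eqP/freeg_eqP => x; rewrite coeff0.
by have [//|/c0] := eqVneq (coeff x c) 0.
Qed.

Lemma freegZU (a : K) x : << a *g x >> = a *: (<< x >> : F).
Proof.
by apply/eqP/freeg_eqP => y; rewrite coeffZ !coeffU mul1r.
Qed.

Lemma freegs_ind (Q : T -> Prop) (P : F -> Prop) c :
  suppt Q c -> P 0 -> (forall a x c', Q x -> P c' -> P (a *: << x >> + c')) ->
  P c.
Proof.
move=> Qc P0 PD; rewrite -[c]freeg_sumE big_seq_cond.
elim/big_rec: _ => // x c' /andP[]; rewrite mem_dom => /Qc Qx _ Pc'.
by rewrite freegZU; exact: PD.
Qed.

Lemma freeg_dec (c : F) : c = \sum_(x <- freeg.dom c) coeff x c *: << x >>.
Proof.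
by rewrite -[LHS]freeg_sumE; apply: eq_bigr => x _; rewrite freegZU.
Qed.

End FreeModule.

Section FreeLinear.
Variables (K : comNzRingType) (T : choiceType) (M : lmodType K).
Local Notation F := {freeg T / K}.

Lemma fglift_is_linear (f : T -> M) : linear (fglift f).
Proof.
have addf : {morph fglift f : c c' / c + c'}.
  have f0 : fglift f 0 = 0.
    by rewrite -(subrr (0 : F)) lift_is_additive subrr.
  move=> c c'; rewrite -[c' in LHS]opprK -[- c' in LHS]sub0r.
  by rewrite !lift_is_additive f0 sub0r opprK.
have f0 : fglift f 0 = 0.
  by rewrite -(subrr (0 : F)) lift_is_additive subrr.
move=> a c c'; rewrite addf; congr (_ + _).
rewrite [in RHS](freeg_dec c) [in LHS](freeg_dec c) scaler_sumr.
rewrite !(big_morph _ addf f0) scaler_sumr.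
apply: eq_bigr => x _.
by rewrite scalerA -!freegZU !liftU scalerA.
Qed.

HB.instance Definition _ (f : T -> M) :=
  GRing.isLinear.Build K F M _ (fglift f) (fglift_is_linear f).

Lemma fgliftU (f : T -> M) x : fglift f << x >> = f x.
Proof. by rewrite liftU scale1r. Qed.

Lemma lin_ext (Q : T -> Prop) (f g : {linear F -> M}) c :
  suppt Q c -> (forall x, Q x -> f << x >> = g << x >>) -> f c = g c.
Proof.
move=> Qc fg; apply: (freegs_ind (P := fun c => f c = g c) Qc); first by rewrite !linear0.
by move=> a x c' /fg fgx IH; rewrite !linearP /= fgx IH.
Qed.

Lemma linU_ext (f g : {linear F -> M}) c :
  (forall x, f << x >> = g << x >>) -> f c = g c.
Proof.
by move=> fg; apply: (@lin_ext (fun=> True)) => //; exact: suppT.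
Qed.
End FreeLinear.

Lemma supp_lin (K : comNzRingType) (T T' : choiceType)
    (f : {linear {freeg T / K} -> {freeg T' / K}})
    (Q : T -> Prop) (Q' : T' -> Prop) c :
  suppt Q c -> (forall x, Q x -> suppt Q' (f << x >>)) -> suppt Q' (f c).
Proof.
move=> Qc Qf; apply: (freegs_ind (P := fun c => suppt Q' (f c)) Qc); first by rewrite linear0; exact: supp0.
move=> a x c' Qx IH; rewrite linearP; apply: suppD => //.
by apply: suppZ; exact: Qf.
Qed.

Section Restriction.
Variables (K : comNzRingType) (T : choiceType) (P : T -> Prop).
Local Notation F := {freeg T / K}.

(** Small chains are divided between two open sets by this linear projection rather than by a
    choice. It then commutes with push-forward ([restr_push]), so the pieces of a liftable or
    invariant chain are again liftable or invariant. *)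
Definition restr : F -> F := fglift (fun x => if `[< P x >] then << x >> else 0).
HB.instance Definition _ := GRing.Linear.on restr.

Lemma restrU x : restr << x >> = if `[< P x >] then << x >> else 0.
Proof. exact: fgliftU. Qed.

Lemma supp_restr (Q : T -> Prop) c : suppt Q c -> suppt (fun x => Q x /\ P x) (restr c).
Proof.
move=> Qc; apply: (supp_lin (f := restr) Qc) => x Qx.
rewrite [GRing.Linear.sort _ _]restrU.
by case: asboolP => Px; [exact: suppU | exact: supp0].
Qed.

Lemma supp_restrC (Q : T -> Prop) c :
  suppt Q c -> suppt (fun x => Q x /\ ~ P x) (c - restr c).
Proof.
move=> Qc; pose P' c := suppt (fun x => Q x /\ ~ P x) (c - restr c).
apply: (freegs_ind (P := P') Qc); rewrite /P'; first by rewrite linear0 subr0; exact: supp0.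
move=> a x c' Qx IH; rewrite linearP /= opprD addrACA; apply: suppD => //.
rewrite restrU -scalerBr; apply: suppZ; case: asboolP => Px.
  by rewrite subrr; exact: supp0.
by rewrite subr0; exact: suppU.
Qed.

End Restriction.

(** * Formal simplicial chains and barycentric subdivision *)

Section Formal.
Variable P : choiceType.
Local Notation F := {freeg (seq P) / rat}.

Definition cone (b : P) : F -> F := fglift (fun s => << b :: s >>).
HB.instance Definition _ b := GRing.Linear.on (cone b).

Lemma coneU b s : cone b << s >> = << b :: s >>.
Proof. exact: fgliftU. Qed.

(** A formal simplex is the list of its vertices. The empty list is kept as a simplex of degree -1,
    so the complex is augmented and [fbd_cone] has no exception in degree 0. *)
Fixpoint fbd_seq (s : seq P) : F :=
  if s is a :: s' then << s' >> - cone a (fbd_seq s') else 0.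
Definition fbd : F -> F := fglift fbd_seq.
HB.instance Definition _ := GRing.Linear.on fbd.

Lemma fbdU s : fbd << s >> = fbd_seq s.
Proof. exact: fgliftU. Qed.

Lemma fbd_cone b c : fbd (cone b c) = c - cone b (fbd c).
Proof.
apply: (@linU_ext _ _ _ (fbd \o cone b) (idfun - (cone b \o fbd))) => s.
by rewrite /= [RHS]/= coneU !fbdU.
Qed.

Lemma fbd_fbd c : fbd (fbd c) = 0.
Proof.
apply: (@linU_ext _ _ _ (fbd \o fbd) (\0 : {linear F -> F})) => s.
rewrite [LHS]/= fbdU; elim: s => [|a s IH] /=; first by rewrite linear0.
by rewrite linearB /= fbdU fbd_cone IH linear0 subr0 subrr.
Qed.

Lemma supp_fbd_seq s :
  suppt (fun t => size t = (size s).-1 /\ {subset t <= s}) (fbd_seq s).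
Proof.
elim: s => [|a s IH] /=; first exact: supp0.
apply: suppB; first by apply: suppU; split=> // x xs; rewrite inE xs orbT.
case: s IH => [|b s] IH; first by rewrite linear0; exact: supp0.
apply: (supp_lin (f := cone a) IH) => t [/= st ts].
rewrite [GRing.Linear.sort _ _]coneU; apply: suppU; split => [|x].
  by rewrite /= st.
by rewrite !inE => /orP[->//|/ts]; rewrite inE => ->; rewrite orbT.
Qed.

Lemma fbd_ind (A : seq P -> Prop) :
  A [::] ->
  (forall s, s != [::] -> (forall t, size t = (size s).-1 ->
     {subset t <= s} -> A t) -> A s) -> forall s, A s.
Proof.
move=> A0 AS s; move: {2}(size s) (erefl (size s)) => n.
elim: n s => [|n IH] s; first by move=> /size0nil ->.
move=> sn; apply: AS; first by case: s sn.
by move=> t; rewrite sn /= => /IH.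
Qed.

End Formal.

Section Fmap.
Variables (P P' : choiceType) (h : P -> P').

Definition lmap : {freeg (seq P) / rat} -> {freeg (seq P') / rat} :=
  fglift (fun s => << map h s >>).
HB.instance Definition _ := GRing.Linear.on lmap.

Lemma lmapU s : lmap << s >> = << map h s >>.
Proof. exact: fgliftU. Qed.

Lemma lmap_cone b c : lmap (cone b c) = cone (h b) (lmap c).
Proof.
apply: (@linU_ext _ _ _ (lmap \o cone b) (cone (h b) \o lmap)) => s.
by rewrite [LHS]/= [RHS]/= coneU !lmapU coneU.
Qed.

Lemma lmap_fbd c : lmap (fbd c) = fbd (lmap c).
Proof.
apply: (@linU_ext _ _ _ (lmap \o @fbd P) (@fbd P' \o lmap)) => s.
rewrite [LHS]/= [RHS]/= lmapU !fbdU; elim: s => [|a s IH] /=.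
  by rewrite linear0.
by rewrite linearB /= lmapU lmap_cone IH.
Qed.
End Fmap.

(* The operator determined by op s = b_s (d s + e op (bd s)): both the
   subdivision and the chain homotopies between natural operators are of this
   form. *)
Section Recursive.
Variables (P P' : choiceType).
Local Notation F := {freeg (seq P) / rat}.
Local Notation F' := {freeg (seq P') / rat}.
Variables (e : rat) (init : F') (b : seq P -> P') (d : seq P -> F').

(** [n] is fuel for the structural recursion. The faces of [s] are shorter by exactly one, so
    [rec_op] supplies the length of [s]. *)
Fixpoint rec_seq (n : nat) (s : seq P) : F' :=
  if n is n'.+1 then
    cone (b s) (d s + e *: fglift (rec_seq n') (fbd << s >>))
  else init.
Definition rec_op : F -> F' := fglift (fun s => rec_seq (size s) s).
HB.instance Definition _ := GRing.Linear.on rec_op.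

Lemma rec_opU s : rec_op << s >> = rec_seq (size s) s.
Proof. exact: fgliftU. Qed.

Lemma rec_op0 : rec_op << [::] >> = init.
Proof. exact: rec_opU. Qed.

Lemma rec_opS s : s != [::] ->
  rec_op << s >> = cone (b s) (d s + e *: rec_op (fbd << s >>)).
Proof.
case: s => // a s _; rewrite rec_opU /=; congr (cone _ (_ + _ *: _)).
rewrite fbdU; apply: (lin_ext (f := fglift _) (g := rec_op) (@supp_fbd_seq _ (a :: s))).
by move=> t [/= st _]; rewrite rec_opU st [LHS]fgliftU.
Qed.

Lemma rec_op_supp (C : P -> Prop) (C' : P' -> Prop) k :
  suppt (fun t => size t = k /\ forall x, x \in t -> C' x) init ->
  (forall s, s != [::] -> (forall x, x \in s -> C x) -> C' (b s)) ->
  (forall s, s != [::] -> (forall x, x \in s -> C x) ->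
     suppt (fun t => (size t).+1 = (size s + k)%N /\ forall x, x \in t -> C' x) (d s)) ->
  forall s, (forall x, x \in s -> C x) ->
  suppt (fun t => size t = (size s + k)%N /\ forall x, x \in t -> C' x)
       (rec_op << s >>).
Proof.
move=> i0 Cb Cd; apply: fbd_ind => [_|s s0 IH Cs]; first by rewrite rec_op0.
rewrite rec_opS //.
have : suppt (fun t => (size t).+1 = (size s + k)%N /\ forall x, x \in t -> C' x)
    (d s + e *: rec_op (fbd << s >>)).
  apply: suppD; first exact: Cd.
  apply: suppZ; rewrite fbdU.
  apply: (supp_lin (f := rec_op) (@supp_fbd_seq _ s)) => t [st ts].
  apply: sub_supp (IH t st ts _); last by move=> x /ts /Cs.
  move=> u [-> Cu]; split=> //; rewrite st -addSn prednK //.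
  by case: (s) s0.
move=> /(supp_lin (f := cone (b s))); apply => t [st Ct].
rewrite [GRing.Linear.sort _ _]coneU; apply: suppU; split; first by rewrite /= st.
by move=> x; rewrite inE => /orP[/eqP->|/Ct//]; exact: Cb.
Qed.
End Recursive.

(** Naturality: the recursion is made of cones, boundaries, [b] and [d], and [lmap] respects the
    first two for every map of vertices. *)
Lemma rec_op_lmap (P P' Q Q' : choiceType) (h : P -> Q) (h' : P' -> Q') e init
    init' b b' d d' :
  lmap h' init = init' ->
  (forall s, s != [::] -> h' (b s) = b' (map h s)) ->
  (forall s, s != [::] -> lmap h' (d s) = d' (map h s)) ->
  forall c, lmap h' (rec_op e init b d c) = rec_op e init' b' d' (lmap h c).
Proof.
move=> i0 hb hd c.
apply: (@linU_ext _ _ _ (lmap h' \o rec_op e init b d)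
  (rec_op e init' b' d' \o lmap h)) => s.
rewrite [LHS]/= [RHS]/= lmapU; elim/fbd_ind: s => [|s s0 IH].
  by rewrite !rec_op0.
have s0' : map h s != [::] by case: (s) s0.
rewrite !rec_opS // lmap_cone hb // linearD linearZ /= hd //.
congr (cone _ (_ + _ *: _)).
rewrite -lmapU -lmap_fbd [fbd _]fbdU.
apply: (lin_ext (f := lmap h' \o rec_op e init b d)
  (g := rec_op e init' b' d' \o lmap h) (@supp_fbd_seq _ s)) => t [st ts].
by rewrite [LHS]/= [RHS]/= lmapU; exact: IH.
Qed.

Section Homotopy.
Variables (P P' : choiceType).
Local Notation F := {freeg (seq P) / rat}.
Local Notation F' := {freeg (seq P') / rat}.
Variables (f g : {linear F -> F'}) (b : seq P -> P').
Hypothesis f_fbd : forall c, fbd (f c) = f (fbd c).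
Hypothesis g_fbd : forall c, fbd (g c) = g (fbd c).
Hypothesis fg0 : f << [::] >> = g << [::] >>.

Definition hom_op := rec_op (-1) 0 b (fun s => f << s >> - g << s >>).
HB.instance Definition _ := GRing.Linear.on hom_op.

(** Acyclic models: once the formula holds on the faces of [s], the chain
    [f s - g s - hom_op (fbd s)] is a cycle, and its cone at [b s] has it as boundary. *)
Lemma hom_opE c : fbd (hom_op c) = f c - g c - hom_op (fbd c).
Proof.
apply: (@linU_ext _ _ _ (@fbd P' \o hom_op) (f \- g \- (hom_op \o @fbd P))) => s.
rewrite [LHS]/= [RHS]/=; elim/fbd_ind: s => [|s s0 IH].
  by rewrite /hom_op fbdU /= !linear0 rec_op0 fg0 subrr addr0 linear0.
rewrite {1}/hom_op rec_opS // fbd_cone scaleN1r.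
suff -> : fbd (f << s >> - g << s >> - hom_op (fbd << s >>)) = 0.
  by rewrite linear0 subr0.
rewrite linearB /=; have -> : fbd (hom_op (fbd << s >>)) =
    f (fbd << s >>) - g (fbd << s >>) - hom_op (fbd (fbd << s >>)).
  rewrite fbdU.
  have Q := @lin_ext _ _ _ _ (@fbd P' \o hom_op)
    (f \- g \- (hom_op \o @fbd P)) _ (@supp_fbd_seq _ s).
  by apply: Q => t [st ts]; exact: IH.
by rewrite linearB /= f_fbd g_fbd fbd_fbd linear0 subr0 subrr.
Qed.
End Homotopy.

(** * Barycentric subdivision of formal simplices *)

Section Subdivision.
Variables (R : realType) (P : lmodType R).
Local Notation F := {freeg (seq P) / rat}.

Definition bary (s : seq P) : P := (size s)%:R^-1 *: \sum_(x <- s) x.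

Definition fsd : F -> F := rec_op 1 << [::] >> bary (fun=> 0).
HB.instance Definition _ := GRing.Linear.on fsd.

Lemma fsd0 : fsd << [::] >> = << [::] >>.
Proof. exact: rec_op0. Qed.

Lemma fsdS s : s != [::] -> fsd << s >> = cone (bary s) (fsd (fbd << s >>)).
Proof. by move=> s0; rewrite /fsd rec_opS // add0r scale1r. Qed.

Lemma fsd_fbd c : fbd (fsd c) = fsd (fbd c).
Proof.
apply: (@linU_ext _ _ _ (@fbd P \o fsd) (fsd \o @fbd P)) => s.
rewrite [LHS]/= [RHS]/=; elim/fbd_ind: s => [|s s0 IH].
  by rewrite fsd0 fbdU /= linear0.
rewrite fsdS // fbd_cone.
have -> : fbd (fsd (fbd << s >>)) = fsd (fbd (fbd << s >>)).
  rewrite fbdU.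
  have Q := @lin_ext _ _ _ _ (@fbd P \o fsd) (fsd \o @fbd P) _ (@supp_fbd_seq _ s).
  by apply: Q => t [st ts]; exact: IH.
by rewrite fbd_fbd !linear0 addr0.
Qed.

Definition fhs : F -> F := hom_op idfun fsd bary.
HB.instance Definition _ := GRing.Linear.on fhs.

Lemma fhsE c : fbd (fhs c) = c - fsd c - fhs (fbd c).
Proof. by apply: hom_opE => //= *; rewrite ?fsd_fbd ?fsd0. Qed.

End Subdivision.

Section Convex.
Variables (R : realType) (P : lmodType R).

Definition convexp (C : P -> Prop) := forall (s : seq P) (a : nat -> R),
  (forall x, x \in s -> C x) -> (forall i, 0 <= a i) ->
  \sum_(i < size s) a i = 1 -> C (\sum_(i < size s) a i *: nth 0 s i).

Lemma convexp_bary C s : convexp C -> s != [::] ->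
  (forall x, x \in s -> C x) -> C (bary s).
Proof.
move=> cC s0 sC; rewrite /bary scaler_sumr (big_nth 0) big_mkord.
apply: (cC s (fun=> (size s)%:R^-1)) => //; first by move=> i; rewrite invr_ge0.
rewrite sumr_const card_ord -[LHS]mulr_natr mulVf // pnatr_eq0.
by case: (s) s0.
Qed.

Lemma fsd_supp C : convexp C -> forall s, (forall x, x \in s -> C x) ->
  suppt (fun t => size t = (size s + 0)%N /\ forall x, x \in t -> C x) (fsd << s >>).
Proof.
move=> cC; apply: rec_op_supp; first by apply: suppU.
  by move=> s s0; exact: convexp_bary.
by move=> s _ _; exact: supp0.
Qed.

Lemma fhs_supp C : convexp C -> forall s, (forall x, x \in s -> C x) ->
  suppt (fun t => size t = (size s + 1)%N /\ forall x, x \in t -> C x) (fhs << s >>).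
Proof.
move=> cC; apply: rec_op_supp; first exact: supp0.
  by move=> s s0; exact: convexp_bary.
move=> s s0 Cs; apply: suppB => /=.
  by apply: suppU; rewrite addn1.
apply: sub_supp (fsd_supp cC Cs) => t [-> Ct]; split=> //.
by rewrite addn0 addn1.
Qed.
End Convex.

Section LinearNat.
Variables (R : realType) (P Q : lmodType R) (h : {linear P -> Q}).

Lemma bary_map s : h (bary s) = bary (map h s).
Proof. by rewrite /bary linearZ /= size_map linear_sum big_map. Qed.

Lemma fsd_map c : lmap h (fsd c) = fsd (lmap h c).
Proof.
apply: rec_op_lmap => [|s _|s _]; first by rewrite lmapU.
  exact: bary_map.
by rewrite linear0.
Qed.

Lemma fhs_map c : lmap h (fhs c) = fhs (lmap h c).
Proof.
apply: rec_op_lmap => [|s _|s _]; first by rewrite linear0.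
  exact: bary_map.
by rewrite linearB /= fsd_map !lmapU.
Qed.
End LinearNat.

(** * The formal prism operator *)

Section Prism.
Variables (R : realType) (P : lmodType R).
Local Notation F := {freeg (seq P) / rat}.
Local Notation F' := {freeg (seq (P * R^o)%type) / rat}.

Definition fat (a : R^o) : F -> F' := lmap (fun x => (x, a)).
HB.instance Definition _ a := GRing.Linear.on (fat a).

Lemma fatU a s : fat a << s >> = << [seq (x, a) | x <- s] >>.
Proof. exact: lmapU. Qed.

Lemma fat_fbd a c : fbd (fat a c) = fat a (fbd c).
Proof. by rewrite /fat lmap_fbd. Qed.

(** The apex is the bottom copy of the first vertex. This choice commutes with every map of vertices
    and, unlike a barycentre, asks for no convexity. The degenerate simplices that arise are
    harmless, as chains are not normalised. *)
Definition fprism : F -> F' :=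
  hom_op (@fat 1) (@fat 0) (fun s => (head 0 s, 0)).
HB.instance Definition _ := GRing.Linear.on fprism.

Lemma fprismE c : fbd (fprism c) = fat 1 c - fat 0 c - fprism (fbd c).
Proof.
apply: hom_opE; [exact: fat_fbd | exact: fat_fbd |].
by rewrite [LHS]fatU [RHS]fatU.
Qed.

Lemma fprism_supp (C : P -> Prop) s : (forall x, x \in s -> C x) ->
  suppt (fun t => size t = (size s + 1)%N /\
    forall x, x \in t -> C x.1 /\ 0 <= x.2 <= 1) (fprism << s >>).
Proof.
move: s; apply: rec_op_supp; first exact: supp0.
  by move=> [//|x s] _ Cs /=; split; [apply: Cs; rewrite inE eqxx | rewrite lexx ler01].
move=> s s0 Cs; apply: suppB; rewrite [GRing.Linear.sort _ _]fatU; apply: suppU; rewrite size_map addn1.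
  split=> // _ /mapP[x xs ->] /=; split; [exact: Cs | by rewrite lexx ler01].
split=> // _ /mapP[x xs ->] /=; split; [exact: Cs | by rewrite lexx ler01].
Qed.
End Prism.

Lemma fat_map (R : realType) (P Q : lmodType R) (h : {linear P -> Q}) a c :
  lmap (fun p : P * R^o => (h p.1, p.2)) (fat a c) = fat a (lmap h c).
Proof.
apply: (@linU_ext _ _ _ (lmap (fun p : P * R^o => (h p.1, p.2)) \o fat a)
  (fat a \o lmap h)) => s.
rewrite [LHS]/= [RHS]/= lmapU !fatU lmapU -!map_comp.
by congr << _ >>; apply: eq_map.
Qed.

Lemma fprism_map (R : realType) (P Q : lmodType R) (h : {linear P -> Q}) c :
  lmap (fun p : P * R^o => (h p.1, p.2)) (fprism c) = fprism (lmap h c).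
Proof.
apply: rec_op_lmap => [|[//|x s] _|s _] //; first by rewrite linear0.
by rewrite linearB /= !fat_map !lmapU.
Qed.

(** * Natural operators on singular chains *)

Lemma mx_coord_continuous (X : topologicalType) m n (i : 'I_m) (j : 'I_n) :
  continuous (fun x : 'M[X]_(m, n) => x i j).
Proof.
move=> x W Wx; exists (fun i' j' => if (i' == i) && (j' == j) then W else setT).
  by move=> i' j'; case: ifP => [/andP[/eqP -> /eqP ->]//|_]; exact: filterT.
by move=> y /(_ i j); rewrite !eqxx.
Qed.

Lemma mx_continuous (T X : topologicalType) m n (f : T -> 'M[X]_(m, n)) :
  (forall i j, continuous (fun t => f t i j)) -> continuous f.
Proof.
move=> fc t W [Q Qf QW].
have : \forall s \near t, forall ij : 'I_m * 'I_n, Q ij.1 ij.2 (f s ij.1 ij.2).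
  by apply: filter_forall => ij; exact: fc.
by apply: filterS => s Qs; apply: QW => i j; exact: (Qs (i, j)).
Qed.

Lemma pair_continuous (T U V : topologicalType) (f : T -> U) (g : T -> V) :
  continuous f -> continuous g -> continuous (fun t => (f t, g t)).
Proof. by move=> fc gc t; apply: cvg_pair; [exact: fc | exact: gc]. Qed.

Lemma sub_continuous (T U : topologicalType) (A : set U) (f : T -> A) :
  continuous (fun t => \val (f t)) -> continuous f.
Proof. by move=> fc; apply: (@continuous_comp_initial _ T _ set_val f). Qed.

Lemma val_continuous (U : topologicalType) (A : set U) :
  continuous (\val : A -> U).
Proof. exact: (@initial_continuous _ U set_val). Qed.

Lemma continuous_sumR (R : realType) (T : topologicalType) (I : Type) (r : seq I)
    (f : I -> T -> R) :
  (forall i, continuous (f i)) -> continuous (fun t => \sum_(i <- r) f i t).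
Proof.
by move=> fc; apply: continuous_big => //; exact: add_continuous.
Qed.

Section Combination.
Variables (R : realType).
Local Notation D n := (std_simplex R n).

Lemma simplex_ge0 n (t : D n) i : 0 <= \val t ord0 i.
Proof. by case: t => t /= /set_mem[]. Qed.

Lemma simplex_sum1 n (t : D n) : \sum_i \val t ord0 i = 1.
Proof. by case: t => t /= /set_mem[]. Qed.

Lemma simplex_vertex n (i : 'I_n.+1) : delta_mx ord0 i \in std_simplex R n.
Proof.
apply/mem_set; split=> [j|]; first by rewrite mxE; case: eqP; case: eqP.
rewrite (bigD1 i) //= mxE !eqxx big1 ?addr0 // => j /negPf ji.
by rewrite mxE eqxx ji.
Qed.

Definition vertex n (i : 'I_n.+1) : D n :=
  exist (fun w => w \in D n) _ (simplex_vertex i).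

Definition combo (P : lmodType R) k (s : seq P) (t : D k) : P :=
  \sum_(i < k.+1) \val t ord0 i *: nth 0 s i.

Lemma combo_map (P Q : lmodType R) (h : {linear P -> Q}) k s (t : D k) :
  h (combo s t) = combo (map h s) t.
Proof.
rewrite /combo linear_sum; apply: eq_bigr => i _; rewrite linearZ /=.
congr (_ *: _); have [si|si] := ltnP i (size s).
  by rewrite (nth_map 0).
by rewrite !nth_default ?size_map // linear0.
Qed.

Lemma combo_fst (P : lmodType R) k s (t : D k) :
  (combo s t : P * R^o).1 = combo (map fst s) t.
Proof. exact: (combo_map (fst : {linear (P * R^o)%type -> P})). Qed.

Lemma combo_snd (P : lmodType R) k s (t : D k) :
  (combo s t : P * R^o).2 = combo (map snd s) t.
Proof. exact: (combo_map (snd : {linear (P * R^o)%type -> R^o})). Qed.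

Lemma combo_convex (P : lmodType R) (C : P -> Prop) k s (t : D k) :
  convexp C -> size s = k.+1 -> (forall x, x \in s -> C x) -> C (combo s t).
Proof.
move=> cC sk Cs.
pose a i := if insub i is Some j then \val t ord0 j else 0.
have aE (i : 'I_k.+1) : a i = \val t ord0 i by rewrite /a valK.
have -> : combo s t = \sum_(i < k.+1) a i *: nth 0 s i.
  by apply: eq_bigr => i _; rewrite aE.
rewrite -sk; apply: cC => // [i|].
  by rewrite /a; case: insubP => // *; exact: simplex_ge0.
rewrite sk -[RHS](simplex_sum1 t); apply: eq_bigr => i _; exact: aE.
Qed.

Lemma convexp_simplex n : convexp (fun v : 'rV[R]_n.+1 => v \in D n).
Proof.
move=> s a sD a0 a1; apply/mem_set; split=> [i|].
  rewrite summxE sumr_ge0 // => j _; rewrite mxE mulr_ge0 //.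
  by have /sD/set_mem[] := mem_nth 0 (ltn_ord j).
under eq_bigr do rewrite summxE; rewrite exchange_big /= -[RHS]a1.
apply: eq_bigr => j _; under eq_bigr do rewrite mxE.
rewrite -mulr_sumr.
by have /sD/set_mem[_ ->] := mem_nth 0 (ltn_ord j); rewrite mulr1.
Qed.

Lemma convexp_unit : convexp (fun a : R^o => 0 <= a <= 1).
Proof.
move=> s a sI a0 a1; have sI' (i : 'I_(size s)) : 0 <= nth 0 s i <= 1.
  by apply: sI; exact: mem_nth.
apply/andP; split.
  by apply: sumr_ge0 => i _; rewrite mulr_ge0 //; have /andP[] := sI' i.
rewrite -a1; apply: ler_sum => i _; rewrite -[leRHS]mulr1 ler_wpM2l //.
by have /andP[] := sI' i.
Qed.

Lemma simplex_coord_continuous k (l : 'I_k.+1) :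
  continuous (fun t : D k => \val t ord0 l).
Proof.
move=> t; exact: (continuous_comp (@val_continuous _ (std_simplex R k) t)
  (@mx_coord_continuous R 1 k.+1 ord0 l _)).
Qed.

Lemma combo_cts_rV n k (s : seq 'rV[R]_n) :
  continuous (fun t : D k => combo s t).
Proof.
apply: mx_continuous => i j.
have -> : (fun t : D k => combo s t i j) =
    (fun t : D k => \sum_(l < k.+1) \val t ord0 l * nth 0 s l i j).
  by apply/funext => t; rewrite /combo summxE; apply: eq_bigr => l _; rewrite mxE.
apply: continuous_sumR => l t.
exact: (cvgM (@simplex_coord_continuous _ l t) (cvg_cst _)).
Qed.

Lemma combo_cts_R k (s : seq R^o) :
  continuous (fun t : D k => combo s t : R).
Proof.
apply: continuous_sumR => l t.
exact: (cvgM (@simplex_coord_continuous _ l t) (cvg_cst _)).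
Qed.

(** Totality keeps membership proofs out of formulas; the default vertex is never met when affine
    simplices inside the standard simplex are evaluated. *)
Definition to_simplex n (v : 'rV[R]_n.+1) : D n := insubd (vertex ord0) v.

Lemma to_simplexK n (v : 'rV[R]_n.+1) : v \in D n -> \val (to_simplex v) = v.
Proof. exact: insubdK. Qed.

Lemma to_simplex_val n (t : D n) : to_simplex (\val t) = t.
Proof. exact: valKd. Qed.

End Combination.

Section Realization.
Variables (R : realType) (E : topologicalType).
Local Notation D n := (std_simplex R n).

(** The value 0 on discontinuous maps makes push-forward and evaluation total linear operators.
    Their formulas then need continuity only along the simplices that occur in a chain. *)
Definition mksing n (h : D n -> E) : chain R rat E n :=
  match pselect (continuous h) with
  | left hc => << (mkcts hc : continuousType _ _) >>
  | right _ => 0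
  end.

Lemma mksingE n (h : D n -> E) (s : singular R E n) : h =1 s -> mksing h = << s >>.
Proof.
move=> /funext ->; rewrite /mksing; case: pselect => [hc|]; last first.
  by case; exact: cts_fun.
by congr << _ >>; apply/continuousEP.
Qed.

Lemma supp_mksing n (h : D n -> E) (Q : singular R E n -> Prop) :
  (forall s : singular R E n, h =1 s -> Q s) -> suppt Q (mksing h).
Proof.
move=> hQ; rewrite /mksing; case: pselect => [hc|_]; last exact: supp0.
by apply: suppU; exact: hQ.
Qed.

Lemma mksing_ex n (h : D n -> E) : continuous h ->
  exists2 s : singular R E n, h =1 s & mksing h = << s >>.
Proof. by move=> hc; exists (mkcts hc) => //; exact: mksingE. Qed.

End Realization.

Lemma insert0_linear (R : realType) n (k : 'I_n.+2) :
  linear (@insert0 R n k).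
Proof.
move=> a u v; apply/rowP => i; rewrite !mxE.
by case: unliftP => [j _|_] /=; rewrite ?mxE // mulr0 addr0.
Qed.
HB.instance Definition _ (R : realType) n (k : 'I_n.+2) :=
  GRing.isLinear.Build R 'rV[R]_n.+1 'rV[R]_n.+2 _ (@insert0 R n k)
    (@insert0_linear R n k).

Section BoundaryLinear.
Variables (R : realType) (X : topologicalType).

Lemma boundary_is_linear n : linear (@boundary R rat X n).
Proof. by move=> a c c'; rewrite boundaryD boundaryZ. Qed.
HB.instance Definition _ n :=
  GRing.isLinear.Build rat (chain R rat X n) (chain R rat X n.-1) _
    (@boundary R rat X n) (@boundary_is_linear n).

Lemma boundaryU n (s : singular R X n.+1) :
  boundary (<< s >> : chain R rat X n.+1) =
  \sum_(k < n.+2) (-1) ^+ k *: (<< face_map k s >> : chain R rat X n).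
Proof. exact: fgliftU. Qed.
End BoundaryLinear.

Section DropAt.
Variable P : choiceType.

Definition del i (s : seq P) := take i s ++ drop i.+1 s.

Lemma fbd_seqE (s : seq P) :
  fbd_seq s = \sum_(i < size s) (-1) ^+ i *: << del i s >>.
Proof.
elim: s => [|a s IH] /=; first by rewrite big_ord0.
rewrite big_ord_recl /del /= drop0 expr0 scale1r IH linear_sum /= -sumrN.
congr (_ + _); apply: eq_bigr => i _.
by rewrite linearZ /= coneU exprS mulN1r scaleNr.
Qed.

Lemma size_del i (s : seq P) : (i < size s)%N -> size (del i s) = (size s).-1.
Proof.
move=> si; rewrite size_cat size_take size_drop si.
by case: (size s) si => // m; rewrite subSS /= => im; rewrite subnKC.
Qed.

Lemma nth_del x0 i (s : seq P) j : (i < size s)%N ->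
  nth x0 (del i s) j = nth x0 s (bump i j).
Proof.
move=> si; rewrite nth_cat size_take si /bump.
case: ltnP => ij; first by rewrite nth_take // leqNgt ij.
by rewrite nth_drop; congr nth; lia.
Qed.

Lemma mem_del i (s : seq P) : {subset del i s <= s}.
Proof. by move=> x; rewrite mem_cat => /orP[/mem_take|/mem_drop]. Qed.
End DropAt.

Section SingularOperators.
Variables (R : realType).
Local Notation D n := (std_simplex R n).
Local Notation V n := 'rV[R]_n.+1.
Local Notation VR n := ('rV[R]_n.+1 * R^o)%type.

(** The identity simplex of the standard simplex, which is the universal model at which natural
    operators are evaluated. *)
Definition iota_s n : seq (V n) := [seq delta_mx ord0 i | i <- enum 'I_n.+1].

Lemma size_iota_s n : size (iota_s n) = n.+1.
Proof. by rewrite size_map size_enum_ord. Qed.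

Lemma iota_s_simplex n x : x \in iota_s n -> x \in D n.
Proof. by move=> /mapP[i _ ->]; exact: simplex_vertex. Qed.

Lemma nth_iota_s n (i : 'I_n.+1) : nth 0 (iota_s n) i = delta_mx ord0 i.
Proof. by rewrite (nth_map ord0) ?size_enum_ord // nth_ord_enum. Qed.

Lemma combo_iota n (t : D n) : combo (iota_s n) t = \val t.
Proof.
apply/rowP => j; rewrite /combo summxE (bigD1 j) //= nth_iota_s !mxE !eqxx mulr1.
rewrite big1 ?addr0 // => i /negPf ij.
by rewrite nth_iota_s !mxE eqxx eq_sym ij mulr0.
Qed.

Lemma del_iota n (i : 'I_n.+2) :
  del i (iota_s n.+1) = map (insert0 i) (iota_s n).
Proof.
have si : (i < size (iota_s n.+1))%N by rewrite size_iota_s.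
apply: (@eq_from_nth _ 0); first by rewrite size_del // size_iota_s size_map size_iota_s.
rewrite size_del // size_iota_s /= => j jn; rewrite nth_del //.
rewrite [RHS](nth_map 0) ?size_iota_s //.
rewrite -[j]/(nat_of_ord (Ordinal jn)) nth_iota_s -/(lift i (Ordinal jn)).
rewrite (nth_iota_s (lift i (Ordinal jn))).
apply/rowP => l; rewrite !mxE; case: unliftP => [l' ->|->] /=.
  by rewrite mxE (inj_eq lift_inj).
by rewrite (negPf (neq_lift _ _)).
Qed.

Definition good n k (s : seq (VR n)) :=
  size s = k.+1 /\ forall x, x \in s -> x.1 \in D n /\ 0 <= x.2 <= 1.

Section Homotopy.
Variables (E E' : topologicalType) (H : E -> R -> E').

Definition real n (f : D n -> E) k (s : seq (VR n)) (t : D k) : E' :=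
  H (f (to_simplex (combo s t).1)) (combo s t).2.

(** Continuity of [H] is demanded only along [f], since the homotopies used later are built from
    charts and are continuous on a subset of [E]. *)
Definition adm n (f : D n -> E) := forall k (u : D k -> D n) (tau : D k -> R),
  continuous u -> continuous tau -> (forall t, 0 <= tau t <= 1) ->
  continuous (fun t => H (f (u t)) (tau t)).

Lemma good_combo n k (s : seq (VR n)) (t : D k) : good k s ->
  (combo s t).1 \in D n /\ 0 <= (combo s t).2 <= 1.
Proof.
move=> [sk sD]; rewrite combo_fst combo_snd; split.
  apply: (@combo_convex _ _ (fun v => v \in D n)).
  - exact: convexp_simplex.
  - by rewrite size_map.
  - by move=> _ /mapP[x /sD[xD _] ->].
apply: (@combo_convex _ R^o (fun a => 0 <= a <= 1)).
- exact: convexp_unit.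
- by rewrite size_map.
- by move=> _ /mapP[x /sD[_ xI] ->].
Qed.

Lemma real_cts n (f : D n -> E) k s : adm f -> good k s ->
  continuous (real f s : D k -> E').
Proof.
move=> fadm gs; apply: fadm.
- apply: sub_continuous.
  have -> : (fun t : D k => \val (to_simplex (combo s t).1)) =
      (fun t : D k => combo (map fst s) t).
    apply/funext => t; rewrite to_simplexK ?combo_fst //.
    by rewrite -combo_fst; exact: (good_combo t gs).1.
  exact: combo_cts_rV.
- have -> : (fun t : D k => (combo s t).2) = (fun t : D k => combo (map snd s) t).
    by apply/funext => t; rewrite combo_snd.
  exact: combo_cts_R.
- by move=> t; exact: (good_combo t gs).2.
Qed.

Definition ev n (f : D n -> E) k : {freeg (seq (VR n)) / rat} -> chain R rat E' k :=
  fglift (fun s => mksing (real f s : D k -> E')).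
HB.instance Definition _ n f k := GRing.Linear.on (@ev n f k).

Lemma evU n (f : D n -> E) k s : ev f k << s >> = mksing (real f s : D k -> E').
Proof. exact: fgliftU. Qed.

Lemma combo_face (P : lmodType R) k (s : seq P) (i : 'I_k.+2) (t : D k) :
  size s = k.+2 -> combo s (face i t) = combo (del i s) t.
Proof.
move=> sk; rewrite /combo (bigD1_ord i) //= mxE unlift_none /= scale0r add0r.
apply: eq_bigr => j _; rewrite mxE liftK /=; congr (_ *: _).
by rewrite nth_del // sk.
Qed.

Lemma ev_bd n (f : D n -> E) k c : adm f -> suppt (good (n := n) k.+1) c ->
  boundary (ev f k.+1 c) = ev f k (fbd c).
Proof.
move=> fadm gc.
apply: (@lin_ext _ _ _ _ (@boundary R rat E' k.+1 \o ev f k.+1)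
  (ev f k \o @fbd _) _ gc) => s gs.
rewrite [LHS]/= [RHS]/= evU fbdU fbd_seqE.
have [sg sgE ->] := mksing_ex (real_cts fadm gs).
rewrite [LHS]boundaryU linear_sum (gs.1); apply: eq_bigr => i _.
rewrite linearZ /= evU; congr (_ *: _); symmetry; apply: mksingE => t /=.
by rewrite -sgE /real combo_face ?gs.1.
Qed.

Lemma good_del n k (s : seq (VR n)) (i : 'I_k.+2) : good k.+1 s -> good k (del i s).
Proof.
move=> [sk sD]; split; first by rewrite size_del sk.
by move=> x /mem_del /sD.
Qed.

End Homotopy.

(* op plays the role of a natural transformation from the affine simplices of
   the standard simplices to those of their cylinders; it raises the degree
   by r. *)
Record natop (r : nat) := NatOp {
  natop_fun :> forall n, {linear {freeg (seq (V n)) / rat} -> {freeg (seq (VR n)) / rat}};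
  natop_map : forall n (i : 'I_n.+2) c,
    lmap (fun p : VR n => (insert0 i p.1, p.2)) (natop_fun n c) =
    natop_fun n.+1 (lmap (insert0 i) c);
  natop_supp : forall n s, (forall x, x \in s -> x \in D n) ->
    suppt (fun t => size t = (size s + r)%N /\
      forall x, x \in t -> x.1 \in D n /\ 0 <= x.2 <= 1)
    (natop_fun n << s >>) }.

Section Sop.
Variables (E E' : topologicalType) (H : E -> R -> E') (r : nat) (op : natop r).

Definition sop n k : chain R rat E n -> chain R rat E' k :=
  fglift (fun s : singular R E n => ev H s k (op n << iota_s n >>)).
HB.instance Definition _ n k := GRing.Linear.on (@sop n k).

Lemma sopU n k (s : singular R E n) :
  sop k (<< s >> : chain R rat E n) = ev H s k (op n << iota_s n >>).
Proof. exact: fgliftU. Qed.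

Lemma natop_good n k (s : seq (V n)) : (forall x, x \in s -> x \in D n) ->
  (size s + r = k.+1)%N -> suppt (good (n := n) k) (op n << s >>).
Proof.
move=> sD sk; have := @natop_supp _ op _ _ sD; apply: sub_supp => t [st tD].
by split=> //; rewrite st.
Qed.

Lemma sop_bd n k (s : singular R E n) : adm H s -> (n + r = k.+1)%N ->
  boundary (sop k.+1 (<< s >> : chain R rat E n)) =
  ev H s k (fbd (op n << iota_s n >>)).
Proof.
move=> sadm nk; rewrite sopU ev_bd //; apply: natop_good => [x|].
  exact: iota_s_simplex.
by rewrite size_iota_s addSn nk.
Qed.

(** A face of [s] is [s] composed with [insert0 i], and the i-th face of the universal simplex is
    the image of the smaller universal simplex under the same map; naturality of [op] identifies the
    two evaluations. *)
Lemma bd_sop n k (s : singular R E n.+1) : (n + r = k)%N ->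
  sop k (boundary (<< s >> : chain R rat E n.+1)) =
  ev H s k (op n.+1 (fbd << iota_s n.+1 >>)).
Proof.
move=> nk; rewrite boundaryU fbdU fbd_seqE size_iota_s !linear_sum.
apply: eq_bigr => i _; rewrite !linearZ /=; congr (_ *: _).
rewrite sopU del_iota -(lmapU (insert0 i)) -natop_map.
have gi : suppt (good (n := n) k) (op n << iota_s n >>).
  apply: natop_good => [x|]; first exact: iota_s_simplex.
  by rewrite size_iota_s addSn nk.
apply: (@lin_ext _ _ _ _ (ev H (face_map i s) k) (ev H s k \o lmap _) _ gi) => t gt.
rewrite [LHS]evU [RHS]/= lmapU evU; congr mksing; apply/funext => x.
rewrite /real !combo_fst !combo_snd -!map_comp /=.
congr (H (s _) _).
have -> : map (fst \o (fun p : VR n => (insert0 i p.1, p.2))) t =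
    map (insert0 i) (map fst t) by rewrite -map_comp; apply: eq_map.
rewrite -(combo_map (insert0 i)).
have w : combo (map fst t) x \in D n by rewrite -combo_fst; exact: (good_combo _ gt).1.
have w' : insert0 i (combo (map fst t) x) \in D n.+1.
  by have := insert0_simplex i (to_simplex (combo (map fst t) x)); rewrite to_simplexK.
apply/val_inj.
exact: (etrans (congr1 (insert0 i) (to_simplexK w)) (esym (to_simplexK w'))).
Qed.

Lemma sop_supp (A : set E) (B : set E') n k (c : chain R rat E n) :
  (n + r = k)%N ->
  (forall x a, A x -> 0 <= a <= 1 -> B (H x a)) ->
  suppt (fun s : singular R E n => forall x, A (s x)) c ->
  suppt (fun s : singular R E' k => forall x, B (s x)) (sop k c).
Proof.
move=> nk HB Ac; apply: (supp_lin (f := @sop n k) Ac) => s As.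
rewrite [GRing.Linear.sort _ _]sopU.
have gi : suppt (good (n := n) k) (op n << iota_s n >>).
  apply: natop_good => [x|]; first exact: iota_s_simplex.
  by rewrite size_iota_s addSn nk.
apply: (supp_lin (f := ev H s k) gi) => t gt.
rewrite [GRing.Linear.sort _ _]evU; apply: supp_mksing => s' ss' x.
by rewrite -ss'; apply: HB => //; exact: (good_combo x gt).2.
Qed.

End Sop.
End SingularOperators.

(** * Subdivision, prism and push-forward of singular chains *)

Section NaturalOperators.
Variable R : realType.
Local Notation D n := (std_simplex R n).

Lemma fat_natop_map a n (i : 'I_n.+2) c :
  lmap (fun p : 'rV[R]_n.+1 * R^o => (insert0 i p.1, p.2)) (fat a c) =
  fat a (lmap (insert0 i) c).
Proof. exact: (fat_map (insert0 i)). Qed.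

Lemma fat_natop_supp (a : R) r n (c : {freeg (seq 'rV[R]_n.+1) / rat}) k :
  0 <= a <= 1 ->
  suppt (fun t => size t = (k + r)%N /\ forall x, x \in t -> x \in D n) c ->
  suppt (fun t => size t = (k + r)%N /\
      forall x, x \in t -> x.1 \in D n /\ 0 <= x.2 <= 1) (fat a c).
Proof.
move=> a01 cD; apply: (supp_lin (f := fat a) cD) => t [st tD].
rewrite [GRing.Linear.sort _ _]fatU; apply: suppU; rewrite size_map; split=> //.
by move=> _ /mapP[x /tD xD ->].
Qed.

Lemma unit0 : 0 <= (0 : R) <= 1. Proof. by rewrite lexx ler01. Qed.
Lemma unit1 : 0 <= (1 : R) <= 1. Proof. by rewrite lexx ler01. Qed.

Definition op_at (a : R) (a01 : 0 <= a <= 1) : natop R 0.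
Proof.
exists (fun n => fat a) => [n i c|n s sD]; first exact: fat_natop_map.
by apply: fat_natop_supp => //; apply: suppU; rewrite addn0.
Defined.

(** An operator without homotopy parameter is placed at the bottom of the cylinder. With an [H] that
    ignores the parameter it fits the same formalism as the prism. *)
Definition op_sd : natop R 0.
Proof.
exists (fun n => fat 0 \o (@fsd R 'rV[R]_n.+1)) => [n i c|n s sD].
  rewrite [LHS]fat_natop_map [RHS]/=; congr fat.
  exact: (fsd_map (insert0 i)).
apply: fat_natop_supp; first exact: unit0.
by apply: fsd_supp => //; exact: convexp_simplex.
Defined.

Definition op_hsd : natop R 1.
Proof.
exists (fun n => fat 0 \o (@fhs R 'rV[R]_n.+1)) => [n i c|n s sD].
  rewrite [LHS]fat_natop_map [RHS]/=; congr fat.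
  exact: (fhs_map (insert0 i)).
apply: fat_natop_supp; first exact: unit0.
by apply: fhs_supp => //; exact: convexp_simplex.
Defined.

Definition op_prism : natop R 1.
Proof.
exists (fun n => @fprism R 'rV[R]_n.+1) => [n i c|n s sD].
  exact: (fprism_map (insert0 i)).
by apply: (fprism_supp (C := fun x => x \in D n)).
Defined.

Definition push (E E' : topologicalType) (f : E -> E') n :
    chain R rat E n -> chain R rat E' n :=
  fglift (fun s : singular R E n => mksing (f \o s : D n -> E')).
HB.instance Definition _ E E' f n := GRing.Linear.on (@push E E' f n).

Section Push.
Variables (E E' : topologicalType) (f : E -> E').

Lemma pushU n (s : singular R E n) :
  push f (<< s >> : chain R rat E n) = mksing (f \o s : D n -> E').
Proof. exact: fgliftU. Qed.

Lemma push_cts n (s : singular R E n) (s' : singular R E' n) :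
  f \o s =1 s' -> push f (<< s >> : chain R rat E n) = << s' >>.
Proof. by move=> ss'; rewrite pushU; exact: mksingE. Qed.

Lemma push_bd n (c : chain R rat E n) :
  suppt (fun s : singular R E n => continuous (f \o s)) c ->
  boundary (push f c) = push f (boundary c).
Proof.
case: n c => [c _|n c fc]; first by rewrite /= linear0.
apply: (@lin_ext _ _ _ _ (@boundary R rat E' n.+1 \o @push E E' f n.+1)
  (@push E E' f n \o @boundary R rat E n.+1) _ fc) => s sc.
rewrite [LHS]/= [RHS]/= pushU; have [s' ss' ->] := mksing_ex sc.
rewrite [LHS]boundaryU [X in push f X]boundaryU linear_sum.
apply: eq_bigr => i _; rewrite linearZ /=; congr (_ *: _).
by symmetry; apply: push_cts => x; rewrite /= -ss'.
Qed.

Lemma push_supp (A : set E) (B : set E') n (c : chain R rat E n) :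
  (forall x, A x -> B (f x)) ->
  suppt (fun s : singular R E n => forall x, A (s x)) c ->
  suppt (fun s : singular R E' n => forall x, B (s x)) (push f c).
Proof.
move=> AB Ac; apply: (supp_lin (f := @push E E' f n) Ac) => s As.
rewrite [GRing.Linear.sort _ _]pushU; apply: supp_mksing => s' ss' x.
by rewrite -ss'; apply: AB.
Qed.
End Push.

Lemma push_comp (E E' E'' : topologicalType) (f : E -> E') (g : E' -> E'') n
    (c : chain R rat E n) :
  suppt (fun s : singular R E n => continuous (f \o s)) c ->
  push g (push f c) = push (g \o f) c.
Proof.
move=> fc; apply: (@lin_ext _ _ _ _ (@push E' E'' g n \o @push E E' f n)
  (@push E E'' (g \o f) n) _ fc) => s sc.
rewrite [LHS]/= [RHS]pushU pushU; have [s' ss' ->] := mksing_ex sc.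
by rewrite pushU; congr mksing; apply/funext => x; rewrite /= -ss'.
Qed.

Lemma push_ext (E E' : topologicalType) (f g : E -> E') n (c : chain R rat E n) (A : set E) :
  suppt (fun s : singular R E n => forall x, A (s x)) c ->
  (forall x, A x -> f x = g x) -> push f c = push g c.
Proof.
move=> Ac fg; apply: (@lin_ext _ _ _ _ (@push E E' f n) (@push E E' g n) _ Ac) => s As.
by rewrite [LHS]pushU [RHS]pushU; congr mksing; apply/funext => x /=; apply: fg.
Qed.

Lemma push_id (E : topologicalType) n (c : chain R rat E n) : push id c = c.
Proof.
apply: (@linU_ext _ _ _ (@push E E id n) idfun) => s.
by apply: push_cts.
Qed.

Lemma sop_push (E0 E E' : topologicalType) (f : E0 -> E) (H : E -> R -> E') r
    (op : natop R r) n k (c : chain R rat E0 n) :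
  suppt (fun s : singular R E0 n => continuous (f \o s)) c ->
  sop H op k (push f c) = sop (fun x a => H (f x) a) op k c.
Proof.
move=> fc; apply: (@lin_ext _ _ _ _ (@sop _ _ _ H _ op n k \o @push E0 E f n)
  (@sop _ _ _ (fun x a => H (f x) a) _ op n k) _ fc) => s sc.
rewrite [LHS]/= pushU; have [s' ss' ->] := mksing_ex sc.
rewrite [LHS]sopU [RHS]sopU; apply: (@linU_ext _ _ _ (ev H s' k) (ev _ s k)) => t.
rewrite [LHS]evU [RHS]evU; congr mksing.
by apply/funext => x; rewrite /real /= -ss'.
Qed.

Lemma push_sop (E E' E'' : topologicalType) (g : E' -> E'') (H : E -> R -> E') r
    (op : natop R r) n k (c : chain R rat E n) :
  (n + r = k)%N ->
  suppt (fun s : singular R E n => adm H s) c ->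
  push g (sop H op k c) = sop (fun x a => g (H x a)) op k c.
Proof.
move=> nk fc; apply: (@lin_ext _ _ _ _ (@push E' E'' g k \o @sop _ _ _ H _ op n k)
  (@sop _ _ _ (fun x a => g (H x a)) _ op n k) _ fc) => s sc.
rewrite [LHS]/= [RHS]sopU sopU.
have gi : suppt (good (n := n) k) (op n << iota_s R n >>).
  apply: natop_good => [x|]; first exact: iota_s_simplex.
  by rewrite size_iota_s addSn nk.
apply: (@lin_ext _ _ _ _ (@push E' E'' g k \o ev H s k) (ev (fun x a => g (H x a)) s k) _ gi).
move=> t gt; rewrite [LHS]/= [RHS]evU evU.
have [s' ss' ->] := mksing_ex (real_cts sc gt).
by rewrite pushU; congr mksing; apply/funext => x; rewrite /= -ss'.
Qed.

Lemma sop_at (E E' : topologicalType) (H : E -> R -> E') a (a01 : 0 <= a <= 1) n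
    (c : chain R rat E n) : sop H (op_at a01) n c = push (H^~ a) c.
Proof.
apply: (@linU_ext _ _ _ (@sop _ _ _ H _ (op_at a01) n n) (@push E E' (H^~ a) n)) => s.
rewrite [LHS]sopU [RHS]pushU /= fatU evU; congr mksing; apply/funext => t.
rewrite /real combo_fst combo_snd.
have -> : map fst [seq (x, a : R^o) | x <- iota_s R n] = iota_s R n.
  by rewrite -[LHS]map_comp [LHS]map_id.
rewrite combo_iota to_simplex_val /=; congr (H _ _).
rewrite /combo -[RHS]mul1r -[in RHS](simplex_sum1 t) mulr_suml; apply: eq_bigr => i _.
by rewrite -map_comp (nth_map 0) ?size_iota_s.
Qed.

Section Sd.
Variable E : topologicalType.
Local Notation Hid := (fun (x : E) (_ : R) => x).

Lemma adm_id n (s : singular R E n) : adm Hid s.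
Proof.
move=> k u tau uc _ _; exact: (fun t => continuous_comp (uc t) (cts_fun (s := s) _)).
Qed.

Definition sd n : chain R rat E n -> chain R rat E n := sop Hid op_sd n.
HB.instance Definition _ n := GRing.Linear.on (@sd n).
Definition hsd n : chain R rat E n -> chain R rat E n.+1 := sop Hid op_hsd n.+1.
HB.instance Definition _ n := GRing.Linear.on (@hsd n).

Lemma sop_id n (c : chain R rat E n) : sop Hid (op_at unit0) n c = c.
Proof. by rewrite sop_at push_id. Qed.

Lemma sd_bd n (c : chain R rat E n) : boundary (sd c) = sd (boundary c).
Proof.
case: n c => [c|n c]; first by rewrite /= linear0.
apply: (@linU_ext _ _ _ (@boundary R rat E n.+1 \o @sd n.+1)
  (@sd n \o @boundary R rat E n.+1)) => s.
have L := @sop_bd R E E Hid 0 op_sd n.+1 n s (@adm_id _ s) (addn0 _).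
rewrite [LHS]L [RHS](bd_sop Hid op_sd s (addn0 _)); congr ev.
by rewrite /= fat_fbd fsd_fbd.
Qed.

(** Since [0.-1] is 0, the boundary of a 0-chain is a zero chain typed in degree 0; the case
    distinction keeps the homotopy formula well typed in all degrees. *)
Definition hsd' n : chain R rat E n.-1 -> chain R rat E n :=
  match n with 0 => fun=> 0 | n.+1 => @hsd n end.

Lemma hsdE n (c : chain R rat E n) :
  boundary (hsd c) = c - sd c - hsd' (boundary c).
Proof.
have H n' (s : singular R E n') : boundary (hsd (<< s >> : chain R rat E n')) =
    << s >> - sd (<< s >> : chain R rat E n') -
    ev Hid s n' (op_hsd n' (fbd << iota_s R n' >>)).
  rewrite /hsd sop_bd ?addn1 //; last exact: adm_id.
  rewrite /= fat_fbd fhsE !linearB /= -[<< iota_s R n' >>]/(idfun _).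
  congr (_ - _ - _); last by rewrite /sd sopU.
  by rewrite -[RHS]sop_id [RHS]sopU.
case: n c => [c|n c].
  apply: (@linU_ext _ _ _ (@boundary R rat E 1 \o @hsd 0)
    (idfun \- @sd 0 \- \0)) => s.
  rewrite [LHS]H [RHS]/=; congr (_ - _).
  (* In the augmented complex a vertex has the empty simplex as boundary, and the homotopy vanishes
     there. *)
  have -> : fbd << iota_s R 0 >> = << [::] >>.
    rewrite fbdU fbd_seqE size_iota_s big_ord1 expr0 scale1r.
    have /size0nil -> // : size (del 0 (iota_s R 0)) = 0.
    by rewrite size_del size_iota_s.
  rewrite /= /fhs /hom_op [X in fat 0 X]rec_op0 !linear0 //.
apply: (@linU_ext _ _ _ (@boundary R rat E n.+2 \o @hsd n.+1)
    (idfun \- @sd n.+1 \- (@hsd n \o @boundary R rat E n.+1))) => s.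
rewrite [LHS]H [RHS]/=; congr (_ - _).
by rewrite /hsd bd_sop ?addn1.
Qed.

Lemma sd_supp (A : set E) n (c : chain R rat E n) :
  suppt (fun s : singular R E n => forall x, A (s x)) c ->
  suppt (fun s : singular R E n => forall x, A (s x)) (sd c).
Proof. by apply: sop_supp; rewrite ?addn0. Qed.

Lemma hsd_supp (A : set E) n (c : chain R rat E n) :
  suppt (fun s : singular R E n => forall x, A (s x)) c ->
  suppt (fun s : singular R E n.+1 => forall x, A (s x)) (hsd c).
Proof. by apply: sop_supp; rewrite ?addn1. Qed.

End Sd.

Lemma cts_push (E E' : topologicalType) (f : E -> E') n (c : chain R rat E n) :
  continuous f -> suppt (fun s : singular R E n => continuous (f \o s)) c.
Proof.
move=> fc; apply: suppT => s t.
exact: (continuous_comp (cts_fun (s := s) t) (fc _)).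
Qed.

Lemma push_sd (E E' : topologicalType) (f : E -> E') n (c : chain R rat E n) :
  continuous f -> push f (sd c) = sd (push f c).
Proof.
move=> fc; rewrite /sd [RHS]sop_push; last exact: cts_push.
by rewrite push_sop ?addn0 //; apply: suppT => s; exact: adm_id.
Qed.

Lemma push_hsd (E E' : topologicalType) (f : E -> E') n (c : chain R rat E n) :
  continuous f -> push f (hsd c) = hsd (push f c).
Proof.
move=> fc; rewrite /hsd [RHS]sop_push; last exact: cts_push.
by rewrite push_sop ?addn1 //; apply: suppT => s; exact: adm_id.
Qed.

Section PrismOp.
Variables (E E' : topologicalType) (H : E -> R -> E').

Definition prism n : chain R rat E n -> chain R rat E' n.+1 := sop H op_prism n.+1.
HB.instance Definition _ n := GRing.Linear.on (@prism n).

Definition prism' n : chain R rat E n.-1 -> chain R rat E' n :=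
  match n with 0 => fun=> 0 | n.+1 => @prism n end.

Lemma prismE n (c : chain R rat E n) :
  suppt (fun s : singular R E n => adm H s) c ->
  boundary (prism c) = push (H^~ 1) c - push (H^~ 0) c - prism' (boundary c).
Proof.
have K n' (s : singular R E n') : adm H s ->
    boundary (prism (<< s >> : chain R rat E n')) =
    push (H^~ 1) (<< s >> : chain R rat E n') - push (H^~ 0) (<< s >> : chain R rat E n') -
    ev H s n' (op_prism n' (fbd << iota_s R n' >>)).
  move=> sadm; rewrite /prism sop_bd ?addn1 //.
  rewrite /= fprismE !linearB /=.
  by rewrite -(sop_at H unit0) -(sop_at H unit1) !sopU.
case: n c => [c ac|n c ac].
  apply: (@lin_ext _ _ _ _ (@boundary R rat E' 1 \o @prism 0)
    (@push E E' (H^~ 1) 0 \- @push E E' (H^~ 0) 0 \- \0) _ ac) => s sadm.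
  rewrite [LHS]K //= ; congr (_ - _).
  have -> : fbd << iota_s R 0 >> = << [::] >>.
    rewrite fbdU fbd_seqE size_iota_s big_ord1 expr0 scale1r.
    have /size0nil -> // : size (del 0 (iota_s R 0)) = 0.
    by rewrite size_del size_iota_s.
  by rewrite [fprism _]rec_op0 linear0.
apply: (@lin_ext _ _ _ _ (@boundary R rat E' n.+2 \o @prism n.+1)
    (@push E E' (H^~ 1) n.+1 \- @push E E' (H^~ 0) n.+1 \- (@prism n \o @boundary R rat E n.+1))
     _ ac) => s sadm.
rewrite [LHS]K // [RHS]/=; congr (_ - _).
by rewrite /prism bd_sop ?addn1.
Qed.

Lemma prism_supp (A : set E) (B : set E') n (c : chain R rat E n) :
  (forall x a, A x -> 0 <= a <= 1 -> B (H x a)) ->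
  suppt (fun s : singular R E n => forall x, A (s x)) c ->
  suppt (fun s : singular R E' n.+1 => forall x, B (s x)) (prism c).
Proof. by apply: sop_supp; rewrite ?addn1. Qed.

End PrismOp.
End NaturalOperators.

(** * Small simplices *)

Section Diameter.
Variable R : realType.

Section Formal.
Variables (P : normedModType R).

Definition diamle (d : R) (s : seq P) :=
  forall x y, x \in s -> y \in s -> `|x - y| <= d.

Lemma convexp_ball (b : P) (d : R) : convexp (fun y => `|b - y| <= d).
Proof.
move=> s a sd a0 a1; have -> : b = \sum_(i < size s) a i *: b.
  by rewrite -scaler_suml a1 scale1r.
rewrite -sumrB (le_trans (ler_norm_sum _ _ _)) //.
rewrite -[leRHS]mul1r -a1 mulr_suml ler_sum // => i _.
rewrite -scalerBr normrZ ger0_norm // ler_wpM2l //.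
by apply: sd; exact: mem_nth.
Qed.

(** The difference from the barycentre to [x] is the mean of the vectors [y - x], one of which is
    zero; this gives the factor below 1. *)
Lemma bary_dist (s : seq P) (d : R) x : x \in s -> diamle d s ->
  `|bary s - x| <= (1 - (size s)%:R^-1) * d.
Proof.
move=> xs sd; have s0 : (0 < size s)%N by case: (s) xs.
have d0 : 0 <= d by apply: le_trans (sd x x xs xs); rewrite subrr normr0.
have s0R : (size s)%:R != 0 :> R by rewrite pnatr_eq0 -lt0n.
have -> : bary s - x = (size s)%:R^-1 *: \sum_(y <- s) (y - x).
  rewrite big_split /= scalerDr /bary; congr (_ + _).
  rewrite sumrN big_const_seq count_predT iter_addr_0 scalerN.
  by rewrite -[x *+ _]scaler_nat scalerA mulVf // scale1r.
rewrite normrZ gtr0_norm ?invr_gt0 ?ltr0n //.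
have -> : (1 - (size s)%:R^-1) * d = (size s)%:R^-1 * (((size s)%:R - 1) * d).
  by field.
rewrite ler_wpM2l ?invr_ge0 // (big_rem x xs) /= subrr add0r.
rewrite (le_trans (ler_norm_sum _ _ _)) //.
have -> : (size s)%:R - 1 = (size (rem x s))%:R :> R.
  by rewrite size_rem // -subn1 natrB.
rewrite -[in leRHS](count_predT) mulr_natl -iter_addr_0 -big_const_seq.
rewrite big_seq [leRHS]big_seq ler_sum // => y /mem_rem ys; exact: sd.
Qed.

(** An edge of the subdivision either lies in the subdivision of a face or ends at the barycentre of
    [s]. Faces have fewer vertices, so the factor belonging to the bound [N] serves both kinds. *)
Lemma fsd_diam N s (d : R) : (size s <= N)%N -> diamle d s ->
  suppt (diamle ((1 - N%:R^-1) * d)) (fsd << s >>).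
Proof.
elim/fbd_ind: s => [|s s0 IH] sN sd; first by rewrite fsd0; apply: suppU.
have s_gt0 : (0 < size s)%N by case: (s) s0.
have [x0 x0s] : exists x, x \in s by case: (s) s0 => // x ? _; exists x; rewrite inE eqxx.
have d0 : 0 <= d by apply: le_trans (sd x0 x0 x0s x0s); rewrite subrr normr0.
have N_gt0 : (0 < N)%N := leq_trans s_gt0 sN.
have r0 : 0 <= (1 - N%:R^-1) * d.
  by rewrite mulr_ge0 // subr_ge0 invf_le1 ?ler1n ?ltr0n.
have bs x : x \in s -> `|bary s - x| <= (1 - N%:R^-1) * d.
  move=> xs; apply: le_trans (bary_dist xs sd) _; rewrite ler_wpM2r // lerB //.
  by rewrite lef_pV2 ?posrE ?ltr0n ?ler_nat.
rewrite fsdS // fbdU.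
have : suppt (fun t => diamle ((1 - N%:R^-1) * d) t /\
    forall y, y \in t -> `|bary s - y| <= (1 - N%:R^-1) * d) (fsd (fbd_seq s)).
  apply: (supp_lin (f := @fsd R P) (@supp_fbd_seq _ s)) => t [st ts].
  apply: suppI; first apply: IH => //; first by rewrite st (leq_trans (leq_pred _)).
    by move=> x y /ts xs /ts ys; exact: sd.
  apply: sub_supp (fsd_supp (@convexp_ball (bary s) ((1 - N%:R^-1) * d)) _).
    by move=> u [].
  by move=> x /ts; exact: bs.
move=> /(supp_lin (f := cone (bary s))); apply => t [td tb].
rewrite [GRing.Linear.sort _ _]coneU; apply: suppU => x y.
rewrite !inE => /orP[/eqP->|xt] /orP[/eqP->|yt].
- by rewrite subrr normr0.
- exact: tb.
- by rewrite distrC; exact: tb.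
- exact: td.
Qed.

Lemma fsd_iter_diam N s (d : R) k C : convexp C -> (size s = N)%N -> diamle d s ->
  (forall x, x \in s -> C x) ->
  suppt (fun t => diamle ((1 - N%:R^-1) ^+ k * d) t /\ size t = N /\
     forall x, x \in t -> C x) (iter k (@fsd R P) << s >>).
Proof.
move=> cC sN sd sC; elim: k => [|k IH] /=.
  by apply: suppU; rewrite expr0 mul1r.
apply: (supp_lin (f := @fsd R P) IH) => t [td [tN tC]].
apply: suppI.
  by rewrite exprS -mulrA; apply: fsd_diam => //; rewrite tN.
by apply: sub_supp (fsd_supp cC tC) => u [-> uC]; rewrite addn0.
Qed.
End Formal.

Local Notation D n := (std_simplex R n).

Section SdEv.
Variables (E : topologicalType).
Local Notation Hid := (fun (x : E) (_ : R) => x).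

Definition combo_lin n k (s : seq 'rV[R]_n.+1) (v : 'rV[R]_k.+1) : 'rV[R]_n.+1 :=
  \sum_(i < k.+1) v ord0 i *: nth 0 s i.

Lemma combo_lin_linear n k s : linear (@combo_lin n k s).
Proof.
move=> a u v; rewrite /combo_lin scaler_sumr -big_split /=.
by apply: eq_bigr => i _; rewrite !mxE scalerDl scalerA.
Qed.
HB.instance Definition _ n k s :=
  GRing.isLinear.Build R _ _ _ (@combo_lin n k s) (@combo_lin_linear n k s).

Lemma combo_lin_iota n k (s : seq 'rV[R]_n.+1) : size s = k.+1 ->
  map (combo_lin s) (iota_s R k) = s.
Proof.
move=> sk; apply: (@eq_from_nth _ 0); first by rewrite size_map size_iota_s.
move=> i; rewrite size_map size_iota_s => ik.
rewrite (nth_map 0) ?size_iota_s // -[i]/(nat_of_ord (Ordinal ik)) nth_iota_s.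
rewrite /combo_lin (bigD1 (Ordinal ik)) //= big1 => [|j /negPf ji].
  by rewrite mxE !eqxx scale1r addr0.
by rewrite mxE eqxx ji scale0r.
Qed.

Lemma sd_ev n k (s : singular R E n) c :
  suppt (fun t => size t = k.+1 /\ forall x, x \in t -> x \in D n) c ->
  sd (ev Hid s k (fat 0 c)) = ev Hid s k (fat 0 (fsd c)).
Proof.
move=> cD; apply: (@lin_ext _ _ _ _ (@sd R E k \o ev Hid s k \o fat 0)
  (ev Hid s k \o fat 0 \o (@fsd R _)) _ cD) => t [tk tD].
rewrite [LHS]/= [RHS]/= fatU evU.
have gt : good k [seq (x, 0 : R^o) | x <- t].
  split; first by rewrite size_map.
  by move=> _ /mapP[x /tD xD ->] /=; rewrite lexx ler01.
have [s' ss' ->] := mksing_ex (real_cts (adm_id (s := s)) gt).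
rewrite [LHS]sopU /= -[in RHS](combo_lin_iota tk) -(lmapU (combo_lin t)) -(fsd_map (combo_lin t)).
have iD : suppt (fun u => size u = (size (iota_s R k) + 0)%N /\
    forall x, x \in u -> x \in D k) (fsd << iota_s R k >>).
  apply: (fsd_supp (C := fun x => x \in D k)); first exact: convexp_simplex.
  exact: iota_s_simplex.
apply: (@lin_ext _ _ _ _ (ev Hid s' k \o fat 0)
  (ev Hid s k \o fat 0 \o lmap (combo_lin t)) _ iD) => u [uk uD].
rewrite [LHS]/= [RHS]/= lmapU !fatU !evU; congr mksing; apply/funext => x.
have ku : size u = k.+1 by rewrite uk size_iota_s addn0.
have uk' : combo u x \in D k.
  by apply: (combo_convex (C := fun x => x \in D k)) => //; exact: convexp_simplex.
have fst0 m (w : seq 'rV[R]_m.+1) : map fst [seq (y, 0 : R^o) | y <- w] = w.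
  by rewrite -map_comp map_id.
rewrite /real !combo_fst !fst0 -ss' /real combo_fst fst0; congr (s (to_simplex _)).
by rewrite -(combo_map (combo_lin t)) /= {1}/combo to_simplexK.
Qed.

(** Iterated subdivision of a singular simplex is carried back to the affine subdivision of the
    standard simplex, where diameters make sense. *)
Lemma sd_iter_ev n k (s : singular R E n) :
  iter k (@sd R E n) (<< s >> : chain R rat E n) =
  ev Hid s n (fat 0 (iter k (@fsd R _) << iota_s R n >>)).
Proof.
elim: k => [|k IH] /=.
  have : << s >> = sop Hid (op_at (unit0 R)) n (<< s >> : chain R rat E n).
    by rewrite sop_id.
  by rewrite sopU.
rewrite IH sd_ev //.
have dd : diamle (\sum_(x <- iota_s R n) \sum_(y <- iota_s R n) `|x - y|) (iota_s R n).
  move=> x y xs ys; rewrite (big_rem x xs) /= (big_rem y ys) /= -addrA lerDl.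
  by rewrite addr_ge0 // ?sumr_ge0 // => *; rewrite ?sumr_ge0.
have := @fsd_iter_diam _ _ _ _ k _ (@convexp_simplex R n) (size_iota_s R n) dd
  (@iota_s_simplex R n).
by apply: sub_supp => t [_ []].
Qed.

End SdEv.

Lemma simplex_compact n : compact (D n).
Proof.
apply: bounded_closed_compact.
  exists 1; split=> // M M1 v [v0 v1]; apply: le_trans (ltW M1).
  rewrite [leLHS]/Num.norm /= mx_normrE; apply: bigmax_le => // -[i j] _ /=.
  rewrite (ord1 i) ger0_norm // -v1 (bigD1 j) //= lerDl.
  by rewrite sumr_ge0.
have -> : (D n : set _) = \bigcap_(i in [set: 'I_n.+1]) [set v | 0 <= v ord0 i] `&`
    [set v | \sum_i v ord0 i = 1].
  apply/seteqP; split=> v [v0 v1]; split=> // i; first by move=> _; exact: v0.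
  exact: (v0 i I).
apply: closedI.
  apply: closed_bigI => i _.
  apply: (@closed_comp _ _ (fun v : 'rV[R]_n.+1 => v ord0 i) [set x | 0 <= x]).
    by move=> v _; exact: mx_coord_continuous.
  exact: closed_ge.
apply: (@closed_comp _ _ (fun v : 'rV[R]_n.+1 => \sum_i v ord0 i) [set x | x = 1]).
  move=> v _; apply: continuous_sumR => i; exact: mx_coord_continuous.
exact: closed_eq.
Qed.

(** * Subdividing until every simplex is small *)

Section Lebesgue.
Variables (E : topologicalType) (W1 W2 : set E).
Hypotheses (W1o : open W1) (W2o : open W2).

Definition small (T : Type) (f : T -> E) := (forall x, W1 (f x)) \/ (forall x, W2 (f x)).

(** Compactness is used as a near-covering property along radii tending to 0 from the right: if the
    radius [e] is good at [v], then any radius below [e / 2] is good at all points within [e / 2] of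
    [v]. *)
Lemma lebesgue_number n (s : singular R E n) :
  (forall x, (W1 `|` W2) (s x)) ->
  exists2 e : R, 0 < e & forall x : D n,
    (forall y : D n, `|\val x - \val y| < e -> W1 (s y)) \/
    (forall y : D n, `|\val x - \val y| < e -> W2 (s y)).
Proof.
move=> s12.
pose Q (e : R) (v : 'rV[R]_n.+1) :=
  (forall y : D n, `|v - \val y| < e -> W1 (s y)) \/
  (forall y : D n, `|v - \val y| < e -> W2 (s y)).
have loc (W : set E) (x : D n) : open W -> W (s x) ->
    exists2 e : R, 0 < e & forall y : D n, `|\val x - \val y| < e -> W (s y).
  move=> Wo Wx; have : nbhs x (s @^-1` W).
    by apply: (cts_fun (s := s) x); exact: open_nbhs_nbhs.
  rewrite nbhsE /= => -[B [[B' B'o B'B] Bx] BW].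
  have : nbhs (\val x) B' by apply: open_nbhs_nbhs; split=> //; rewrite -B'B in Bx.
  move=> /nbhs_ballP[e /= e0 eB]; exists e => // y xy; apply: BW.
  by rewrite -B'B; apply: eB; rewrite -ball_normE.
have /compact_near_coveringP/(_ R (0^'+) Q) : compact (D n) by exact: simplex_compact.
have key (x : D n) : exists2 e : R, 0 < e & Q e (\val x).
  case: (s12 x) => Wx.
    by have [e e0 eW] := loc _ _ W1o Wx; exists e => //; left.
  by have [e e0 eW] := loc _ _ W2o Wx; exists e => //; right.
case.
  move=> v Dv; pose x : D n := exist (fun w => w \in D n) v (mem_set Dv).
  have [e e0 Qe] := key x.
  exists (ball v (e / 2), [set d : R | d < e / 2]) => /=.
    split; first by apply: nbhsx_ballx; rewrite divr_gt0.
    by apply: nbhs_right_lt; rewrite divr_gt0.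
  move=> [v' d] [/= vv' de].
  have vv'' : `|v - v'| < e / 2 by move: vv'; rewrite -ball_normE.
  have tri (y : D n) : `|v' - \val y| < d -> `|\val x - \val y| < e.
    move=> yd; rewrite -(subrKA v') (le_lt_trans (ler_normD _ _)) //.
    by rewrite (splitr e) ltrD // (lt_trans yd).
  by case: Qe => Qe; [left|right] => y /tri /Qe.
move=> d /= d0 dQ; exists (d / 2); rewrite ?divr_gt0 // => x.
apply: (dQ (d / 2)) => /=.
- by rewrite sub0r normrN gtr0_norm ?divr_gt0 // ltr_pdivrMr // mulr2n mulrDr mulr1 ltrDl.
- by rewrite divr_gt0.
- by case: (x) => /= v /set_mem.
Qed.

Lemma sd_small1 n (s : singular R E n) : (forall x, (W1 `|` W2) (s x)) ->
  exists k, suppt (fun t : singular R E n => small t)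
    (iter k (@sd R E n) (<< s >> : chain R rat E n)).
Proof.
move=> /lebesgue_number[e e0 se].
(* The sum of all pairwise distances dominates each of them. Any finite bound would do, because each
   subdivision multiplies it by a fixed factor below 1. *)
pose d := (\sum_(x <- iota_s R n) \sum_(y <- iota_s R n) `|x - y|).
have dd : diamle d (iota_s R n).
  move=> x y xs ys; rewrite /d (big_rem x xs) /= (big_rem y ys) /= -addrA lerDl.
  by rewrite addr_ge0 // ?sumr_ge0 // => *; rewrite ?sumr_ge0.
have [k kd] : exists k, (1 - (n.+1)%:R^-1) ^+ k * d < e.
  have : (fun k => (1 - (n.+1)%:R^-1) ^+ k * d) @ \oo --> (0 : R).
    rewrite -[0 in X in _ --> X](mul0r d); apply: cvgM; last exact: cvg_cst.
    apply: cvg_expr; rewrite ger0_norm ?subr_ge0 ?invf_le1 ?ler1n //.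
    by rewrite ltrBlDr ltrDl invr_gt0.
  move=> /cvgrPdist_lt/(_ e e0)[k _ /(_ k (leqnn k)) /=].
  rewrite sub0r normrN => ke; exists k; apply: le_lt_trans ke; exact: ler_norm.
exists k; rewrite sd_iter_ev.
have it := @fsd_iter_diam _ _ _ _ k _ (@convexp_simplex R n) (size_iota_s R n) dd
  (@iota_s_simplex R n).
apply: (supp_lin (f := ev (fun (x : E) (_ : R) => x) s n \o fat 0) it) => t [td [tn tD]].
rewrite [GRing.Linear.sort _ _]/= fatU evU; apply: supp_mksing => s' ss'.
(* The first vertex serves as centre: balls are convex, so the whole affine simplex stays within the
   diameter bound of it. *)
have tx0 : nth 0 t 0 \in t by rewrite mem_nth // tn.
have key (y : D n) : `|\val (to_simplex (nth 0 t 0)) - \val (to_simplex (combo t y))| < e.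
  rewrite to_simplexK ?tD // to_simplexK; last first.
    by apply: (combo_convex (C := fun x => x \in D n)) => //; exact: convexp_simplex.
  apply: le_lt_trans kd.
  apply: (combo_convex (C := fun x => `|nth 0 t 0 - x| <= _)) => //.
    exact: convexp_ball.
  by move=> x xt; exact: td.
have E' y : s' y = s (to_simplex (combo t y)).
  by rewrite -ss' /real combo_fst -map_comp map_id.
by case: (se (to_simplex (nth 0 t 0))) => st; [left|right] => y; rewrite E'; exact: st.
Qed.

Lemma sd_iter_supp (A : set E) n k (c : chain R rat E n) :
  suppt (fun s : singular R E n => forall x, A (s x)) c ->
  suppt (fun s : singular R E n => forall x, A (s x)) (iter k (@sd R E n) c).
Proof. by move=> Ac; elim: k => //= k; exact: sd_supp. Qed.

Lemma sd_keep_small n k (c : chain R rat E n) :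
  suppt (fun t : singular R E n => small t) c ->
  suppt (fun t : singular R E n => small t) (iter k (@sd R E n) c).
Proof.
elim: k => //= k IH cs; apply: (supp_lin (f := @sd R E n) (IH cs)) => s [s1|s2].
  apply: sub_supp (sd_supp (A := W1) _) => [t|]; first by left.
  exact: suppU.
apply: sub_supp (sd_supp (A := W2) _) => [t|]; first by right.
exact: suppU.
Qed.

Lemma sd_iterP n k a (c c' : chain R rat E n) :
  iter k (@sd R E n) (a *: c + c') = a *: iter k (@sd R E n) c + iter k (@sd R E n) c'.
Proof. by elim: k => //= k ->; rewrite linearP. Qed.

(** Small chains stay small under subdivision, so the numbers of steps needed by the individual
    simplices can be added up. *)
Lemma sd_small n (c : chain R rat E n) :
  suppt (fun s : singular R E n => forall x, (W1 `|` W2) (s x)) c ->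
  exists k, suppt (fun t : singular R E n => small t) (iter k (@sd R E n) c).
Proof.
move=> cW; apply: (freegs_ind (P := fun c => exists k,
  suppt (fun t : singular R E n => small t) (iter k (@sd R E n) c)) cW).
  by exists 0%N; exact: supp0.
move=> a s c' sW [k' IH]; have [k ks] := sd_small1 sW.
exists (k + k')%N; rewrite [iter _ _ _]sd_iterP; apply: suppD.
  by apply: suppZ; rewrite addnC iterD; exact: sd_keep_small.
by rewrite iterD; exact: sd_keep_small.
Qed.

End Lebesgue.
End Diameter.

(** * Finite generation and the local-to-global principle *)

Section FinGen.
Variable V : lmodType rat.
Implicit Types (Z B : V -> Prop) (L : seq V).

Definition submod Z := Z 0 /\ forall (c : rat) x y, Z x -> Z y -> Z (c *: x + y).

Lemma submodD Z x y : submod Z -> Z x -> Z y -> Z (x + y).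
Proof. by move=> [_ H] Zx Zy; rewrite -[x]scale1r; exact: H. Qed.

Lemma submodZ Z (c : rat) x : submod Z -> Z x -> Z (c *: x).
Proof. by move=> [Z0 H] Zx; rewrite -[_ *: _]addr0; exact: H. Qed.

Lemma submodN Z x : submod Z -> Z x -> Z (- x).
Proof. by move=> sZ Zx; rewrite -scaleN1r; exact: submodZ. Qed.

Lemma submodB Z x y : submod Z -> Z x -> Z y -> Z (x - y).
Proof. by move=> sZ Zx Zy; apply: submodD => //; exact: submodN. Qed.

Definition lcomb L (a : nat -> rat) : V := \sum_(i < size L) a i *: nth 0 L i.

Lemma lcombP L a a' (c : rat) :
  lcomb L (fun i => c * a i + a' i) = c *: lcomb L a + lcomb L a'.
Proof.
rewrite /lcomb scaler_sumr -big_split /=; apply: eq_bigr => i _.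
by rewrite scalerDl scalerA.
Qed.

Lemma lcomb_cat L L' a a' :
  exists b, lcomb (L ++ L') b = lcomb L a + lcomb L' a'.
Proof.
exists (fun i => if (i < size L)%N then a i else a' (i - size L)%N).
rewrite /lcomb size_cat big_split_ord /=; congr (_ + _); apply: eq_bigr => i _.
  by rewrite ltn_ord nth_cat ltn_ord.
by rewrite nth_cat ltnNge leq_addr /= addKn.
Qed.

(* The flag b records that no generator is needed, so that the vanishing and
   the finiteness of homology are handled by the same arguments. *)
Definition fgb (b : bool) Z B :=
  exists L, (b -> L = [::]) /\ forall z, Z z -> exists a, B (z - lcomb L a).

Lemma fgb_sub b Z B : (forall z, Z z -> B z) -> fgb b Z B.
Proof.
move=> ZB; exists [::]; split=> // z Zz; exists (fun=> 0).
by rewrite /lcomb big_ord0 subr0; exact: ZB.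
Qed.

Lemma fgbT Z B : fgb true Z B <-> forall z, Z z -> B z.
Proof.
split=> [[L [/(_ isT) -> H]] z /H[a]|]; first by rewrite /lcomb big_ord0 subr0.
exact: fgb_sub.
Qed.

Lemma fgb_mono b Z Z' B B' : (forall z, Z' z -> Z z) -> (forall z, B z -> B' z) ->
  fgb b Z B -> fgb b Z' B'.
Proof.
move=> ZZ' BB' [L [Lb H]]; exists L; split=> // z /ZZ'/H[a Ba].
by exists a; exact: BB'.
Qed.

Lemma fgb_trans b Z Z' B : fgb b Z Z' -> fgb b Z' B -> fgb b Z B.
Proof.
move=> [L [Lb H]] [L' [Lb' H']]; exists (L ++ L'); split.
  by move=> bT; rewrite Lb // Lb'.
move=> z /H[a /H'[a' Ba']]; have [c cE] := lcomb_cat L L' a a'.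
by exists c; rewrite cE opprD addrA.
Qed.

Lemma fgb_add b Z1 Z2 B : submod B -> fgb b Z1 B -> fgb b Z2 B ->
  fgb b (fun z => exists z1 z2, [/\ Z1 z1, Z2 z2 & z = z1 + z2]) B.
Proof.
move=> sB [L [Lb H]] [L' [Lb' H']]; exists (L ++ L'); split.
  by move=> bT; rewrite Lb // Lb'.
move=> z [z1 [z2 [/H[a Ba] /H'[a' Ba'] ->]]].
have [c cE] := lcomb_cat L L' a a'; exists c.
by rewrite cE opprD addrACA; exact: submodD.
Qed.

(** Gaussian elimination on a linear relation between [Z] and vectors of [r] coefficients, where
    vanishing coefficients force membership in [B]. Passing to a relation, not a map, lets a
    connecting homomorphism be described by arbitrary choices of splittings. The generators are
    found inside [Z] and are at most [r] in number. *)
Lemma fgb_step r Z B (Rel : V -> (nat -> rat) -> Prop) :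
  submod Z ->
  (forall c z z' a a', Rel z a -> Rel z' a' ->
     Rel (c *: z + z') (fun i => c * a i + a' i)) ->
  (forall z, Z z -> exists a, Rel z a) ->
  (forall z a, Z z -> Rel z a -> (forall i, (i < r)%N -> a i = 0) -> B z) ->
  exists L, [/\ (size L <= r)%N, forall x, x \in L -> Z x &
    forall z, Z z -> exists a, B (z - lcomb L a)].
Proof.
elim: r Z Rel => [|r IH] Z Rel sZ linR totR Rel0.
  exists [::]; split=> // z Zz; exists (fun=> 0).
  rewrite /lcomb big_ord0 subr0; have [a Ra] := totR _ Zz.
  exact: Rel0 Ra _.
pose Rel' z a := Rel z a /\ a r = 0.
have linR' c z z' a a' : Rel' z a -> Rel' z' a' ->
     Rel' (c *: z + z') (fun i => c * a i + a' i).
  move=> [Ra ar] [Ra' ar']; split; first exact: linR.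
  by rewrite ar ar' mulr0 addr0.
have Rel0' z a : Z z -> Rel' z a -> (forall i, (i < r)%N -> a i = 0) -> B z.
  move=> Zz [Ra ar] a0; apply: (Rel0 _ _ Zz Ra) => i.
  by rewrite ltnS leq_eqVlt => /orP[/eqP->//|/a0].
have [[z0 [a0 [Zz0 Ra0 a0r]]]|none] :=
  pselect (exists z0 a0, [/\ Z z0, Rel z0 a0 & a0 r != 0]); last first.
  have [L [sL ZL HL]] : exists L, [/\ (size L <= r)%N, forall x, x \in L -> Z x &
      forall z, Z z -> exists a, B (z - lcomb L a)].
    apply: (IH Z Rel') => // z Zz; have [a Ra] := totR _ Zz; exists a; split=> //.
    by apply/eqP; apply: contra_notT none => ar; exists z, a.
  by exists L; split=> //; exact: leqW.
(* [z0] serves as pivot: a multiple of it brings any element of [Z] into this kernel of the last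
   coefficient. *)
pose Z' z := Z z /\ exists a, Rel' z a.
have sZ' : submod Z'.
  split; first split; first by case: sZ.
    exists (fun i => -1 * a0 i + a0 i); split.
      by rewrite -[0](addNr z0) -scaleN1r; exact: linR.
    by rewrite mulN1r addNr.
  move=> c x y [Zx [a Ra]] [Zy [a' Ra']]; split; first by case: sZ => _; exact.
  by exists (fun i => c * a i + a' i); exact: linR'.
have [L [sL ZL HL]] : exists L, [/\ (size L <= r)%N, forall x, x \in L -> Z' x &
      forall z, Z' z -> exists a, B (z - lcomb L a)].
  by apply: (IH Z' Rel') => [//|//|z []//|z a [Zz _]]; exact: Rel0'.
exists (z0 :: L); split=> // [x|z Zz].
  by rewrite inE => /orP[/eqP->//|/ZL[]].
have [a Ra] := totR _ Zz.
pose c := - (a r / a0 r).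
have [] := HL (c *: z0 + z).
  split; first by case: sZ => _; apply.
  exists (fun i => c * a0 i + a i); split; first exact: linR.
  by rewrite /c mulNr divfK // addNr.
move=> b Bb; exists (fun i => if i is i'.+1 then b i' else - c).
rewrite /lcomb big_ord_recl /=; rewrite scaleNr opprD opprK addrA.
by rewrite [z + _]addrC.
Qed.

Lemma fgb_rel (b : bool) r Z B (Rel : V -> (nat -> rat) -> Prop) :
  (b -> r = 0%N) -> submod Z ->
  (forall c z z' a a', Rel z a -> Rel z' a' ->
     Rel (c *: z + z') (fun i => c * a i + a' i)) ->
  (forall z, Z z -> exists a, Rel z a) ->
  (forall z a, Z z -> Rel z a -> (forall i, (i < r)%N -> a i = 0) -> B z) ->
  fgb b Z B.
Proof.
move=> bL sZ linR totR Rel0.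
have [L' [sL' ZL' HL']] := fgb_step sZ linR totR Rel0.
exists L'; split=> // bT; apply: size0nil; apply/eqP.
by rewrite -leqn0 (leq_trans sL') // bL.
Qed.

(** The list in [fgb] may lie outside [Z]; elimination replaces it by one inside [Z] that is no
    longer. *)
Lemma fgb_gen b Z B : submod Z -> submod B -> fgb b Z B ->
  exists L, [/\ b -> L = [::], forall x, x \in L -> Z x &
    forall z, Z z -> exists a, B (z - lcomb L a)].
Proof.
move=> sZ sB [L [Lb H]].
have [||z a Zz Ba a0|L' [sL' ZL' HL']] := @fgb_step (size L) Z B
  (fun z a => B (z - lcomb L a)) sZ.
- move=> c z z' a a' Ba Ba'; rewrite lcombP opprD addrACA -scalerBr.
  by case: sB => _; exact.
- exact: H.
- suff : lcomb L a = 0 by move=> a0'; rewrite a0' subr0 in Ba.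
  by rewrite /lcomb big1 // => i _; rewrite a0 ?scale0r.
exists L'; split=> // bT; apply: size0nil; apply/eqP.
by rewrite -leqn0 (leq_trans sL') // Lb.
Qed.

End FinGen.

Lemma suppt_submod (T : choiceType) (Q : T -> Prop) :
  submod (fun c : {freeg T / rat} => suppt Q c).
Proof.
split=> [|c x y Qx Qy]; first exact: supp0.
by apply: suppD => //; exact: suppZ.
Qed.

Lemma set_consE (T : eqType) (x : T) (l : seq T) : [set` x :: l] = x |` [set` l].
Proof.
apply/seteqP; split=> y /=.
  by rewrite in_cons => /orP[/eqP->|yl]; [left|right].
by rewrite in_cons; case=> ->; rewrite ?eqxx ?orbT.
Qed.

(** * Compact sets in Hausdorff spaces *)

Section CompactTools.
Variable S : topologicalType.
Implicit Types K A B O W : set S.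

Lemma compact_finite_cover K (U : S -> set S) : compact K ->
  (forall x, K x -> nbhs x (U x)) ->
  exists l : seq S, (forall x, x \in l -> K x) /\
    forall y, K y -> exists2 x, x \in l & U x y.
Proof.
move=> /compact_near_coveringP cK KU.
(* Lists ordered by inclusion generate a filter; a near covering along it is exactly a finite
   subcover indexed by points of [K]. *)
pose F : set_system (seq S) := fun Q => exists2 l0 : seq S,
  (forall x, x \in l0 -> K x) & forall l : seq S, {subset l0 <= l} -> Q l.
have FF : Filter F.
  split; first by exists [::].
    move=> Q Q' [l lK lQ] [l' lK' lQ']; exists (l ++ l').
      by move=> x; rewrite mem_cat => /orP[/lK|/lK'].
    by move=> m sm; split; [apply: lQ|apply: lQ'] => x xl; apply: sm; rewrite mem_cat xl ?orbT.
  by move=> Q Q' QQ' [l lK lQ]; exists l => // m /lQ/QQ'.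
have [x Kx|l lK lU] := cK _ F (fun (l : seq S) y => exists2 x, x \in l & U x y) FF.
  exists (U x, [set l : seq S | x \in l]) => /=.
    split; first exact: KU.
    exists [:: x]; first by move=> y; rewrite inE => /eqP->.
    by move=> l sl; apply: sl; rewrite inE.
  by move=> [y l] [/= Uy xl]; exists x.
by exists l; split=> // y Ky; exact: (lU l).
Qed.

Hypothesis hS : hausdorff_space S.

Lemma compact_sep_point K x : compact K -> ~ K x ->
  exists U V, [/\ open U, open V, U x, K `<=` V & forall y, U y -> ~ V y].
Proof.
move=> cK nKx.
have sep y : exists UV : set S * set S, K y ->
    [/\ open UV.1, open UV.2, UV.1 x, UV.2 y & forall z, UV.1 z -> ~ UV.2 z].
  have [Ky|nKy] := pselect (K y); last by exists (set0, set0).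
  have xy : x != y by apply/eqP => xy; apply: nKx; rewrite xy.
  have := hS; rewrite open_hausdorff => /(_ _ _ xy)[[U V] /= [Ux Vy] [Uo Vo /eqP UV]].
  exists (U, V) => _; split=> //; [exact/set_mem|exact/set_mem|].
  by move=> z Uz Vz; have : (U `&` V) z by []; rewrite UV.
have [UV UVP] := choice sep.
have [l [lK lV]] : exists l : seq S, (forall x, x \in l -> K x) /\
    forall y, K y -> exists2 x, x \in l & (UV x).2 y.
  apply: compact_finite_cover => // y Ky; have [_ Vo _ Vy _] := UVP y Ky.
  exact: open_nbhs_nbhs.
exists (\bigcap_(y in [set` l]) (UV y).1), (\bigcup_(y in [set` l]) (UV y).2); split.
- elim: l lK {lV} => [|y l IH] lK.
    by rewrite set_nil bigcap_set0; exact: openT.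
  rewrite set_consE bigcap_setU1; apply: openI.
    by have [] := UVP y; first by apply: lK; rewrite inE eqxx.
  by apply: IH => z zl; apply: lK; rewrite inE zl orbT.
- by apply: bigcup_open => y /= /lK /UVP[].
- by move=> y /= /lK /UVP[].
- by move=> y /lV[z zl Vy]; exists z.
- move=> z Uz [y /= yl Vz]; have [_ _ _ _ H] := UVP y (lK _ yl).
  by apply: H Vz; exact: Uz.
Qed.

Lemma compact_sep K K' : compact K -> compact K' -> K `&` K' = set0 ->
  exists U V, [/\ open U, open V, K `<=` U, K' `<=` V & forall y, U y -> ~ V y].
Proof.
move=> cK cK' KK'.
have sep x : exists UV : set S * set S, K x ->
    [/\ open UV.1, open UV.2, UV.1 x, K' `<=` UV.2 & forall z, UV.1 z -> ~ UV.2 z].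
  have [Kx|nKx] := pselect (K x); last by exists (set0, set0).
  have nK'x : ~ K' x by move=> K'x; have : (K `&` K') x by []; rewrite KK'.
  have [U [V H]] := compact_sep_point cK' nK'x.
  by exists (U, V).
have [UV UVP] := choice sep.
have [l [lK lV]] : exists l : seq S, (forall x, x \in l -> K x) /\
    forall y, K y -> exists2 x, x \in l & (UV x).1 y.
  apply: compact_finite_cover => // y Ky; have [Uo _ Uy _ _] := UVP y Ky.
  exact: open_nbhs_nbhs.
exists (\bigcup_(y in [set` l]) (UV y).1), (\bigcap_(y in [set` l]) (UV y).2); split.
- by apply: bigcup_open => y /= /lK /UVP[].
- elim: l lK {lV} => [|y l IH] lK.
    by rewrite set_nil bigcap_set0; exact: openT.
  rewrite set_consE bigcap_setU1; apply: openI.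
    by have [] := UVP y; first by apply: lK; rewrite inE eqxx.
  by apply: IH => z zl; apply: lK; rewrite inE zl orbT.
- by move=> y /lV[z zl Uy]; exists z.
- by move=> y K'y z /= /lK /UVP[_ _ _ KV _]; exact: KV.
- move=> z [y /= yl Uz] Vz; have [_ _ _ _ H] := UVP y (lK _ yl).
  by apply: H Uz _; exact: Vz.
Qed.

Lemma compact_setD K O : compact K -> open O -> compact (K `\` O).
Proof. by move=> cK Oo; rewrite setDE; apply: compact_closedI => //; exact: open_closedC. Qed.

Lemma compact_setI K K' : compact K -> compact K' -> compact (K `&` K').
Proof.
by move=> cK cK'; apply: compact_closedI => //; exact: compact_closed.
Qed.

(** [K] without [O] is compact and disjoint from [K']; separate these two and add [O] to the
    neighbourhood of the first. *)
Lemma compact_shrink K K' O : compact K -> compact K' -> open O -> K `&` K' `<=` O ->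
  exists U V, [/\ open U, open V, K `<=` U, K' `<=` V & U `&` V `<=` O].
Proof.
move=> cK cK' Oo KK'O.
have [|U [V [Uo Vo KU KV UV]]] := compact_sep (compact_setD cK Oo) cK'.
  by apply/seteqP; split=> // x [[Kx nOx] K'x]; apply: nOx; exact: KK'O.
exists (U `|` O), V; split=> //; first exact: openU.
- move=> x Kx; have [Ox|nOx] := pselect (O x); first by right.
  by left; exact: KU.
- by move=> x [[/UV//|//] Vx].
Qed.

(** Each point of [K] has a compact neighbourhood within [K] inside the given [O]; finitely many of
    these cover [K]. *)
Lemma compact_ind (K : set S) (Q : set S -> Prop) : compact K -> Q set0 ->
  (forall A B, compact A -> compact B -> Q A -> Q B -> Q (A `|` B)) ->
  (forall p, K p -> exists O, [/\ open O, O p &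
     forall A, compact A -> A `<=` O -> Q A]) -> Q K.
Proof.
move=> cK Q0 QU loc.
have sh p : exists C : set S, K p -> [/\ nbhs p C, compact (K `&` C) & Q (K `&` C)].
  have [Kp|nKp] := pselect (K p); last by exists set0.
  have [O [Oo Op OQ]] := loc p Kp.
  have [|U [V [Uo Vo Up KV UV]]] := @compact_sep_point (K `\` O) p (compact_setD cK Oo).
    by case.
  exists (~` V) => _; split.
  - apply: (@filterS _ _ _ U); last exact: open_nbhs_nbhs.
    by move=> z /UV.
  - by apply: compact_closedI => //; exact: open_closedC.
  - apply: OQ; first by apply: compact_closedI => //; exact: open_closedC.
    move=> z [Kz nVz]; apply: contrapT => nOz; apply: nVz; exact: KV.
have [C CP] := choice sh.
have [|l [lK lC]] := @compact_finite_cover K C cK; first by move=> x /CP[].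
have -> : K = \bigcup_(x in [set` l]) (K `&` C x).
  apply/seteqP; split=> [y Ky|y [x _ [//]]].
  by have [x xl Cy] := lC y Ky; exists x.
have [//] : Q (\bigcup_(x in [set` l]) (K `&` C x)) /\
    compact (\bigcup_(x in [set` l]) (K `&` C x)).
elim: l lK {lC} => [|x l IH] lK.
  by rewrite set_nil bigcup_set0; split=> //; exact: compact0.
rewrite set_consE bigcup_setU1.
have [_ c1 q1] := CP x (lK x (mem_head _ _)).
have [|q2 c2] := IH; first by move=> z zl; apply: lK; rewrite inE zl orbT.
by split; [exact: QU | exact: compactU].
Qed.

End CompactTools.

Arguments boundary : simpl never.

Lemma set_type_compact (X : topologicalType) (A : set X) :
  compact A -> compact [set: A].
Proof.
move=> cA F PF _.
have FA : fmap (\val : A -> X) F A.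
  change (F [set x | A (\val x)]).
  by apply: (@filterS _ F _ setT) => [x _|]; [exact: set_valP | exact: filterT].
have [v [Av clv]] := cA _ (fmap_proper_filter _ PF) FA.
exists (exist (fun w => w \in A) v (mem_set Av)); split=> // P Q FP.
rewrite nbhsE /= => -[B [[B' B'o B'B] Bx] BQ].
have [] := clv (\val @` P) B'.
- by apply: (@filterS _ F _ P) => // x Px; exists x.
- by apply: open_nbhs_nbhs; split=> //; move: Bx; rewrite -B'B.
- by move=> _ [[x Px <-] B'x]; exists x; split=> //; apply: BQ; rewrite -B'B.
Qed.

Lemma addr_swap (V : zmodType) (x y a b : V) : x + y = a + b -> x - a = - (y - b).
Proof.
by move=> H; rewrite opprB; apply/eqP; rewrite subr_eq addrAC [b + a]addrC -H addrK.
Qed.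

(** A singular simplex is the evaluation of the formal identity simplex, which reduces the claim to
    [fbd_fbd]. *)
Lemma boundary_boundary (R : realType) (E : topologicalType) n (c : chain R rat E n) :
  boundary (boundary c) = 0.
Proof.
case: n c => [|[|n]] c //.
apply: (@linU_ext _ _ _ (@boundary R rat E n.+1 \o @boundary R rat E n.+2) \0) => s.
change (boundary (boundary (<< s >> : chain R rat E n.+2)) = 0).
rewrite -[<< s >>]sop_id [X in boundary (boundary X)]sopU.
have gi : suppt (good n.+2) (op_at (unit0 R) n.+2 << iota_s R n.+2 >>).
  apply: natop_good => [x|]; first exact: iota_s_simplex.
  by rewrite size_iota_s addn0.
rewrite ev_bd; [|exact: adm_id|exact: gi].
rewrite ev_bd; [by rewrite fbd_fbd linear0|exact: adm_id|].
apply: (supp_lin (f := @fbd _) gi) => t gt; rewrite [GRing.Linear.sort _ _]fbdU fbd_seqE gt.1.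
by apply: supp_sum => i _; apply: suppZ; apply: suppU; exact: good_del.
Qed.

Section InC.
Variables (R : realType) (E : topologicalType).

Definition inC (A : set E) n (c : chain R rat E n) :=
  suppt (fun s : singular R E n => forall x, A (s x)) c.

Lemma inC_submod A n : submod (@inC A n).
Proof. exact: suppt_submod. Qed.

Lemma inC_sub A B n c : A `<=` B -> @inC A n c -> inC B c.
Proof. by move=> AB; apply: sub_supp => s As x; exact: AB. Qed.

Lemma inCI A B n c : @inC A n c -> inC B c -> inC (A `&` B) c.
Proof. by move=> Ac Bc s cs x; split; [exact: Ac | exact: Bc]. Qed.

Lemma inC_bd A n (c : chain R rat E n) : inC A c -> inC A (boundary c).
Proof.
case: n c => [|n] c Ac; first exact: supp0.
apply: (supp_lin (f := @boundary R rat E n.+1) Ac) => s As.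
rewrite [GRing.Linear.sort _ _]boundaryU; apply: supp_sum => i _.
by apply: suppZ; apply: suppU => x; exact: As.
Qed.

Lemma inC_sd A n (c : chain R rat E n) : inC A c -> inC A (sd c).
Proof. exact: sd_supp. Qed.

Lemma inC_hsd A n (c : chain R rat E n) : inC A c -> inC A (hsd c).
Proof. exact: hsd_supp. Qed.

Lemma inCT n (c : chain R rat E n) : inC setT c.
Proof. exact: suppT. Qed.

Lemma inC0 n (c : chain R rat E n) : inC set0 c -> c = 0.
Proof.
move=> c0; apply: supp_false; apply: sub_supp c0 => s /(_ (vertex R ord0)).
by [].
Qed.

Lemma singular_image_compact n (s : singular R E n) : compact (range s).
Proof.
apply: continuous_compact.
  by apply: continuous_subspaceT => x; exact: (cts_fun (s := s)).
by apply: set_type_compact; exact: simplex_compact.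
Qed.

Lemma inC_compact (S : topologicalType) (f : E -> S) W n (c : chain R rat E n) :
  continuous f -> inC (f @^-1` W) c ->
  exists K, [/\ compact K, K `<=` W & forall O, K `<=` O -> inC (f @^-1` O) c].
Proof.
move=> fc cW; apply: (freegs_ind (P := fun c => exists K, [/\ compact K, K `<=` W &
  forall O, K `<=` O -> inC (f @^-1` O) (c : chain R rat E n)]) cW).
  by exists set0; split=> [||O _]; [exact: compact0 | by [] | exact: supp0].
move=> a s c' sW [K [cK KW KO]]; exists (f @` range s `|` K); split.
- apply: compactU => //; apply: continuous_compact; last exact: singular_image_compact.
  exact: continuous_subspaceT.
- by move=> y [[_ [x _ <-] <-]|/KW//]; exact: sW.
- move=> O sO; apply: suppD; last by apply: KO => y Ky; apply: sO; right.
  by apply: suppZ; apply: suppU => x; apply: sO; left; exists (s x) => //; exists x.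
Qed.

End InC.

(** * Mayer-Vietoris induction over compact sets *)

Section LocalToGlobal.
Variables (R : realType) (E S : topologicalType) (f : E -> S).
Variables (V N : forall n, chain R rat E n -> Prop).
Hypothesis fc : continuous f.
Hypothesis V_submod : forall n, submod (@V n).
Hypothesis N_submod : forall n, submod (@N n).
Hypothesis V_bd : forall n (c : chain R rat E n), V c -> V (boundary c).
Hypothesis N_bd : forall n (c : chain R rat E n), N c -> N (boundary c).
Hypothesis V_sd : forall n (c : chain R rat E n), V c -> V (sd c).
Hypothesis N_sd : forall n (c : chain R rat E n), N c -> N (sd c).
Hypothesis V_hsd : forall n (c : chain R rat E n), V c -> V (hsd c).
Hypothesis N_hsd : forall n (c : chain R rat E n), N c -> N (hsd c).
Hypothesis V_split : forall n (W1 W2 : set S) (c : chain R rat E n),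
  open W1 -> open W2 -> V c ->
  suppt (fun s : singular R E n => small (f @^-1` W1) (f @^-1` W2) s) c ->
  exists c1 c2, [/\ c = c1 + c2, V c1 /\ inC (f @^-1` W1) c1,
    V c2 /\ inC (f @^-1` W2) c2 & N c -> N c1 /\ N c2].

(** Homology of the chains of type [V] lying over [W], modulo those of type [N]. Four instances
    occur: all chains modulo those in an open set; reduced chains, localised over one coordinate;
    chains of the quotient modulo liftable ones; and invariant chains that die in the quotient,
    modulo zero and localised over the quotient. The map [f] is what allows localising over a space
    other than [E]. *)
Definition lsub W n (c : chain R rat E n) := V c /\ inC (f @^-1` W) c.
Definition lcyc W n (c : chain R rat E n) := lsub W c /\ N (boundary c).
Definition lbnd W n (c : chain R rat E n) :=
  lsub W c /\ exists e, lsub W e /\ N (c - @boundary R rat E n.+1 e).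

Lemma lsub_submod W n : submod (@lsub W n).
Proof.
split=> [|c x y [Vx Wx] [Vy Wy]].
  by split; [have [] := V_submod n | have [] := @inC_submod R E (f @^-1` W) n].
by split; [have [_] := V_submod n; exact | have [_] := @inC_submod R E (f @^-1` W) n; exact].
Qed.

Lemma lcyc_submod W n : submod (@lcyc W n).
Proof.
have [s0 sP] := lsub_submod W n; have [N0 NP] := N_submod n.-1.
split=> [|c x y [sx Nx] [sy Ny]].
  by split=> //; rewrite linear0.
by split; [exact: sP | rewrite linearP; exact: NP].
Qed.

Lemma lbnd_submod W n : submod (@lbnd W n).
Proof.
have [s0 sP] := lsub_submod W n; have [s0' sP'] := lsub_submod W n.+1.
have [N0 NP] := N_submod n.
split=> [|c x y [sx [e [se Ne]]] [sy [e' [se' Ne']]]].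
  by split=> //; exists 0; split=> //; rewrite linear0 subr0.
split; first exact: sP.
exists (c *: e + e'); split; first exact: sP'.
by rewrite linearP opprD addrACA -scalerBr; exact: NP.
Qed.

Lemma lsub_mono W W' n (c : chain R rat E n) : W `<=` W' -> lsub W c -> lsub W' c.
Proof. by move=> WW' [Vc Wc]; split=> //; apply: inC_sub Wc => x; exact: WW'. Qed.

Lemma lcyc_mono W W' n (c : chain R rat E n) : W `<=` W' -> lcyc W c -> lcyc W' c.
Proof. by move=> WW' [sc Nc]; split=> //; exact: lsub_mono sc. Qed.

Lemma lbnd_mono W W' n (c : chain R rat E n) : W `<=` W' -> lbnd W c -> lbnd W' c.
Proof.
move=> WW' [sc [e [se Ne]]]; split; first exact: lsub_mono sc.
by exists e; split=> //; exact: lsub_mono se.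
Qed.

Lemma lsub_sd W n (c : chain R rat E n) : lsub W c -> lsub W (sd c).
Proof. by move=> [Vc Wc]; split; [exact: V_sd | exact: inC_sd]. Qed.

Lemma lcyc_sd W n (c : chain R rat E n) : lcyc W c -> lcyc W (sd c).
Proof. by move=> [sc Nc]; split; [exact: lsub_sd | rewrite sd_bd; exact: N_sd]. Qed.

Lemma lsub_hsd W n (c : chain R rat E n) : lsub W c -> lsub W (hsd c).
Proof. by move=> [Vc Wc]; split; [exact: V_hsd | exact: inC_hsd]. Qed.

Lemma lbnd_sd W n (z : chain R rat E n) : lcyc W z -> lbnd W (z - sd z).
Proof.
move=> [sz Nz]; split.
  by apply: submodB => //; [exact: lsub_submod | exact: lsub_sd].
exists (hsd z); split; first exact: lsub_hsd.
rewrite hsdE opprD addNKr opprK; case: n z sz Nz => [|n] z sz Nz /=.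
  by have [] := N_submod 0.
exact: N_hsd.
Qed.

Lemma lcyc_sdk W n k (c : chain R rat E n) : lcyc W c -> lcyc W (iter k (@sd R E n) c).
Proof. by move=> cW; elim: k => //= k; exact: lcyc_sd. Qed.

Lemma lbnd_sdk W n k (z : chain R rat E n) : lcyc W z -> lbnd W (z - iter k (@sd R E n) z).
Proof.
move=> zc; elim: k => [|k IH] /=.
  by rewrite subrr; have [] := lbnd_submod W n.
rewrite -(subrKA (iter k (@sd R E n) z)); apply: submodD => //.
  exact: lbnd_submod.
by apply: lbnd_sd; exact: lcyc_sdk.
Qed.

Lemma N_sdk n k (c : chain R rat E n) : N c -> N (iter k (@sd R E n) c).
Proof. by move=> Nc; elim: k => //= k; exact: N_sd. Qed.
Lemma V_sdk n k (c : chain R rat E n) : V c -> V (iter k (@sd R E n) c).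
Proof. by move=> Nc; elim: k => //= k; exact: V_sd. Qed.
Lemma sdk_bd n k (c : chain R rat E n) :
  boundary (iter k (@sd R E n) c) = iter k (@sd R E n.-1) (boundary c).
Proof. by elim: k => //= k IH; rewrite sd_bd IH. Qed.

(** The boundary of [c1] need not lie in [N], but after subtracting [n1] it equals minus the
    corresponding chain for [c2]. It therefore lies over both open sets and represents the
    connecting class. *)
Lemma mv_split (W1 W2 : set S) n (z : chain R rat E n) : open W1 -> open W2 ->
  lcyc (W1 `|` W2) z ->
  exists c1 c2 n1 n2,
    [/\ lsub W1 c1 /\ lsub W2 c2, lbnd (W1 `|` W2) (z - (c1 + c2)),
        lsub W1 n1 /\ lsub W2 n2, N n1 /\ N n2 &
        boundary c1 + boundary c2 = n1 + n2].
Proof.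
move=> W1o W2o zc; have [[Vz Wz] Nz] := zc.
have fo W : open W -> open (f @^-1` W) by move=> ?; apply: open_comp.
have [k kz] : exists k, suppt (fun s : singular R E n =>
    small (f @^-1` W1) (f @^-1` W2) s) (iter k (@sd R E n) z).
  by apply: sd_small => //; exact: fo.
have [l lz] : exists l, suppt (fun s : singular R E n.-1 =>
    small (f @^-1` W1) (f @^-1` W2) s) (iter l (@sd R E n.-1) (boundary z)).
  by apply: sd_small; [exact: fo | exact: fo | exact: (inC_bd Wz)].
(* Both [z] and its boundary are subdivided [l + k] times, so that the two splittings belong to the
   same chain. *)
have kz' : suppt (fun s : singular R E n => small (f @^-1` W1) (f @^-1` W2) s)
    (iter (l + k) (@sd R E n) z) by rewrite iterD; exact: sd_keep_small.
have lz' : suppt (fun s : singular R E n.-1 => small (f @^-1` W1) (f @^-1` W2) s)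
    (iter (l + k) (@sd R E n.-1) (boundary z)).
  by rewrite addnC iterD; exact: sd_keep_small.
have [c1 [c2 [cE c1W c2W _]]] := V_split W1o W2o (V_sdk (l + k) Vz) kz'.
have [n1 [n2 [nE n1W n2W]]] := V_split W1o W2o (V_sdk (l + k) (V_bd Vz)) lz'.
move=> /(_ (N_sdk _ Nz)) [Nn1 Nn2].
exists c1, c2, n1, n2; split=> //; first by rewrite -cE; exact: lbnd_sdk.
by rewrite -nE -sdk_bd cE linearD.
Qed.

Hypothesis hS : hausdorff_space S.

(** Allowing any submodule [Bh] that contains the boundaries over [W] makes the principle apply also
    to the statement that a cycle is homologous to its projection. In the union step the connecting
    class lies in a group of one degree less, which [low] controls. *)
Lemma local_to_global (b : bool) (W : set S) i (Bh : chain R rat E i -> Prop) :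
  open W -> submod Bh -> (forall c, lbnd W c -> Bh c) ->
  (forall j, i = j.+1 -> forall K (O : set S), compact K -> K `<=` O -> open O ->
     O `<=` W -> exists O', [/\ open O', K `<=` O', O' `<=` O &
       fgb b (@lcyc O' j) (@lbnd O j)]) ->
  (forall p, W p -> exists O, [/\ open O, O p, O `<=` W & fgb b (@lcyc O i) Bh]) ->
  forall K, compact K -> K `<=` W ->
  exists O, [/\ open O, K `<=` O, O `<=` W & fgb b (@lcyc O i) Bh].
Proof.
move=> Wo sB bB low loc K cK KW0; move: (KW0).
apply: (@compact_ind S hS K (fun K => K `<=` W ->
  exists O, [/\ open O, K `<=` O, O `<=` W & fgb b (@lcyc O i) Bh])) => //.
- move=> _; exists set0; split=> //; first exact: open0.
  apply: fgb_sub => z [[_ z0] _]; rewrite (inC0 z0).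
  by have [] := sB.
- move=> K1 K2 cK1 cK2 IH1 IH2 KW.
  have [|O1 [O1o KO1 O1W fg1]] := IH1; first by move=> x Kx; apply: KW; left.
  have [|O2 [O2o KO2 O2W fg2]] := IH2; first by move=> x Kx; apply: KW; right.
  (* In degree 0 every chain is a cycle, so there is no connecting class and the two halves
     suffice. *)
  case: i Bh sB bB low {loc IH1 IH2} fg1 fg2 => [|j] Bh sB bB low fg1 fg2.
    exists (O1 `|` O2); split.
    + exact: openU.
    + by move=> x [/KO1|/KO2]; [left|right].
    + by move=> x [/O1W|/O2W].
    + have fg0 : fgb b (fun z => Bh z) Bh by exact: fgb_sub.
      have := fgb_add sB fg0 (fgb_add sB fg1 fg2).
      apply: fgb_mono => // z /(mv_split O1o O2o)[c1 [c2 [_ [_ [[s1 s2] bz _ _ _]]]]].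
      have N0 : N (0 : chain R rat E 0) by have [] := N_submod 0.
      exists (z - (c1 + c2)), (c1 + c2); split; last by rewrite subrK.
        apply: bB; apply: lbnd_mono bz => x [/O1W|/O2W]//.
      by exists c1, c2; split.
  have KO12' : K1 `&` K2 `<=` O1 `&` O2 by move=> x [/KO1 ? /KO2 ?].
  have O12W : O1 `&` O2 `<=` W by move=> x [/O1W].
  have [O12 [O12o KO12 O12s [L [bL HL]]]] := low j erefl _ _ (compact_setI hS cK1 cK2)
    KO12' (openI O1o O2o) O12W.
  (* The two open sets must be shrunk until they meet inside [O12], since generators are available
     only for cycles over [O12]. *)
  have [U1 [U2 [U1o U2o KU1 KU2 U12]]] := compact_shrink hS cK1 cK2 O12o KO12.
  pose W1 := U1 `&` O1; pose W2 := U2 `&` O2.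
  have W1o : open W1 by exact: openI.
  have W2o : open W2 by exact: openI.
  have WW : W1 `|` W2 `<=` W by move=> x [[_ /O1W]|[_ /O2W]].
  exists (W1 `|` W2); split=> //.
  + exact: openU.
  + move=> x [Kx|Kx]; [left|right]; split; [exact: KU1|exact: KO1|exact: KU2|exact: KO2].
  pose Z3 z := exists z0 z', [/\ Bh z0, (exists z1 z2, [/\ lcyc O1 z1, lcyc O2 z2 & z' = z1 + z2])
     & z = z0 + z'].
  have fg3 : fgb b Z3 Bh.
    have fg0 : fgb b (fun z => Bh z) Bh by exact: fgb_sub.
    exact: fgb_add sB fg0 (fgb_add sB fg1 fg2).
  apply: fgb_trans fg3.
  have sBj := lbnd_submod (O1 `&` O2) j.
  (* The coefficients attached to [z] are those of a connecting class of [z] in terms of the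
     generators [L] for the intersection. *)
  pose Rel (z : chain R rat E j.+1) a := exists c1 c2 n1 n2,
    [/\ lsub W1 c1 /\ lsub W2 c2, lbnd (W1 `|` W2) (z - (c1 + c2)),
        lsub W1 n1 /\ lsub W2 n2, N n1 /\ N n2 &
        boundary c1 + boundary c2 = n1 + n2 /\
        lbnd (O1 `&` O2) (boundary c1 - n1 - lcomb L a)].
  apply: (@fgb_rel _ b (size L) _ _ Rel (fun h => congr1 size (bL h)) (lcyc_submod _ _)).
  + move=> c z z' a a' [c1 [c2 [n1 [n2 [[s1 s2] bz [t1 t2] [m1 m2] [E1 E2]]]]]]
      [c1' [c2' [n1' [n2' [[s1' s2'] bz' [t1' t2'] [m1' m2'] [E1' E2']]]]]].
    exists (c *: c1 + c1'), (c *: c2 + c2'), (c *: n1 + n1'), (c *: n2 + n2').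
    have [_ sP1] := lsub_submod W1 j.+1; have [_ sP2] := lsub_submod W2 j.+1.
    have [_ sQ1] := lsub_submod W1 j; have [_ sQ2] := lsub_submod W2 j.
    have [_ NP] := N_submod j; have [_ bP] := lbnd_submod (W1 `|` W2) j.+1.
    split; [by split; [exact: sP1 | exact: sP2] | |
      by split; [exact: sQ1 | exact: sQ2] | by split; exact: NP |].
      have -> : c *: z + z' - (c *: c1 + c1' + (c *: c2 + c2')) =
          c *: (z - (c1 + c2)) + (z' - (c1' + c2')).
        by rewrite addrACA -scalerDr opprD addrACA -scalerBr.
      exact: bP.
    split; first by rewrite !linearP addrACA -scalerDr E1 E1' [RHS]addrACA -scalerDr.
    have -> : boundary (c *: c1 + c1') - (c *: n1 + n1') -
        lcomb L (fun i => c * a i + a' i) =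
        c *: (boundary c1 - n1 - lcomb L a) + (boundary c1' - n1' - lcomb L a').
      rewrite lcombP linearP opprD addrACA -scalerBr opprD addrACA -scalerBr.
      by [].
    by case: sBj => _; exact.
  + move=> z /(mv_split W1o W2o)[c1 [c2 [n1 [n2 [[s1 s2] bz [t1 t2] [m1 m2] E1]]]]].
    have [|a Ha] := HL (boundary c1 - n1).
      have W12 : W1 `&` W2 `<=` O12 by move=> x [[U1x _] [U2x _]]; exact: U12.
      apply: (lcyc_mono W12); split; last first.
        rewrite linearB /= ; apply: submodB; first exact: N_submod.
          have -> : boundary (boundary c1) = 0 by exact: boundary_boundary.
          by have [] := N_submod j.-1.
        exact: N_bd.
      split.
        by apply: submodB => //; [exact: V_bd (s1.1) | exact: t1.1].
      rewrite preimage_setI; apply: inCI.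
        exact: (submodB (@inC_submod R E (f @^-1` W1) j) (inC_bd s1.2) t1.2).
      rewrite (addr_swap E1).
      apply: (submodN (@inC_submod R E (f @^-1` W2) j)).
      exact: (submodB (@inC_submod R E (f @^-1` W2) j) (inC_bd s2.2) t2.2).
    by exists a, c1, c2, n1, n2.
  + move=> z a zc [c1 [c2 [n1 [n2 [[s1 s2] bz [t1 t2] [m1 m2] [E1 E2]]]]]] a0.
    have L0 : lcomb L a = 0 by rewrite /lcomb big1 // => k _; rewrite a0 ?scale0r.
    rewrite L0 subr0 in E2; have [sE [e [se Ne]]] := E2.
    exists (z - (c1 + c2)), (c1 + c2); split; last by rewrite subrK.
      by apply: bB; exact: lbnd_mono bz.
    (* [e] bounds the connecting class modulo [N] and lies over both sets; moving it from one half
       to the other turns both halves into cycles. *)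
    have se1 : lsub O1 e by apply: lsub_mono se => x [].
    have se2 : lsub O2 e by apply: lsub_mono se => x [].
    exists (c1 - e), (c2 + e); split; last by rewrite addrACA addNr addr0.
      split; first apply: submodB => //; first exact: lsub_submod.
        by apply: lsub_mono s1 => x [].
      have -> : boundary (c1 - e) = n1 + (boundary c1 - n1 - boundary e).
        by rewrite linearB /= addrA addrCA subrr addr0.
      by apply: submodD.
    split; first apply: submodD => //; first exact: lsub_submod.
      by apply: lsub_mono s2 => x [].
    have -> : boundary (c2 + e) = n2 - (boundary c1 - n1 - boundary e).
      by rewrite linearD /= opprB (addr_swap E1) opprK addrCA [n2 + _]addrC subrK addrC.
    by apply: submodB.
- move=> p Kp; have [O [Oo Op OW fgO]] := loc p (KW0 p Kp).
  by exists O; split=> // A cA AO _; exists O.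
Qed.

(** Induction on the degree: the union step in degree [i] consults intersections in degree [i - 1],
    for arbitrary smaller open sets. *)
Lemma local_to_global_all (b : bool) (W : set S) k :
  (forall i (O : set S) p, (i <= k)%N -> open O -> O `<=` W -> O p ->
     exists O', [/\ open O', O' p, O' `<=` O & fgb b (@lcyc O' i) (@lbnd O i)]) ->
  forall i (K O : set S), (i <= k)%N -> compact K -> K `<=` O -> open O -> O `<=` W ->
  exists O', [/\ open O', K `<=` O', O' `<=` O & fgb b (@lcyc O' i) (@lbnd O i)].
Proof.
move=> loc; elim=> [|i IH] K O ik cK KO Oo OW.
  apply: local_to_global => // [|p Op]; first exact: lbnd_submod.
  exact: loc.
apply: local_to_global => // [|j [<-] K' O' cK' K'O' O'o O'O|p Op].
- exact: lbnd_submod.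
- by apply: IH => //; [exact: ltnW | move=> x /O'O/OW].
- exact: loc.
Qed.

Lemma local_to_global_vanish (W : set S) k : open W ->
  (forall i (O : set S) p, (i <= k)%N -> open O -> O `<=` W -> O p ->
     exists O', [/\ open O', O' p, O' `<=` O & fgb true (@lcyc O' i) (@lbnd O i)]) ->
  forall c : chain R rat E k, lcyc W c -> lbnd W c.
Proof.
move=> Wo loc c cc; have [[Vc Wc] Nc] := cc.
have [K [cK KW KO]] := inC_compact fc Wc.
have [O [Oo KOs OW /fgbT]] := local_to_global_all loc (leqnn k) cK KW Wo (@subset_refl _ W).
by apply; split=> //; split=> //; exact: KO.
Qed.
End LocalToGlobal.

(** * Relative Mayer-Vietoris and homotopy invariance *)

Lemma boundaryB (R : realType) (E : topologicalType) n (c c' : chain R rat E n) :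
  boundary (c - c') = boundary c - boundary c'.
Proof. exact: linearB. Qed.

Section RelativeChains.
Variables (R : realType) (E : topologicalType).
Implicit Types (A U O : set E).

(** Cycles of the pair formed by [A] and [A] intersected with [U]: a chain in [A] has its boundary
    in [A] anyway. An empty [U] gives the absolute homology of [A], and [A] full gives the pair of
    [E] and [U]. *)
Definition rcyc A U n (c : chain R rat E n) := inC A c /\ inC U (boundary c).
Definition rbnd A U n (c : chain R rat E n) :=
  inC A c /\ exists e, inC A e /\ inC U (c - @boundary R rat E n.+1 e).

Lemma rcyc_submod A U n : submod (@rcyc A U n).
Proof.
have [s0 sP] := @inC_submod R E A n; have [N0 NP] := @inC_submod R E U n.-1.
split=> [|c x y [sx Nx] [sy Ny]]; first by split=> //; rewrite linear0.
by split; [exact: sP | rewrite linearP; exact: NP].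
Qed.

Lemma rbnd_submod A U n : submod (@rbnd A U n).
Proof.
have [s0 sP] := @inC_submod R E A n; have [s0' sP'] := @inC_submod R E A n.+1.
have [N0 NP] := @inC_submod R E U n.
split=> [|c x y [sx [e [se Ne]]] [sy [e' [se' Ne']]]].
  by split=> //; exists 0; split=> //; rewrite linear0 subr0.
split; first exact: sP.
exists (c *: e + e'); split; first exact: sP'.
by rewrite linearP opprD addrACA -scalerBr; exact: NP.
Qed.

Lemma rcyc_mono A A' U U' n (c : chain R rat E n) : A `<=` A' -> U `<=` U' ->
  rcyc A U c -> rcyc A' U' c.
Proof. by move=> AA UU [Ac Uc]; split; [exact: inC_sub Ac | exact: inC_sub Uc]. Qed.

Lemma rbnd_mono A A' U U' n (c : chain R rat E n) : A `<=` A' -> U `<=` U' ->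
  rbnd A U c -> rbnd A' U' c.
Proof.
move=> AA UU [Ac [e [Ae Ue]]]; split; first exact: inC_sub Ac.
by exists e; split; [exact: inC_sub Ae | exact: inC_sub Ue].
Qed.

Lemma rbnd_in A U n (c : chain R rat E n) : inC A c -> inC U c -> rbnd A U c.
Proof.
move=> Ac Uc; split=> //; exists 0; split; first exact: supp0.
by rewrite linear0 subr0.
Qed.

Lemma rbnd_bd A U n (e : chain R rat E n.+1) : inC A e -> rbnd A U (boundary e).
Proof.
move=> Ae; split; first exact: inC_bd Ae.
by exists e; split=> //; rewrite subrr; exact: supp0.
Qed.

Lemma rbnd_sd A U n (z : chain R rat E n) : rcyc A U z -> rbnd A U (z - sd z).
Proof.
move=> [Az Uz]; split; first by apply: suppB => //; exact: inC_sd.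
exists (hsd z); split; first exact: inC_hsd.
rewrite hsdE opprD addNKr opprK; case: n z Az Uz => [|n] z Az Uz /=.
  exact: supp0.
exact: inC_hsd.
Qed.

Lemma rcyc_sd A U n (c : chain R rat E n) : rcyc A U c -> rcyc A U (sd c).
Proof. by move=> [Ac Uc]; split; [exact: inC_sd | rewrite sd_bd; exact: inC_sd]. Qed.

Lemma inC_sdk A n k (c : chain R rat E n) : inC A c -> inC A (iter k (@sd R E n) c).
Proof. exact: sd_iter_supp. Qed.

Lemma sdk_boundary n k (c : chain R rat E n) :
  boundary (iter k (@sd R E n) c) = iter k (@sd R E n.-1) (boundary c).
Proof. by elim: k => //= k IH; rewrite sd_bd IH. Qed.

Lemma rbnd_sdk A U n k (z : chain R rat E n) : rcyc A U z ->
  rbnd A U (z - iter k (@sd R E n) z).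
Proof.
move=> zc; have zk i : rcyc A U (iter i (@sd R E n) z).
  by elim: i => //= i; exact: rcyc_sd.
elim: k => [|k IH] /=; first by rewrite subrr; have [] := rbnd_submod A U n.
rewrite -(subrKA (iter k (@sd R E n) z)); apply: submodD => //.
  exact: rbnd_submod.
exact: rbnd_sd.
Qed.

Lemma inC_split (U1 U2 : set E) n (c : chain R rat E n) A :
  suppt (fun s : singular R E n => small U1 U2 s) c -> inC A c ->
  exists c1 c2, [/\ c = c1 + c2, inC U1 c1, inC U2 c2, inC A c1 & inC A c2].
Proof.
move=> cs cA; pose Q (s : singular R E n) := forall x, U1 (s x).
exists (restr Q c), (c - restr Q c); split.
- by rewrite addrC subrK.
- by have := supp_restr (P := Q) cs; apply: sub_supp => s [].
- by have := supp_restrC (P := Q) cs; apply: sub_supp => s [[]].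
- by have := supp_restr (P := Q) cA; apply: sub_supp => s [].
- by have := supp_restrC (P := Q) cA; apply: sub_supp => s [].
Qed.

Lemma inC_union_split (U1 U2 : set E) n (c : chain R rat E n) A : open U1 -> open U2 ->
  inC (U1 `|` U2) c -> inC A c ->
  exists k c1 c2, [/\ iter k (@sd R E n) c = c1 + c2, inC U1 c1, inC U2 c2,
    inC A c1 & inC A c2].
Proof.
move=> U1o U2o cU cA; have [k ks] := sd_small U1o U2o cU.
have [c1 [c2 H]] := inC_split ks (@inC_sdk _ _ k _ cA).
by exists k, c1, c2.
Qed.

(** * A union of two subspaces with acyclic pairs *)

Section PairUnion.
Variables (W A' U1 U2 : set E).
Hypotheses (U1o : open U1) (U2o : open U2) (U12 : U1 `&` U2 `<=` A').
Hypotheses (A1 : A' `<=` U1) (A2 : A' `<=` U2).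
Hypothesis H1 : forall n (z : chain R rat E n), rcyc W U1 z -> rbnd W U1 z.
Hypothesis H2 : forall n (z : chain R rat E n), rcyc W U2 z -> rbnd W U2 z.

Lemma pair_union0 (z : chain R rat E 0) : rcyc W (U1 `|` U2) z -> rbnd W (U1 `|` U2) z.
Proof.
move=> [Wz _]; apply: (rbnd_mono (@subset_refl _ W) (@subsetUl _ U1 U2)).
by apply: H1; split=> //; exact: supp0.
Qed.

(** Split the boundary of a subdivided cycle as [u1 + u2]. Then [u1] is a cycle of the pair ([W],
    [A']), and if [e] bounds it there, the cycle is the sum of a cycle of ([W], [U2]) and the cycle
    [e] of ([W], [U1]), both of which bound. This shifts the degree by one. *)
Lemma pair_unionS b j : fgb b (@rcyc W A' j) (@rbnd W A' j) ->
  fgb b (@rcyc W (U1 `|` U2) j.+1) (@rbnd W (U1 `|` U2) j.+1).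
Proof.
move=> [L [bL HL]].
pose Rel (z : chain R rat E j.+1) a := exists z' u1 u2,
  [/\ rbnd W (U1 `|` U2) (z - z') /\ inC W z', boundary z' = u1 + u2,
      inC U1 u1 /\ inC W u1, inC U2 u2 /\ inC W u2 & rbnd W A' (u1 - lcomb L a)].
apply: (@fgb_rel _ b (size L) _ _ Rel (fun h => congr1 size (bL h)) (rcyc_submod _ _ _)).
- move=> c z1 z2 a1 a2 [z1' [u1 [u2 [[r1 w1] E1 [p1 p2] [q1 q2] B1]]]].
  move=> [z2' [v1 [v2 [[r2 w2] E2 [s1 s2] [t1 t2] B2]]]].
  have [_ iW] := @inC_submod R E W j.+1; have [_ iW'] := @inC_submod R E W j.
  have [_ i1] := @inC_submod R E U1 j; have [_ i2] := @inC_submod R E U2 j.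
  have [_ rP] := rbnd_submod W (U1 `|` U2) j.+1; have [_ rP'] := rbnd_submod W A' j.
  exists (c *: z1' + z2'), (c *: u1 + v1), (c *: u2 + v2); split.
  + by rewrite opprD addrACA -scalerBr; split; [exact: rP | exact: iW].
  + by rewrite boundaryD boundaryZ E1 E2 addrACA -scalerDr.
  + by split; [exact: i1 | exact: iW'].
  + by split; [exact: i2 | exact: iW'].
  + by rewrite lcombP opprD addrACA -scalerBr; exact: rP'.
- move=> z zc; have [zW zU] := zc.
  have [k [u1 [u2 [E12 p1 q1 p2 q2]]]] := inC_union_split U1o U2o zU (inC_bd zW).
  have [|a Ba] := HL u1.
    split=> //; apply: inC_sub U12 _; apply: inCI; first exact: inC_bd.
    have -> : boundary u1 = - boundary u2.
      apply/eqP; rewrite -addr_eq0 -linearD -E12 -sdk_boundary.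
      by apply/eqP; exact: boundary_boundary.
    by apply: suppN; exact: inC_bd.
  exists a, (iter k (@sd R E j.+1) z), u1, u2; split=> //.
    by split; [exact: rbnd_sdk | exact: inC_sdk].
  by rewrite sdk_boundary.
- move=> z a zc [z' [u1 [u2 [[r1 w1] E1 [p1 p2] [q1 q2] B1]]]] a0.
  have L0 : lcomb L a = 0 by rewrite /lcomb big1 // => k _; rewrite a0 ?scale0r.
  rewrite L0 subr0 in B1; have [_ [e [We Ae]]] := B1.
  rewrite -(subrK z' z); apply: submodD => //; first exact: rbnd_submod.
  rewrite -(subrK e z'); apply: submodD; first exact: rbnd_submod.
    apply: (rbnd_mono (@subset_refl _ W) (@subsetUr _ U1 U2)).
    apply: H2; split; first exact: suppB.
    have -> : boundary (z' - e) = u2 + (u1 - boundary e).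
      by rewrite [LHS]linearB /= E1 addrAC addrC.
    by apply: suppD => //; exact: inC_sub Ae.
  apply: (rbnd_mono (@subset_refl _ W) (@subsetUl _ U1 U2)).
  apply: H1; split=> //.
  have -> : boundary e = u1 - (u1 - boundary e) by rewrite subKr.
  by apply: suppB => //; exact: inC_sub Ae.
Qed.
End PairUnion.

(** * The relative Mayer-Vietoris sequence *)

Section PairIntersection.
Variables (U1 U2 : set E).
Hypotheses (U1o : open U1) (U2o : open U2).

(** The connecting map from the pair with [U1] united with [U2] to the pair with their intersection,
    sending the class of [y] to that of [z]. It is a relation because it is read backwards: a [z]
    that bounds modulo each of the two sets has some [y] over it. *)
Definition conn n (y : chain R rat E n.+1) (z : chain R rat E n) := exists e1 e2,
  [/\ y = e1 - e2, inC U1 (z - boundary e1) & inC U2 (z - boundary e2)].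

Lemma connP n (c : rat) y y' (z z' : chain R rat E n) :
  conn y z -> conn y' z' -> conn (c *: y + y') (c *: z + z').
Proof.
move=> [e1 [e2 [-> H1 H2]]] [e1' [e2' [-> H1' H2']]].
have [_ i1] := @inC_submod R E U1 n; have [_ i2] := @inC_submod R E U2 n.
exists (c *: e1 + e1'), (c *: e2 + e2'); split.
- by rewrite opprD addrACA -scalerBr.
- by rewrite linearP opprD addrACA -scalerBr; exact: i1.
- by rewrite linearP opprD addrACA -scalerBr; exact: i2.
Qed.

Lemma conn_rcyc n y (z : chain R rat E n) : conn y z -> rcyc setT (U1 `|` U2) y.
Proof.
move=> [e1 [e2 [-> H1 H2]]]; split; first exact: inCT.
have -> : boundary (e1 - e2) = (z - boundary e2) - (z - boundary e1).
  by rewrite [LHS]linearB /= opprB [RHS]addrC addrA subrK.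
apply: suppB; first by apply: inC_sub H2 => x; right.
by apply: inC_sub H1 => x; left.
Qed.

Lemma conn_ex n (z : chain R rat E n) :
  rbnd setT U1 z -> rbnd setT U2 z -> exists y, conn y z.
Proof. by move=> [_ [e1 [_ H1]]] [_ [e2 [_ H2]]]; exists (e1 - e2), e1, e2. Qed.

Lemma conn_rbnd n y (z : chain R rat E n) : rcyc setT (U1 `&` U2) z ->
  conn y z -> rbnd setT (U1 `|` U2) y -> rbnd setT (U1 `&` U2) z.
Proof.
move=> zc [e1 [e2 [yE K1 K2]]] [_ [f [_ Uf]]].
have [k [v1 [v2 [vE p1 q1 _ _]]]] := inC_union_split U1o U2o Uf (@inCT R E n.+1 _).
rewrite -(subrK (iter k (@sd R E n) z) z); apply: submodD.
- exact: rbnd_submod.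
- exact: rbnd_sdk.
split; first exact: inCT.
have sdB m (x x' : chain R rat E m) i : iter i (@sd R E m) (x - x') =
    iter i (@sd R E m) x - iter i (@sd R E m) x'.
  by elim: i => //= i ->; rewrite linearB.
have bdk (x : chain R rat E n.+1) :
    iter k (@sd R E n) (boundary x) = boundary (iter k (@sd R E n.+1) x).
  by rewrite sdk_boundary.
(* The subdivided [e1] minus [v1] and the subdivided [e2] plus [v2] differ by a boundary, so one
   chain bounds [z] modulo [U1] and modulo [U2] at once. *)
exists (iter k (@sd R E n.+1) e1 - v1); split; first exact: inCT.
have alg (x p q : chain R rat E n) : x - (p - q) = x - p + q.
  by rewrite opprB addrA addrAC.
apply: inCI.
  rewrite boundaryB -bdk alg -sdB.
  by apply: suppD; [exact: inC_sdk | exact: inC_bd p1].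
have -> : boundary (iter k (@sd R E n.+1) e1 - v1) =
    boundary (iter k (@sd R E n.+1) e2 + v2).
  have := congr1 (@boundary R rat E n.+1) vE.
  have bb : @boundary R rat E n.+1 (boundary f) = 0 := boundary_boundary f.
  rewrite -bdk yE !boundaryB bb subr0 boundaryD sdB !bdk boundaryD => H.
  by apply/eqP; rewrite subr_eq addrAC -addrA -H addrC subrK.
rewrite boundaryD -bdk opprD addrA -sdB.
by apply: suppB; [exact: inC_sdk | exact: inC_bd q1].
Qed.
End PairIntersection.

Section PushRel.
Variables (f : E -> E).

Lemma push_inC A B n (c : chain R rat E n) : (forall x, A x -> B (f x)) ->
  inC A c -> inC B (push f c).
Proof. exact: push_supp. Qed.

Hypothesis fc : continuous f.

Lemma push_boundary n (c : chain R rat E n) : boundary (push f c) = push f (boundary c).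
Proof. by apply: push_bd; exact: cts_push. Qed.

Lemma push_rcyc A U n (c : chain R rat E n) : (forall x, A x -> A (f x)) ->
  (forall x, U x -> U (f x)) -> rcyc A U c -> rcyc A U (push f c).
Proof.
move=> fA fU [Ac Uc]; split; first exact: push_inC Ac.
by rewrite push_boundary; exact: push_inC Uc.
Qed.

Lemma push_rbnd A U n (c : chain R rat E n) : (forall x, A x -> A (f x)) ->
  (forall x, U x -> U (f x)) -> rbnd A U c -> rbnd A U (push f c).
Proof.
move=> fA fU [Ac [e [Ae Ue]]]; split; first exact: push_inC Ac.
exists (push f e); split; first exact: push_inC Ae.
by rewrite push_boundary -linearB; exact: push_inC Ue.
Qed.
End PushRel.

End RelativeChains.

Section HomotopyRel.
Variables (R : realType) (E E' : topologicalType) (H : E -> R -> E').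

(** Joint continuity at the points of [A] only: a homotopy written in charts means nothing outside
    their domain. *)
Definition hcont (A : set E) := forall x (a : R), A x -> 0 <= a <= 1 ->
  (fun p : E * R => H p.1 p.2) @ nbhs (x, a) --> H x a.

Lemma hcont_adm A n (s : singular R E n) : hcont A -> (forall x, A (s x)) -> adm H s.
Proof.
move=> Hc As k u tau uc tc t01 t.
have pc : continuous (fun t => (s (u t), tau t)).
  apply: pair_continuous => // {}t.
  exact: (continuous_comp (uc t) (cts_fun (s := s) _)).
exact: (cvg_comp _ _ (pc t) (Hc _ _ (As _) (t01 _))).
Qed.

Lemma homotopy_rbnd A A' U U' n (z : chain R rat E n) : hcont A ->
  (forall x (a : R), A x -> 0 <= a <= 1 -> A' (H x a)) ->
  (forall x (a : R), A x -> U x -> 0 <= a <= 1 -> U' (H x a)) ->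
  rcyc A U z -> rbnd A' U' (push (H^~ 1) z - push (H^~ 0) z).
Proof.
move=> Hc HA HU [Az Uz]; split.
  by apply: suppB; apply: push_supp Az => x Ax; apply: HA => //; rewrite lexx ler01.
exists (prism H z); split; first by apply: prism_supp Az.
rewrite prismE; last by apply: sub_supp Az => s; exact: hcont_adm.
rewrite opprB addrC subrK; case: n z Az Uz => [|n] z Az Uz /=; first exact: supp0.
by apply: (prism_supp _ (inCI (inC_bd Az) Uz)) => x a [Ax Ux]; exact: HU.
Qed.

End HomotopyRel.

(** * Euclidean discs *)

(** The classes of [r] are open, hence also closed as complements of unions of classes. *)
Lemma connected_rel (X : topologicalType) (r : X -> X -> Prop) :
  connected [set: X] -> (forall x, r x x) -> (forall x y, r x y -> r y x) ->
  (forall x y z, r x y -> r y z -> r x z) ->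
  (forall x, \forall y \near x, r x y) -> forall x y, r x y.
Proof.
move=> cX r1 rS rT rO x y.
have o : open [set z | r x z].
  rewrite openE => z /= rxz; apply: filterS (rO z) => w; exact: rT.
have c : closed [set z | r x z].
  rewrite -[X in closed X]setCK; apply: open_closedC; rewrite openE => z /= nrxz.
  by apply: filterS (rO z) => w rzw rxw; apply: nrxz; apply: rT rxw (rS _ _ rzw).
have -> : r x y = [set z | r x z] y by [].
have -> // : [set z | r x z] = setT.
apply: cX; first by exists x; exact: r1.
  by exists [set z | r x z] => //; rewrite setTI.
by exists [set z | r x z] => //; rewrite setTI.
Qed.

Section ExtendOpen.
Variables (X T : topologicalType) (U : set X) (phi : set_type U -> T) (t0 : T).

(** Charts are given between subtypes; with a default value outside the domain they compose as total
    functions, and continuity at points of [U] is kept. *)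
Definition ext_open (y : X) : T := oapp phi t0 (insub y).

Lemma ext_openE (u : set_type U) : ext_open (\val u) = phi u.
Proof. by rewrite /ext_open valK. Qed.

Lemma ext_open_in y (Uy : y \in U) :
  ext_open y = phi (exist (fun w => w \in U) y Uy).
Proof. by rewrite -ext_openE. Qed.

Lemma ext_within_continuous : continuous phi ->
  forall y, U y -> forall N : set T, nbhs (ext_open y) N ->
  nbhs y [set z | U z -> N (ext_open z)].
Proof.
move=> pc y Uy N; rewrite (ext_open_in (mem_set Uy)) => nN.
have := pc _ _ nN; rewrite nbhs_filterE /= nbhsE /= => -[B [[B' B'o B'B] Bx] BN].
exists B'; first by split=> //; move: Bx; rewrite -B'B.
move=> z B'z Uz; rewrite /= (ext_open_in (mem_set Uz)).
by apply: BN; rewrite -B'B.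
Qed.

Lemma ext_open_continuous : open U -> continuous phi ->
  forall y, U y -> {for y, continuous ext_open}.
Proof.
move=> Uo pc y Uy N nN.
have nU := open_nbhs_nbhs (conj Uo Uy).
by apply: filterS (filterI nU (ext_within_continuous pc Uy nN)) => z [Uz]; apply.
Qed.
End ExtendOpen.

Section Squash.
Variable R : realType.

(** A homeomorphism from the line to the interval from -1 to 1, applied coordinatewise to turn a
    small cube of a chart into all of Euclidean space. *)
Definition squash (t : R) := t / (1 + `|t|).
Definition unsquash (s : R) := s / (1 - `|s|).

Lemma squash_lt1 t : `|squash t| < 1.
Proof.
have h : 0 < 1 + `|t| by rewrite ltr_pwDl.
by rewrite normrM normfV (gtr0_norm h) ltr_pdivrMr // mul1r ltrDr.
Qed.

Lemma squashK : cancel squash unsquash.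
Proof.
move=> t; have h : 0 < 1 + `|t| by rewrite ltr_pwDl.
rewrite /unsquash /squash normrM normfV (gtr0_norm h).
have h' : 1 + `|t| != 0 by rewrite gt_eqF.
have -> : 1 - `|t| / (1 + `|t|) = (1 + `|t|)^-1 by field.
by rewrite invrK -mulrA mulVf // mulr1.
Qed.

Lemma unsquashK s : `|s| < 1 -> squash (unsquash s) = s.
Proof.
move=> s1; have h : 0 < 1 - `|s| by rewrite subr_gt0.
rewrite /squash /unsquash normrM normfV (gtr0_norm h).
have h' : 1 - `|s| != 0 by rewrite gt_eqF.
have -> : 1 + `|s| / (1 - `|s|) = (1 - `|s|)^-1 by field.
by rewrite invrK -mulrA mulVf // mulr1.
Qed.

Lemma squash_continuous : continuous squash.
Proof.
move=> t; apply: cvgM; first exact: cvg_id.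
apply: cvgV; first by rewrite gt_eqF // ltr_pwDl.
apply: cvgD; first exact: cvg_cst.
exact: norm_continuous.
Qed.

Lemma unsquash_continuous s : `|s| < 1 -> {for s, continuous unsquash}.
Proof.
move=> s1; apply: cvgM; first exact: cvg_id.
apply: cvgV; first by rewrite gt_eqF // subr_gt0.
apply: cvgB; first exact: cvg_cst.
exact: norm_continuous.
Qed.

Lemma squash0 : squash 0 = 0. Proof. by rewrite /squash mul0r. Qed.
End Squash.

Section Discs.
Variables (R : realType) (d : nat) (X : topologicalType).

(** The model is the whole of Euclidean space, so [dof] is total and translations or rescalings in
    the chart never leave the disc. *)
Record disc (x : X) (W : set X) := Disc {
  dset : set X;
  dto : X -> 'rV[R]_d;
  dof : 'rV[R]_d -> X;
  d_open : open dset;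
  d_sub : dset `<=` W;
  d_of : forall v, dset (dof v);
  d_ofK : forall v, dto (dof v) = v;
  d_toK : forall y, dset y -> dof (dto y) = y;
  d_of_cts : continuous dof;
  d_to_cts : forall y, dset y -> {for y, continuous dto};
  d_center : dof 0 = x }.

Lemma d_x x W (D : disc x W) : dset D x.
Proof. by rewrite -{2}(d_center D); exact: d_of. Qed.

Lemma mx_box_nbhs (v : 'rV[R]_d) (N : set 'rV[R]_d) : nbhs v N ->
  exists2 e : R, 0 < e &
    forall w : 'rV[R]_d, (forall i, `|w ord0 i - v ord0 i| < e) -> N w.
Proof.
move=> /nbhs_ballP[e /= e0 eN]; exists e => // w wv; apply: eN.
by split=> // i j; rewrite (ord1 i) -ball_normE /= distrC; exact: wv.
Qed.

Lemma mx_box_open (v : 'rV[R]_d) (e : R) :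
  open [set w : 'rV[R]_d | forall i, `|w ord0 i - v ord0 i| < e].
Proof.
rewrite openE => w /= wv.
have : forall i, nbhs w [set w' : 'rV[R]_d | `|w' ord0 i - v ord0 i| < e].
  move=> i; have cc : {for w, continuous (fun w' : 'rV[R]_d => `|w' ord0 i - v ord0 i|)}.
    apply: (@continuous_comp _ _ _ (fun w' : 'rV[R]_d => w' ord0 i - v ord0 i)
      (fun x : R => `|x|)); last exact: norm_continuous.
    exact: (cvgB (@mx_coord_continuous R 1 d ord0 i w) (cvg_cst _)).
  apply: (cc [set x | x < e]); apply: open_nbhs_nbhs.
  by split; [exact: open_lt | exact: wv].
by move=> /filter_forall; apply: filterS => w'.
Qed.

Lemma disc_exists (x : X) (W : set X) : euclidean_at R d x -> nbhs x W ->
  inhabited (disc x W).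
Proof.
move=> [U [V [[Uo Ux] Vo [h [k [hc kc hk kh]]]]]] Wx.
pose xU : set_type U := exist (fun w => w \in U) x (mem_set Ux).
pose h' := ext_open (fun u : set_type U => \val (h u)) 0.
pose k' := ext_open (fun v : set_type V => \val (k v)) x.
have h'c : forall y, U y -> {for y, continuous h'}.
  apply: ext_open_continuous => // u.
  exact: (continuous_comp (hc u) (@val_continuous _ V _)).
have k'c : forall v, V v -> {for v, continuous k'}.
  apply: ext_open_continuous => // u.
  exact: (continuous_comp (kc u) (@val_continuous _ U _)).
have h'V y : U y -> V (h' y) by move=> Uy; rewrite /h' (ext_open_in _ _ (mem_set Uy)); exact: set_valP.
have k'U v : V v -> U (k' v) by move=> Vv; rewrite /k' (ext_open_in _ _ (mem_set Vv)); exact: set_valP.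
have h'K y : U y -> k' (h' y) = y.
  by move=> Uy; rewrite /h' /k' (ext_open_in _ _ (mem_set Uy)) ext_openE hk.
have k'K v : V v -> h' (k' v) = v.
  by move=> Vv; rewrite /h' /k' (ext_open_in _ _ (mem_set Vv)) ext_openE kh.
pose v0 := h' x.
have Vv0 : V v0 by exact: h'V.
(* An open cube around the chart point, contained in the chart and mapped into [W]; [squash] scaled
   by [e] parametrises it. *)
have [e e0 eP] : exists2 e : R, 0 < e &
    forall w : 'rV[R]_d, (forall i, `|w ord0 i - v0 ord0 i| < e) -> (V `&` (k' @^-1` W)) w.
  apply: mx_box_nbhs; apply: filterI; first exact: open_nbhs_nbhs.
  by apply: k'c => //; rewrite /v0 h'K.
pose B := [set w : 'rV[R]_d | forall i, `|w ord0 i - v0 ord0 i| < e].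
pose D := U `&` (h' @^-1` B).
pose of_ (v : 'rV[R]_d) := k' (\row_i (v0 ord0 i + e * squash (v ord0 i))).
pose to_ y := \row_i unsquash ((h' y ord0 i - v0 ord0 i) / e) : 'rV[R]_d.
have inB (v : 'rV[R]_d) : B (\row_i (v0 ord0 i + e * squash (v ord0 i))).
  move=> i; rewrite !mxE addrAC subrr add0r normrM (gtr0_norm e0).
  by rewrite gtr_pMr // squash_lt1.
have inV (v : 'rV[R]_d) : V (\row_i (v0 ord0 i + e * squash (v ord0 i))) by exact: (eP _ (inB v)).1.
have e00 : e != 0 by rewrite gt_eqF.
have sm y i : D y -> `|(h' y ord0 i - v0 ord0 i) / e| < 1.
  move=> [Uy By]; rewrite normrM normfV (gtr0_norm e0) ltr_pdivrMr // mul1r.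
  exact: By.
split; exists D to_ of_.
- rewrite openE => y [Uy By]; apply: filterI; first exact: open_nbhs_nbhs.
  by apply: h'c => //; apply: open_nbhs_nbhs; split => //; exact: mx_box_open.
- by move=> y [Uy By]; rewrite -(h'K y Uy); exact: (eP _ By).2.
- move=> v; split; first exact: k'U.
  by rewrite /preimage /= k'K.
- move=> v; apply/rowP => i; rewrite mxE /of_ k'K // mxE addrAC subrr add0r.
  by rewrite mulrAC divff // mul1r squashK.
- move=> y Dy; have [Uy By] := Dy; rewrite /of_ -[RHS](h'K y Uy); congr k'.
  apply/rowP => i; rewrite !mxE unsquashK ?sm // mulrCA divff // mulr1.
  by rewrite addrC subrK.
- move=> v; apply: (@continuous_comp _ _ _
    (fun v : 'rV[R]_d => \row_i (v0 ord0 i + e * squash (v ord0 i)) : 'rV[R]_d) k').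
    apply: mx_continuous => i j w.
    rewrite (_ : (fun t : 'rV[R]_d => _) = fun t : 'rV[R]_d => v0 ord0 j + e * squash (t ord0 j)); last first.
      by apply/funext => t; rewrite mxE.
    exact: (cvgD (cvg_cst _) (cvgM (cvg_cst _) (continuous_comp
      (@mx_coord_continuous R 1 d ord0 j w) (@squash_continuous R _)))).
  exact: k'c.
- move=> y Dy; have [Uy By] := Dy => N [Q Qy QN].
  have : forall j, \forall z \near y, Q ord0 j (to_ z ord0 j).
    move=> j; have cj : {for y, continuous (fun z => to_ z ord0 j)}.
      rewrite (_ : (fun z => _) = fun z => unsquash ((h' z ord0 j - v0 ord0 j) / e)); last first.
        by apply/funext => t; rewrite mxE.
      apply: (@continuous_comp _ _ _ (fun z => (h' z ord0 j - v0 ord0 j) / e) (@unsquash R)).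
        exact: (cvgM (cvgB (continuous_comp (h'c y Uy)
          (@mx_coord_continuous R 1 d ord0 j _)) (cvg_cst _)) (cvg_cst _)).
      by apply: unsquash_continuous; exact: sm.
    by apply: cj; exact: Qy.
  move=> /filter_forall; apply: filterS => z Qz; apply: QN => i j.
  by rewrite (ord1 i); exact: Qz.
- rewrite /of_ -[RHS](h'K x Ux); congr k'; apply/rowP => i.
  by rewrite !mxE squash0 mulr0 addr0.
Qed.

End Discs.

(** * Complements of diagonals *)

Lemma mx_continuous_at (T X : topologicalType) m n (f : T -> 'M[X]_(m, n)) t :
  (forall i j, {for t, continuous (fun t => f t i j)}) -> {for t, continuous f}.
Proof.
move=> fc W [Q Qf QW].
have : \forall s \near t, forall ij : 'I_m * 'I_n, Q ij.1 ij.2 (f s ij.1 ij.2).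
  by apply: filter_forall => ij; apply: fc; exact: Qf.
by apply: filterS => s Qs; apply: QW => i j; exact: (Qs (i, j)).
Qed.

(** * The complement of a diagonal in a box of charts *)

Section LocalBox.
Variables (R : realType) (d : nat) (X : topologicalType) (m : nat).
Local Notation E := 'rV[X]_m.
Variables (p : E) (N : X -> set X) (D : forall y, disc R d y (N y)).
Variable r : 'I_m -> 'I_m.
Hypothesis rK : forall a, r (r a) = r a.
Hypothesis rp : forall a, p ord0 (r a) = p ord0 a.

Definition boxW : set E := [set x | forall a, dset (D (p ord0 a)) (x ord0 a)].
Local Notation W := boxW.

Lemma boxW_open : open W.
Proof.
rewrite openE => x Wx; have : forall a, nbhs x [set y : E | dset (D (p ord0 a)) (y ord0 a)].
  move=> a; apply: (@mx_coord_continuous X 1 m ord0 a x).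
  by apply: open_nbhs_nbhs; split; [exact: d_open | exact: Wx].
by move=> /filter_forall; apply: filterS.
Qed.

Lemma boxW_p : W p.
Proof. by move=> a; exact: d_x. Qed.

Definition lift_coord (x : E) a : 'rV[R]_d := dto (D (p ord0 a)) (x ord0 a).
(** [p] has equal entries at an index and at its representative, so both are read in the same chart;
    the diagonal is the common zero set of these functions in the box. *)
Definition ell (s : 'I_m * 'I_d) (x : E) : R :=
  lift_coord x s.1 ord0 s.2 - lift_coord x (r s.1) ord0 s.2.

Lemma lift_coord_continuous x a : W x -> {for x, continuous (fun x => lift_coord x a)}.
Proof.
move=> Wx; apply: (continuous_comp (@mx_coord_continuous X 1 m ord0 a x)).
by apply: d_to_cts; exact: Wx.
Qed.

Lemma ell_continuous s x : W x -> {for x, continuous (ell s)}.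
Proof.
move=> Wx; have lc a : {for x, continuous (fun x => lift_coord x a ord0 s.2)}.
  exact: (continuous_comp (@lift_coord_continuous x a Wx)
    (@mx_coord_continuous R 1 d ord0 s.2 _)).
exact: cvgB (lc _) (lc _).
Qed.

Definition Aset (S : seq ('I_m * 'I_d)) : set E :=
  [set x | W x /\ exists2 s, s \in S & ell s x != 0].

Definition halfset (sg : R) s : set E := [set x | W x /\ 0 < sg * ell s x].

Lemma open_at (T : topologicalType) (U : set T) : (forall x, U x -> nbhs x U) -> open U.
Proof. by move=> H; rewrite openE => x /H. Qed.

Lemma Aset_open S : open (Aset S).
Proof.
apply: open_at => x [Wx [s sS es]].
have : nbhs x (W `&` (ell s) @^-1` [set y : R | y != 0]).
  apply: filterI; first by apply: open_nbhs_nbhs; split=> //; exact: boxW_open.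
  by apply: (ell_continuous (s := s) Wx); apply: open_nbhs_nbhs; split.
by apply: filterS => y [Wy ey]; split=> //; exists s.
Qed.

Lemma halfset_open sg s : open (halfset sg s).
Proof.
apply: open_at => x [Wx es].
have : nbhs x (W `&` (fun x => sg * ell s x) @^-1` [set y | 0 < y]).
  apply: filterI; first by apply: open_nbhs_nbhs; split=> //; exact: boxW_open.
  have c : {for x, continuous (fun x => sg * ell s x)}.
    exact: cvgM (cvg_cst _) (ell_continuous (s := s) Wx).
  by apply: c; apply: open_nbhs_nbhs; split=> //; exact: open_gt.
by apply: filterS => y [Wy ey].
Qed.

(** At time 1 the function [ell s] has changed by [sg * (1 + |ell s x|)], which gives it the sign
    [sg] whatever it was. When [s.1] is not a representative, no other [ell] refers to the
    coordinate moved and all of them stay fixed. *)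
Definition pushup (sg : R) (s : 'I_m * 'I_d) (x : E) (tau : R) : E :=
  \row_a if a == s.1 then
    dof (D (p ord0 a)) (lift_coord x a + (tau * (sg * (1 + `|ell s x|))) *: delta_mx ord0 s.2)
  else x ord0 a.

Lemma pushup0 sg s x : W x -> pushup sg s x 0 = x.
Proof.
move=> Wx; apply/rowP => a; rewrite mxE; case: eqP => // _.
by rewrite mul0r scale0r addr0; apply: d_toK; exact: Wx.
Qed.

Lemma pushupW sg s x tau : W x -> W (pushup sg s x tau).
Proof. by move=> Wx a; rewrite mxE; case: eqP => // _; exact: d_of. Qed.

Lemma lift_pushup sg s x tau a : lift_coord (pushup sg s x tau) a =
  lift_coord x a + (if a == s.1 then (tau * (sg * (1 + `|ell s x|))) *: delta_mx ord0 s.2 else 0).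
Proof. by rewrite {1}/lift_coord mxE; case: eqP => _; rewrite ?d_ofK ?addr0. Qed.

Lemma ell_pushup sg s x tau s' : r s.1 != s.1 ->
  ell s' (pushup sg s x tau) =
  ell s' x + (if s' == s then tau * (sg * (1 + `|ell s x|)) else 0).
Proof.
move=> rs; have nr : r s'.1 != s.1.
  by apply: contra rs => /eqP h; rewrite -h rK h.
rewrite /ell !lift_pushup (negPf nr) addr0; case: s' nr => a' c' /= nr.
case: s rs nr => a c /= rs nr; rewrite xpair_eqE.
case: eqP => [->|_] /=; last by rewrite !addr0.
rewrite !mxE eqxx /= eq_sym; case: eqP => [->|_]; last by rewrite mulr0 !addr0.
by rewrite mulr1 addrAC.
Qed.

Lemma pushup_cont sg s : hcont (pushup sg s) W.
Proof.
move=> x tau Wx _.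
change {for (x, tau), continuous (fun q : E * R => pushup sg s q.1 q.2)}.
have c1 a : {for (x, tau), continuous (fun q : E * R => lift_coord q.1 a)}.
  apply: (@continuous_comp _ _ _ fst (fun y => lift_coord y a)); first exact: cvg_fst.
  exact: lift_coord_continuous.
have c2 : {for (x, tau), continuous (fun q : E * R => ell s q.1)}.
  apply: (@continuous_comp _ _ _ fst (ell s)); first exact: cvg_fst.
  exact: ell_continuous.
apply: mx_continuous_at => i a; rewrite (ord1 i) {i}.
case: (eqVneq a s.1) => [as1|as1]; last first.
  rewrite (_ : (fun _ => _) = fun q : E * R => q.1 ord0 a); last first.
    by apply/funext => q; rewrite mxE (negPf as1).
  apply: (@continuous_comp _ _ _ fst (fun y : E => y ord0 a)); first exact: cvg_fst.
  exact: mx_coord_continuous.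
rewrite (_ : (fun _ => _) = fun q : E * R => dof (D (p ord0 a)) (lift_coord q.1 a +
    (q.2 * (sg * (1 + `|ell s q.1|))) *: delta_mx ord0 s.2)); last first.
  by apply/funext => q; rewrite mxE as1 eqxx.
apply: (@continuous_comp _ _ _ (fun q : E * R => lift_coord q.1 a +
    (q.2 * (sg * (1 + `|ell s q.1|))) *: delta_mx ord0 s.2) (dof (D (p ord0 a)))); last first.
  exact: d_of_cts.
apply: mx_continuous_at => i c; rewrite (ord1 i) {i}.
rewrite (_ : (fun _ => _) = fun q : E * R => lift_coord q.1 a ord0 c +
    (q.2 * (sg * (1 + `|ell s q.1|))) * (delta_mx ord0 s.2 : 'rV[R]_d) ord0 c); last first.
  by apply/funext => q; rewrite !mxE.
apply: cvgD.
  exact: (continuous_comp (c1 a) (@mx_coord_continuous R 1 d ord0 c _)).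
apply: (cvgM _ (cvg_cst _)); apply: (cvgM cvg_snd); apply: (cvgM (cvg_cst _)).
apply: (cvgD (cvg_cst _)).
exact: (continuous_comp c2 (@norm_continuous R R _)).
Qed.

(** [pushup] preserves the subspace at all times and carries the whole box into it at time 1. *)
Lemma half_acyclic S (sg : R) s : `|sg| = 1 -> r s.1 != s.1 -> s \notin S ->
  forall n (z : chain R rat E n),
  rcyc W (Aset S `|` halfset sg s) z -> rbnd W (Aset S `|` halfset sg s) z.
Proof.
move=> sg1 rs sS n z zc; have [zW zU] := zc.
have sg2 : sg * sg = 1 by rewrite -expr2 -real_normK ?num_real // sg1 expr1n.
have AP x tau : Aset S x -> Aset S (pushup sg s x tau).
  move=> [Wx [s' s'S e']]; split; first exact: pushupW.
  exists s' => //; rewrite ell_pushup //; case: (s' =P s) => [ss'|_]; last by rewrite addr0.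
  by rewrite -ss' s'S in sS.
have eS x tau : sg * ell s (pushup sg s x tau) = sg * ell s x + tau * (1 + `|ell s x|).
  rewrite ell_pushup // eqxx mulrDr; congr (_ + _).
  by rewrite mulrCA [sg * (sg * _)]mulrA sg2 mul1r.
have HP x tau : halfset sg s x -> 0 <= tau -> halfset sg s (pushup sg s x tau).
  move=> [Wx e']; split; first exact: pushupW.
  by rewrite eS ltr_pwDl // mulr_ge0 // addr_ge0.
have HU x a : W x -> (Aset S `|` halfset sg s) x -> 0 <= a <= 1 ->
    (Aset S `|` halfset sg s) (pushup sg s x a).
  by move=> Wx [Ax|Px] /andP[a0 _]; [left; exact: AP | right; exact: HP].
have := homotopy_rbnd (H := pushup sg s) (@pushup_cont sg s)
  (fun x a Wx _ => @pushupW sg s x a Wx) HU zc.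
have -> : push (pushup sg s ^~ 0) z = z.
  rewrite -[RHS]push_id; apply: (push_ext zW) => x Wx; exact: pushup0.
move=> rb; have : rbnd W (Aset S `|` halfset sg s) (push (pushup sg s ^~ 1) z).
  apply: rbnd_in; first by apply: push_supp zW => x; exact: pushupW.
  apply: push_supp zW => x Wx; right; split; first exact: pushupW.
  rewrite eS mul1r addrCA ltr_pwDl // -[`|ell s x|]mul1r -sg1 -normrM.
  rewrite -lerBlDr sub0r.
  by have := lexx `|sg * ell s x|; rewrite {1}ler_norml => /andP[].
move=> /submodB /(_ rb); rewrite subKr; apply; exact: rbnd_submod.
Qed.

Definition contr (x : E) (tau : R) : E :=
  \row_a dof (D (p ord0 a)) (tau *: lift_coord x a).

Lemma contr_cont : hcont contr W.
Proof.
move=> x tau Wx _.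
change {for (x, tau), continuous (fun q : E * R => contr q.1 q.2)}.
have c1 a : {for (x, tau), continuous (fun q : E * R => lift_coord q.1 a)}.
  apply: (@continuous_comp _ _ _ fst (fun y => lift_coord y a)); first exact: cvg_fst.
  exact: lift_coord_continuous.
apply: mx_continuous_at => i a; rewrite (ord1 i) {i}.
rewrite (_ : (fun _ => _) = fun q : E * R => dof (D (p ord0 a)) (q.2 *: lift_coord q.1 a)); last first.
  by apply/funext => q; rewrite mxE.
apply: (@continuous_comp _ _ _ (fun q : E * R => q.2 *: lift_coord q.1 a) (dof (D (p ord0 a)))); last first.
  exact: d_of_cts.
apply: mx_continuous_at => i c; rewrite (ord1 i) {i}.
rewrite (_ : (fun _ => _) = fun q : E * R => q.2 * lift_coord q.1 a ord0 c); last first.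
  by apply/funext => q; rewrite !mxE.
exact: (cvgM cvg_snd (continuous_comp (c1 a) (@mx_coord_continuous R 1 d ord0 c _))).
Qed.

Lemma contr1 x : W x -> contr x 1 = x.
Proof.
move=> Wx; apply/rowP => a; rewrite mxE scale1r.
by apply: d_toK; exact: Wx.
Qed.

Lemma contr0 x : contr x 0 = p.
Proof. by apply/rowP => a; rewrite mxE scale0r d_center. Qed.

Lemma contrW x tau : W (contr x tau).
Proof. by move=> a; rewrite mxE; exact: d_of. Qed.

Lemma push_cst (T T' : topologicalType) (q : T') n (c : chain R rat T n) :
  exists a : rat, push (fun=> q) c = a *: mksing (fun=> q : T').
Proof.
apply: (freegs_ind (P := fun c => exists a : rat, push (fun=> q) c = a *: mksing (fun=> q : T'))
  (@inCT R T n c)).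
  by exists 0; rewrite linear0 scale0r.
move=> a s c' _ [b E']; exists (a + b).
by rewrite linearP scalerDl; congr (_ *: _ + _) => //; exact: pushU.
Qed.

Lemma box_contractible n : fgb false (@rcyc R E W set0 n) (@rbnd R E W set0 n).
Proof.
exists [:: mksing (fun=> p) : chain R rat E n]; split=> // z zc; have [zW zU] := zc.
have [a aE] := push_cst p z; exists (fun=> a).
rewrite /lcomb big_ord1 /= -aE.
have := homotopy_rbnd (H := contr) (A' := W) (U' := set0) contr_cont
  (fun x a _ _ => contrW x a) (fun _ _ _ x0 _ => x0) zc.
have -> : push (contr ^~ 1) z = z.
  by rewrite -[RHS]push_id; apply: (push_ext zW) => x; exact: contr1.
by have -> : contr ^~ 0 = fun=> p by apply/funext => x; exact: contr0.
Qed.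

(** The box modulo the complement of [size S] independent linear equations, which vanishes below
    degree [size S]. Each new equation splits into two half-spaces with acyclic pairs, and
    [pair_unionS] raises the degree by one. With no equation only finite generation is available. *)
Lemma local_box S j : uniq S -> (forall s, s \in S -> r s.1 != s.1) ->
  fgb (j < size S)%N (@rcyc R E W (Aset S) j) (@rbnd R E W (Aset S) j).
Proof.
elim: S j => [|s S IH] j /=.
  move=> _ _; rewrite ltn0.
  have -> : Aset [::] = set0 by apply/seteqP; split=> // x [_ [s]].
  exact: box_contractible.
move=> /andP[sS uS] rS; have rs : r s.1 != s.1 by apply: rS; rewrite inE eqxx.
pose U1 := Aset S `|` halfset 1 s; pose U2 := Aset S `|` halfset (-1) s.
have -> : Aset (s :: S) = U1 `|` U2.
  apply/seteqP; split=> [x [Wx [s']]|x].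
    rewrite inE => /orP[/eqP->|s'S] e; last by left; left; split=> //; exists s'.
    case/orP: (lt_total e) => h; [right|left]; right; split=> //.
      by rewrite mulN1r oppr_gt0.
    by rewrite mul1r.
  case=> -[[Wx [s' s'S e]]|[Wx e]]; split=> //.
  - by exists s' => //; rewrite inE s'S orbT.
  - by exists s; [rewrite inE eqxx | rewrite gt_eqF // -[X in _ < X]mul1r].
  - by exists s' => //; rewrite inE s'S orbT.
  - by exists s; [rewrite inE eqxx | rewrite lt_eqF // -oppr_gt0 -mulN1r].
have U1o : open U1 by apply: openU; [exact: Aset_open | exact: halfset_open].
have U2o : open U2 by apply: openU; [exact: Aset_open | exact: halfset_open].
have U12 : U1 `&` U2 `<=` Aset S.
  move=> x [[//|[_ e1]] [//|[_ e2]]]; exfalso.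
  by move: e1 e2; rewrite mul1r mulN1r oppr_gt0 => h; rewrite ltNge (ltW h).
have A1 : Aset S `<=` U1 by move=> x; left.
have A2 : Aset S `<=` U2 by move=> x; left.
have H1 := @half_acyclic S 1 s (normr1 _) rs sS.
have H2 : forall n (z : chain R rat E n), rcyc W U2 z -> rbnd W U2 z.
  by apply: half_acyclic => //; rewrite normrN normr1.
case: j => [|j]; first by apply: fgb_sub => z; exact: (pair_union0 H1).
rewrite ltnS; apply: (pair_unionS U1o U2o U12 A1 A2 H1 H2).
by apply: IH => // s' s'S; apply: rS; rewrite inE s'S orbT.
Qed.

End LocalBox.

Lemma mx_hausdorff (X : topologicalType) m n :
  hausdorff_space X -> hausdorff_space 'M[X]_(m, n).
Proof.
move=> hX; rewrite open_hausdorff => x y xy.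
have [i [j xyij]] : exists i j, x i j != y i j.
  apply: contrapT => h; move/eqP: xy; apply; apply/matrixP => i j.
  by apply: contrapT => /eqP e; apply: h; exists i, j.
have := hX; rewrite open_hausdorff => /(_ _ _ xyij)[[A B] /= [Ax By] [Ao Bo /eqP AB]].
exists ((fun z : 'M_(m, n) => z i j) @^-1` A, (fun z : 'M_(m, n) => z i j) @^-1` B) => /=.
  by rewrite !inE in Ax By *.
split; [| |apply/eqP/seteqP; split=> // z [Az Bz]].
- by apply: open_comp => // z _; exact: mx_coord_continuous.
- by apply: open_comp => // z _; exact: mx_coord_continuous.
- by have : (A `&` B) (z i j) by []; rewrite AB.
Qed.

Section Diagonals.
Variables (X : topologicalType) (m : nat).
Local Notation E := 'rV[X]_m.
Implicit Type P : {ffun 'I_m -> 'I_m}.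

(* P labels the blocks of a set partition of the indices; diag P is the closed
   set of tuples which are constant on its blocks. *)
Definition diag P : set E := [set x | forall a b, P a = P b -> x ord0 a = x ord0 b].

Definition rep P a := odflt a [pick b | P b == P a].

Lemma repP P a : P (rep P a) = P a.
Proof. by rewrite /rep; case: pickP => [b /eqP|]. Qed.

Lemma rep_eq P a b : P a = P b -> rep P a = rep P b.
Proof.
move=> Pab; rewrite /rep -Pab; case: pickP => //= h.
by have := h a; rewrite eqxx.
Qed.

Lemma repK P a : rep P (rep P a) = rep P a.
Proof. by apply: rep_eq; exact: repP. Qed.

Lemma diagE P x : diag P x <-> forall a, x ord0 (rep P a) = x ord0 a.
Proof.
split=> [dx a|h a b Pab]; first by apply: dx; exact: repP.
by rewrite -h (rep_eq Pab) h.
Qed.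

Definition nonreps P := [seq a <- enum 'I_m | rep P a != a].
(** The number of indices minus the number of blocks, so that [diag P] has codimension
    [rk P * d]. *)
Definition rk P := size (nonreps P).

Lemma diag_closed P : hausdorff_space X -> closed (diag P).
Proof.
move=> hX; rewrite -[diag P]setCK; apply: open_closedC.
rewrite openE => x nx.
have [a [b [Pab xab]]] : exists a b, P a = P b /\ x ord0 a != x ord0 b.
  apply: contrapT => h; apply: nx => a b Pab; apply: contrapT => /eqP e.
  by apply: h; exists a, b.
have := hX; rewrite open_hausdorff => /(_ _ _ xab)[[A B] /= [Ax By] [Ao Bo /eqP AB]].
rewrite !inE in Ax By.
have nA : nbhs x [set y : E | A (y ord0 a)].
  by apply: (@mx_coord_continuous X 1 m ord0 a x); exact: open_nbhs_nbhs.
have nB : nbhs x [set y : E | B (y ord0 b)].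
  by apply: (@mx_coord_continuous X 1 m ord0 b x); exact: open_nbhs_nbhs.
apply: filterS (filterI nA nB) => y [Ay By'] dy.
have : (A `&` B) (y ord0 a) by split=> //; rewrite (dy a b Pab).
by rewrite AB.
Qed.

End Diagonals.

Section PairLocal.
Variables (R : realType) (d : nat) (X : topologicalType) (m : nat).
Local Notation E := 'rV[X]_m.
Hypothesis hX : hausdorff_space X.
Hypothesis eX : forall x : X, euclidean_at R d x.

Lemma discs_exist (N : X -> set X) : (forall y, nbhs y (N y)) ->
  exists D : forall y, disc R d y (N y), True.
Proof.
move=> Ny; have h y : inhabited (disc R d y (N y)) by exact: disc_exists.
by exists (fun y => inhabited_witness (h y)).
Qed.

Lemma box_nbhs (p : E) (O : set E) : nbhs p O ->
  exists2 N : X -> set X, (forall y, nbhs y (N y)) &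
    forall x : E, (forall a, N (p ord0 a) (x ord0 a)) -> O x.
Proof.
move=> [Q Qp QO].
exists (fun y => [set z | forall a, p ord0 a = y -> Q ord0 a z]).
  move=> y; have : forall a, nbhs y [set z | p ord0 a = y -> Q ord0 a z].
    move=> a; have [<-|ne] := pselect (p ord0 a = y).
      by apply: filterS (Qp ord0 a) => z Qz _.
    by apply: filterS filterT => z _ /ne.
  by move=> /filter_forall; apply: filterS => z h a; exact: h.
by move=> x xN; apply: QO => i a; rewrite (ord1 i); exact: xN.
Qed.

(** Away from the diagonal a neighbourhood lies in the complement and the pair is trivial. On it, a
    box of charts meets the complement in the points violating one of [rk P * d] coordinate
    equations, one for each nonrepresentative and coordinate of the chart. *)
Lemma pair_local (P : {ffun 'I_m -> 'I_m}) (p : E) (O : set E) : open O -> O p ->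
  exists W, [/\ open W, W p, W `<=` O &
    forall j, fgb (j < rk P * d)%N (@rcyc R E W (~` diag P) j) (@rbnd R E W (~` diag P) j)].
Proof.
move=> Oo Op; have [dp|ndp] := pselect (diag P p); last first.
  exists (O `&` ~` diag P); split; [|by []| |].
  - by apply: openI => //; exact/closed_openC/diag_closed.
  - by move=> x [].
  - move=> j; apply: fgb_sub => z [zW zU]; apply: rbnd_in => //.
    by apply: inC_sub zW => x [].
have [N Nn NO] := box_nbhs (open_nbhs_nbhs (conj Oo Op)).
have [D _] := discs_exist Nn.
pose W := @boxW R d X m p N D; exists W; split.
- exact: boxW_open.
- exact: boxW_p.
- by move=> x Wx; apply: NO => a; apply: d_sub; exact: Wx.
pose S := [seq (a, c) | a <- nonreps P, c <- enum 'I_d].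
have rp a : p ord0 (rep P a) = p ord0 a by move/diagE: dp.
have S1 s : s \in S -> rep P s.1 != s.1.
  by move=> /allpairsP[[a c] [/= aS _ ->]] /=; move: aS; rewrite mem_filter => /andP[].
have uS : uniq S.
  apply: allpairs_uniq; [exact/filter_uniq/enum_uniq | exact: enum_uniq |].
  by move=> [a c] [a' c'].
have sS : size S = (rk P * d)%N by rewrite size_allpairs size_enum_ord.
have WA : W `&` ~` diag P `<=` Aset p D (rep P) S.
  move=> x [Wx ndx]; split=> //; apply: contrapT => h; apply: ndx; apply/diagE => a.
  have [ra|ra] := eqVneq (rep P a) a; first by rewrite ra.
  have e : lift_coord p D x (rep P a) = lift_coord p D x a.
    apply/rowP => c; apply: contrapT => /eqP ne; apply: h; exists (a, c).
      apply/allpairsP; exists (a, c); split=> //; last exact: mem_enum.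
      by rewrite mem_filter ra mem_enum.
    by rewrite /ell /= subr_eq0 eq_sym.
  rewrite -(d_toK (Wx a)) -[LHS](d_toK (Wx _)); move: e; rewrite /lift_coord rp => <-.
  by [].
have AU : Aset p D (rep P) S `<=` ~` diag P.
  move=> x [Wx [s sS' es]] /diagE dx; move/negP: es; apply; rewrite /ell subr_eq0.
  by rewrite /lift_coord rp dx.
move=> j; rewrite -sS; have := @local_box R d X m p N D (rep P) (repK P) S j uS S1.
apply: fgb_mono => z.
  by move=> [zW zU]; split=> //; apply: inC_sub WA _; apply: inCI => //; exact: inC_bd.
by apply: rbnd_mono.
Qed.

Local Notation VT := (fun n (_ : chain R rat E n) => True).

Lemma E_hausdorff : hausdorff_space E.
Proof. exact: mx_hausdorff. Qed.

Section Theory.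
Variable U : set E.
Hypothesis Uo : open U.
Local Notation N := (fun n (c : chain R rat E n) => inC U c).

Lemma lcyc_rcyc W n (c : chain R rat E n) : @lcyc R E E id VT N W n c <-> rcyc W U c.
Proof. by split=> [[[_ Wc] Nc]|[Wc Nc]]; split. Qed.

Lemma lbnd_rbnd W n (c : chain R rat E n) : @lbnd R E E id VT N W n c <-> rbnd W U c.
Proof.
split=> [[[_ Wc] [e [[_ We] Ue]]]|[Wc [e [We Ue]]]]; split=> //; by exists e.
Qed.

Lemma VT_submod n : submod (VT n).
Proof. by []. Qed.

Lemma theory_split n (W1 W2 : set E) (c : chain R rat E n) :
  open W1 -> open W2 -> VT n c ->
  suppt (fun s : singular R E n => small (id @^-1` W1) (id @^-1` W2) s) c ->
  exists c1 c2, [/\ c = c1 + c2, VT n c1 /\ inC (id @^-1` W1) c1,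
    VT n c2 /\ inC (id @^-1` W2) c2 & N n c -> N n c1 /\ N n c2].
Proof.
move=> _ _ _ cs; pose Q (s : singular R E n) := forall x, W1 (s x).
exists (restr Q c), (c - restr Q c); split; [|split=> //|split=> //|].
- by rewrite addrC subrK.
- by have := supp_restr (P := Q) cs; apply: sub_supp => s [].
- by have := supp_restrC (P := Q) cs; apply: sub_supp => s [[]].
- move=> Nc; split.
    by have := supp_restr (P := Q) Nc; apply: sub_supp => s [].
  by have := supp_restrC (P := Q) Nc; apply: sub_supp => s [].
Qed.

Lemma rel_local_to_global (b : bool) (W : set E) k :
  (forall i (O : set E) p, (i <= k)%N -> open O -> O `<=` W -> O p ->
     exists O', [/\ open O', O' p, O' `<=` O & fgb b (@rcyc R E O' U i) (@rbnd R E O U i)]) ->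
  forall i (K O : set E), (i <= k)%N -> compact K -> K `<=` O -> open O -> O `<=` W ->
  exists O', [/\ open O', K `<=` O', O' `<=` O & fgb b (@rcyc R E O' U i) (@rbnd R E O U i)].
Proof.
move=> loc i K O ik cK KO Oo OW.
have fgE O1 O2 n : fgb b (@rcyc R E O1 U n) (@rbnd R E O2 U n) <->
    fgb b (@lcyc R E E id VT N O1 n) (@lbnd R E E id VT N O2 n).
  by split; apply: fgb_mono => z; rewrite ?lcyc_rcyc ?lbnd_rbnd // => /lcyc_rcyc.
have idc : continuous (id : E -> E) by move=> x; exact: cvg_id.
have [|O' [O'o KO' O'O /fgE fg]] := @local_to_global_all R E E id VT N
  idc VT_submod (fun n => @inC_submod R E U n) (fun _ _ _ => I)
  (fun n c => @inC_bd R E U n c) (fun _ _ _ => I) (fun n c => @inC_sd R E U n c)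
  (fun _ _ _ => I) (fun n c => @inC_hsd R E U n c) theory_split E_hausdorff b W k _ i K O ik cK KO Oo OW.
  move=> i' O' p i'k O'o O'W O'p; have [O'' [? ? ? /fgE fg]] := loc _ _ _ i'k O'o O'W O'p.
  by exists O''.
by exists O'.
Qed.
End Theory.

Lemma pair_fg (P : {ffun 'I_m -> 'I_m}) (b : bool) k : (b -> k < rk P * d)%N ->
  forall (K O : set E), compact K -> K `<=` O -> open O ->
  exists O', [/\ open O', K `<=` O', O' `<=` O &
    fgb b (@rcyc R E O' (~` diag P) k) (@rbnd R E O (~` diag P) k)].
Proof.
move=> bk K O cK KO Oo.
apply: (@rel_local_to_global (~` diag P) b setT k) => // i O1 p ik O1o _ O1p.
have [W [Wo Wp WO1 fg]] := pair_local P O1o O1p; exists W; split=> //.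
have := fg i; case: b bk => bk.
  have -> : (i < rk P * d)%N = true by apply: leq_ltn_trans ik _; exact: bk.
  by apply: fgb_mono => z //; exact: rbnd_mono.
move=> [L [_ HL]]; exists L; split=> // z /HL[a Ha]; exists a.
exact: rbnd_mono Ha.
Qed.

Lemma pair_vanish (P : {ffun 'I_m -> 'I_m}) (O : set E) k (z : chain R rat E k) :
  (k < rk P * d)%N -> open O ->
  rcyc O (~` diag P) z -> rbnd O (~` diag P) z.
Proof.
move=> kP Oo zc; have [zO zU] := zc.
have idc : continuous (id : E -> E) by move=> x; exact: cvg_id.
have [K [cK KO KI]] := inC_compact idc zO.
have [O' [O'o KO' O'O /fgbT]] := @pair_fg P true k (fun _ => kP) K O cK KO Oo.
by apply; split=> //; exact: KI.
Qed.
End PairLocal.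

(** * Chains killed by fixing coordinates *)

Section SetCoordinate.
Variables (R : realType) (X : topologicalType) (m : nat) (x0 : X).
Local Notation E := 'rV[X]_m.

Definition setc (t : 'I_m) (y : X) (x : E) : E :=
  \row_a if a == t then y else x ord0 a.

Lemma setc_continuous t y : continuous (setc t y).
Proof.
apply: mx_continuous => i a; rewrite (ord1 i) {i}.
case: (eqVneq a t) => [at_|at_].
  rewrite (_ : (fun _ => _) = fun=> y); first exact: cst_continuous.
  by apply/funext => x; rewrite mxE at_ eqxx.
rewrite (_ : (fun _ => _) = fun x : E => x ord0 a); first exact: mx_coord_continuous.
by apply/funext => x; rewrite mxE (negPf at_).
Qed.

Definition proj n (t : 'I_m) : chain R rat E n -> chain R rat E n :=
  @push R E E (setc t x0) n.
HB.instance Definition _ n t := GRing.Linear.on (@proj n t).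

Lemma proj_proj n t (c : chain R rat E n) : proj t (proj t c) = proj t c.
Proof.
rewrite /proj push_comp; last exact/cts_push/setc_continuous.
congr (push _ c); apply/funext => x; apply/rowP => a; rewrite !mxE.
by case: eqP.
Qed.

Lemma projC n s t (c : chain R rat E n) : proj t (proj s c) = proj s (proj t c).
Proof.
rewrite /proj !push_comp; try exact/cts_push/setc_continuous.
congr (push _ c); apply/funext => x; apply/rowP => a; rewrite !mxE.
by case: eqP; case: eqP.
Qed.

Lemma proj_bd n t (c : chain R rat E n) : boundary (proj t c) = proj t (boundary c).
Proof. exact/push_boundary/setc_continuous. Qed.

(** The maps [proj t] are commuting idempotents; this product of their complements projects onto the
    chains killed by all of them. *)
Fixpoint reduce n (T : seq 'I_m) (c : chain R rat E n) : chain R rat E n :=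
  if T is t :: T' then reduce T' c - proj t (reduce T' c) else c.

Lemma reduceB n T (c c' : chain R rat E n) :
  reduce T (c - c') = reduce T c - reduce T c'.
Proof.
elim: T => //= t T ->; rewrite linearB /= opprD addrACA; congr (_ + _).
by rewrite opprD.
Qed.

Lemma reduceD n T (c c' : chain R rat E n) :
  reduce T (c + c') = reduce T c + reduce T c'.
Proof. by elim: T => //= t T ->; rewrite linearD /= opprD addrACA. Qed.

Lemma reduce_bd n T (c : chain R rat E n) : boundary (reduce T c) = reduce T (boundary c).
Proof. by elim: T => //= t T IH; rewrite boundaryB IH proj_bd IH. Qed.

Lemma proj_reduce n T t (c : chain R rat E n) : t \in T -> proj t (reduce T c) = 0.
Proof.
elim: T => //= s T IH; rewrite inE => /orP[/eqP ->|/IH h]; rewrite linearB /=.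
  by rewrite proj_proj subrr.
by rewrite projC h linear0 subrr.
Qed.

Lemma reduce_id n T (c : chain R rat E n) :
  (forall t, t \in T -> proj t c = 0) -> reduce T c = c.
Proof.
elim: T => //= t T IH H; rewrite IH; last by move=> s sT; apply: H; rewrite inE sT orbT.
by rewrite H ?inE ?eqxx // subr0.
Qed.

Lemma reduce_inC n T (A : set E) (c : chain R rat E n) :
  (forall t x, t \in T -> A x -> A (setc t x0 x)) -> inC A c -> inC A (reduce T c).
Proof.
elim: T => //= t T IH H Ac; apply: suppB.
  by apply: IH => // s x sT; apply: H; rewrite inE sT orbT.
apply: push_inC (IH _ Ac) => [x|s x sT]; apply: H; first by rewrite inE eqxx.
by rewrite inE sT orbT.
Qed.

End SetCoordinate.

Section Reduced.
Variables (R : realType) (d : nat) (X : topologicalType) (m : nat) (x0 : X).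
Local Notation E := 'rV[X]_m.
Hypothesis hX : hausdorff_space X.
Hypothesis eX : forall x : X, euclidean_at R d x.
Hypothesis cX : connected [set: X].
Variable P : {ffun 'I_m -> 'I_m}.
Local Notation U := (~` diag (X := X) P).

Definition single t := forall a, P a = P t -> a = t.

Lemma diag_setc t y (x : E) : single t -> diag P (setc t y x) -> diag P x.
Proof.
move=> st dx a b Pab; have [->//|ab] := eqVneq a b.
have [at_|at_] := eqVneq a t; first by move: ab; rewrite at_ -(st b) ?eqxx // -Pab at_.
have [bt|bt] := eqVneq b t; first by move: ab; rewrite bt -(st a) ?eqxx // Pab bt.
by have := dx a b Pab; rewrite !mxE (negPf at_) (negPf bt).
Qed.

Lemma setcU t y (x : E) : single t -> U x -> U (setc t y x).
Proof. by move=> st nx /(diag_setc st). Qed.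

(** * One more degree from a singleton block *)

Section Step.
Variables (T : seq 'I_m) (t : 'I_m) (O : set E) (j : nat).
Hypothesis tT : t \notin T.
Hypothesis sT : forall s, s \in t :: T -> single s.
Hypothesis Oo : open O.
Hypothesis Osat : forall s x y, s \in t :: T -> O x -> O (setc s y x).
Hypothesis IH : forall (O : set E) i (z : chain R rat E i), open O ->
  (forall s x y, s \in T -> O x -> O (setc s y x)) -> (i < j)%N ->
  rcyc O U z -> (forall s, s \in T -> proj x0 s z = 0) -> rbnd O U z.

Let coord (x : E) : X := x ord0 t.
Let V n (c : chain R rat E n) := inC O c /\ forall s, s \in T -> proj x0 s c = 0.
Let N n (c : chain R rat E n) := inC U c.

Lemma coord_setc s y x : s \in T -> coord (setc s y x) = coord x.
Proof.
by move=> sT'; rewrite /coord mxE; case: eqP => // ts; move: tT; rewrite ts sT'.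
Qed.

Lemma step_V_submod n : submod (@V n).
Proof.
split=> [|c x y [Ox Vx] [Oy Vy]]; first by split=> [|s _]; [exact: supp0 | rewrite linear0].
split; first by apply: suppD => //; exact: suppZ.
by move=> s sT'; rewrite linearP /= Vx // Vy // scaler0 addr0.
Qed.

Lemma step_reduce_V n (c : chain R rat E n) : inC O c -> V (reduce x0 T c).
Proof.
move=> Oc; split; last by move=> s; exact: proj_reduce.
by apply: reduce_inC => // s x sT'; apply: Osat; rewrite inE sT' orbT.
Qed.

Lemma step_split n (W1 W2 : set X) (c : chain R rat E n) :
  open W1 -> open W2 -> V c ->
  suppt (fun s : singular R E n => small (coord @^-1` W1) (coord @^-1` W2) s) c ->
  exists c1 c2, [/\ c = c1 + c2, V c1 /\ inC (coord @^-1` W1) c1,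
    V c2 /\ inC (coord @^-1` W2) c2 & N c -> N c1 /\ N c2].
Proof.
move=> _ _ [Oc Vc] cs; pose Q (s : singular R E n) := forall x, (coord @^-1` W1) (s x).
have coordW (W : set X) s x : s \in T -> (coord @^-1` W) x -> (coord @^-1` W) (setc s x0 x).
  by move=> sT'; rewrite /preimage /= coord_setc.
have sU s x : s \in T -> U x -> U (setc s x0 x).
  by move=> sT'; apply: setcU; apply: sT; rewrite inE sT' orbT.
have i1 : inC (coord @^-1` W1) (restr Q c).
  by have := supp_restr (P := Q) cs; apply: sub_supp => s [].
have i2 : inC (coord @^-1` W2) (c - restr Q c).
  by have := supp_restrC (P := Q) cs; apply: sub_supp => s [[]].
have o1 : inC O (restr Q c) by have := supp_restr (P := Q) Oc; apply: sub_supp => s [].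
have o2 : inC O (c - restr Q c) by have := supp_restrC (P := Q) Oc; apply: sub_supp => s [].
exists (reduce x0 T (restr Q c)), (reduce x0 T (c - restr Q c)); split.
- by rewrite -reduceD addrC subrK reduce_id.
- by split; [exact: step_reduce_V | apply: reduce_inC i1; exact: coordW].
- by split; [exact: step_reduce_V | apply: reduce_inC i2; exact: coordW].
- move=> Nc; split; apply: reduce_inC; try exact: sU.
    by have := supp_restr (P := Q) Nc; apply: sub_supp => s [].
  by have := supp_restrC (P := Q) Nc; apply: sub_supp => s [].
Qed.

(** Restricting coordinate [t] to [W] leaves a region that is still saturated in the directions of
    [T], so [IH] applies to it. Reducing the bounding chain makes it a chain of type [V] without
    moving coordinate [t]. *)
Lemma step_low i (W : set X) (z : chain R rat E i) : (i < j)%N -> open W ->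
  lcyc coord V N W z -> lbnd coord V N W z.
Proof.
move=> ij Wo [[[Oz Vz] Wz] Uz]; split; first by split.
have Ao : open (O `&` coord @^-1` W).
  apply: openI => //; apply: open_comp => // x _; exact: mx_coord_continuous.
have Asat s x y : s \in T -> (O `&` coord @^-1` W) x -> (O `&` coord @^-1` W) (setc s y x).
  move=> sT' [Ox Wx]; split; first by apply: Osat => //; rewrite inE sT' orbT.
  by rewrite /preimage /= coord_setc.
have sU s x : s \in T -> U x -> U (setc s x0 x).
  by move=> sT'; apply: setcU; apply: sT; rewrite inE sT' orbT.
have [] := @IH (O `&` coord @^-1` W) i z Ao Asat ij _ Vz.
  by split=> //; exact: inCI.
move=> _ [e [Ae Ue]]; exists (reduce x0 T e); split.
  have Ae' : inC (O `&` coord @^-1` W) (reduce x0 T e).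
    by apply: reduce_inC Ae => s x sT'; exact: Asat.
  split; last by apply: inC_sub Ae' => x [].
  by apply: step_reduce_V; apply: inC_sub Ae => x [].
have -> : z - boundary (reduce x0 T e) = reduce x0 T (z - boundary e).
  by rewrite reduceB reduce_bd (reduce_id Vz).
by apply: reduce_inC Ue => s x sT'; exact: sU.
Qed.

(** Inside one disc the value inserted at [t] can be moved along a ray of the chart; connectedness
    of [X] joins arbitrary values. The complement of the diagonal is respected because [t] is a
    block of its own. *)
Lemma step_setc (p q : X) n (z : chain R rat E n) : rcyc O U z ->
  rbnd O U (push (setc t p) z - push (setc t q) z).
Proof.
have st : single t by apply: sT; rewrite inE eqxx.
have Ot x y' : O x -> O (setc t y' x) by apply: Osat; rewrite inE eqxx.
move=> zc; apply: (@connected_rel X (fun p q =>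
  rbnd O U (push (setc t p) z - push (setc t q) z))) => //.
- by move=> y; rewrite subrr; have [] := @rbnd_submod R E O U n.
- by move=> y y' h; rewrite -opprB; apply: submodN => //; exact: rbnd_submod.
- move=> y y' y'' h h'; rewrite -(subrKA (push (setc t y') z)).
  by apply: submodD => //; exact: rbnd_submod.
move=> y; have [D] := @disc_exists R d X y setT (eX y) filterT.
apply: (@filterS _ _ _ (dset D)); last first.
  by apply: open_nbhs_nbhs; split; [exact: d_open | exact: d_x].
move=> y' Dy'; pose H (x : E) (tau : R) := setc t (dof D (tau *: dto D y')) x.
have Hc : hcont H O.
  move=> x tau _ _.
  change {for (x, tau), continuous (fun q : E * R => H q.1 q.2)}.
  apply: mx_continuous_at => i a; rewrite (ord1 i) {i}.
  case: (eqVneq a t) => [at_|at_].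
    rewrite (_ : (fun _ => _) = fun q : E * R => dof D (q.2 *: dto D y')); last first.
      by apply/funext => w; rewrite mxE at_ eqxx.
    apply: (@continuous_comp _ _ _ (fun q : E * R => q.2 *: dto D y') (dof D)).
      exact: (cvgZ cvg_snd (cvg_cst _)).
    exact: d_of_cts.
  rewrite (_ : (fun _ => _) = fun q : E * R => q.1 ord0 a); last first.
    by apply/funext => w; rewrite mxE (negPf at_).
  apply: (@continuous_comp _ _ _ fst (fun x : E => x ord0 a)); first exact: cvg_fst.
  exact: mx_coord_continuous.
have := homotopy_rbnd (H := H) (A' := O) (U' := U) Hc (fun x a Ox _ => @Ot x _ Ox)
  (fun x a _ Ux _ => @setcU t _ _ st Ux) zc.
have -> : H ^~ 1 = setc t y' by apply/funext => x; rewrite /H scale1r d_toK.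
have -> : H ^~ 0 = setc t y by apply/funext => x; rewrite /H scale0r d_center.
by move=> h; rewrite -opprB; apply: submodN => //; exact: rbnd_submod.
Qed.

Lemma step_local (y : X) (D : disc R d y setT) n (z : chain R rat E n) :
  rcyc (O `&` coord @^-1` dset D) U z -> rbnd O U (z - push (setc t y) z).
Proof.
move=> zc; have st : single t by apply: sT; rewrite inE eqxx.
have Ot x y' : O x -> O (setc t y' x) by apply: Osat; rewrite inE eqxx.
pose H (x : E) (tau : R) := setc t (dof D (tau *: dto D (coord x))) x.
have Hc : hcont H (O `&` coord @^-1` dset D).
  move=> x tau [_ Dx] _.
  change {for (x, tau), continuous (fun q : E * R => H q.1 q.2)}.
  apply: mx_continuous_at => i a; rewrite (ord1 i) {i}.
  case: (eqVneq a t) => [at_|at_].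
    rewrite (_ : (fun _ => _) = fun q : E * R => dof D (q.2 *: dto D (coord q.1))); last first.
      by apply/funext => w; rewrite mxE at_ eqxx.
    apply: (@continuous_comp _ _ _ (fun q : E * R => q.2 *: dto D (coord q.1)) (dof D)).
      apply: (cvgZ cvg_snd).
      apply: (@continuous_comp _ _ _ (fun q : E * R => coord q.1) (dto D)); last exact: d_to_cts.
      apply: (@continuous_comp _ _ _ fst coord); first exact: cvg_fst.
      exact: mx_coord_continuous.
    exact: d_of_cts.
  rewrite (_ : (fun _ => _) = fun q : E * R => q.1 ord0 a); last first.
    by apply/funext => w; rewrite mxE (negPf at_).
  apply: (@continuous_comp _ _ _ fst (fun x : E => x ord0 a)); first exact: cvg_fst.
  exact: mx_coord_continuous.
have [zA zU] := zc.
have := homotopy_rbnd (H := H) (A' := O) (U' := U) Hc (fun x a Ax _ => @Ot x _ Ax.1)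
  (fun x a _ Ux _ => @setcU t _ _ st Ux) zc.
have -> : push (H ^~ 1) z = z.
  rewrite -[RHS]push_id; apply: (push_ext zA) => x [_ Dx].
  rewrite /H scale1r d_toK //; apply/rowP => a; rewrite mxE; case: eqP => // ->.
  by [].
by have -> : H ^~ 0 = setc t y by apply/funext => x; rewrite /H scale0r d_center.
Qed.

(** The local-to-global principle is run over [X] through coordinate [t]: lower degrees vanish by
    [step_low], so in degree [j] the local homotopy between a chain and its projection globalises. A
    chain killed by [proj x0 t] is thus homologous to zero. *)
Lemma step_top (z : chain R rat E j) : rcyc O U z ->
  (forall s, s \in t :: T -> proj x0 s z = 0) -> rbnd O U z.
Proof.
move=> zc Vz; have [Oz Uz] := zc.
(* The property to be globalised: being homologous to the projection along [t]. All boundaries have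
   it, which is what [local_to_global] asks. *)
pose Bh (z : chain R rat E j) := rbnd O U (z - proj x0 t z).
have st : single t by apply: sT; rewrite inE eqxx.
have cc : continuous coord by exact: mx_coord_continuous.
have sU s x : s \in T -> U x -> U (setc s x0 x).
  by move=> sT'; apply: setcU; apply: sT; rewrite inE sT' orbT.
have V_bd n (c : chain R rat E n) : V c -> V (boundary c).
  move=> [Oc Vc]; split; first exact: inC_bd.
  by move=> s sT'; rewrite -proj_bd Vc // linear0.
have V_sd n (c : chain R rat E n) : V c -> V (sd c).
  move=> [Oc Vc]; split; first exact: inC_sd.
  move=> s sT'; rewrite /proj push_sd; last exact: setc_continuous.
  by rewrite [push _ c]Vc // linear0.
have V_hsd n (c : chain R rat E n) : V c -> V (hsd c).
  move=> [Oc Vc]; split; first exact: inC_hsd.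
  move=> s sT'; rewrite /proj push_hsd; last exact: setc_continuous.
  by rewrite [push _ c]Vc // linear0.
have sB : submod Bh.
  have [r0 rP] := @rbnd_submod R E O U j.
  split; first by rewrite /Bh linear0 subr0.
  move=> a x y Bx By; rewrite /Bh linearP /= opprD addrACA -scalerBr.
  exact: rP.
have Bb c : lbnd coord V N setT c -> Bh c.
  move=> [[[Oc _] _] [e [[[Oe _] _] Ue]]].
  have rc : rbnd O U c by split=> //; exists e.
  apply: submodB => //; first exact: rbnd_submod.
  apply: push_rbnd rc => [|x Ox|x Ux].
  - exact: setc_continuous.
  - by apply: Osat => //; rewrite inE eqxx.
  - exact: setcU.
have [K [cK _ KI]] := inC_compact cc (@inCT R E j z : inC (coord @^-1` setT) z).
have [|||O' [_ KO' _ /fgbT fg]] := @local_to_global R E X coord V N cc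
  step_V_submod (fun n => @inC_submod R E U n) V_bd
  (fun n c => @inC_bd R E U n c) V_sd (fun n c => @inC_sd R E U n c)
  V_hsd (fun n c => @inC_hsd R E U n c) step_split hX true setT j Bh openT sB Bb _ _ K cK.
- move=> i ji K' O' cK' K'O' O'o _; exists O'; split=> //.
  by apply: fgb_sub => c; apply: step_low => //; rewrite ji.
- move=> p _; have [D] := @disc_exists R d X p setT (eX p) filterT.
  exists (dset D); split=> //; [exact: d_open | exact: d_x | ].
  apply: fgb_sub => c [[[Oc Vc] Dc] Nc].
  have cc' : rcyc O U c by split.
  rewrite /Bh -(subrKA (push (setc t p) c)); apply: submodD.
  + exact: rbnd_submod.
  + by apply: (@step_local p D); split=> //; exact: inCI.
  + exact: step_setc.
- by [].
have := fg z; rewrite /Bh Vz ?inE ?eqxx // subr0; apply.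
split=> //; split; last exact: KI.
by split=> // s sT'; apply: Vz; rewrite inE sT' orbT.
Qed.
End Step.

(** The base is the vanishing below the codimension of the diagonal; each further singleton in [T]
    adds the one critical degree handled by [step_top]. *)
Lemma reduced_vanish (T : seq 'I_m) : uniq T -> (forall s, s \in T -> single s) ->
  forall (O : set E) j (z : chain R rat E j), open O ->
  (forall s x y, s \in T -> O x -> O (setc s y x)) -> (j < rk P * d + size T)%N ->
  rcyc O U z -> (forall s, s \in T -> proj x0 s z = 0) -> rbnd O U z.
Proof.
elim: T => [|t T IH] /= uT sT O j z Oo Osat jT zc Vz.
  by apply: (pair_vanish hX eX) => //; rewrite addn0 in jT.
have /andP[tT uT'] := uT.
have IH' := IH uT' (fun s h => sT s (mem_behead (s := t :: T) h)).
move: jT; rewrite addnS ltnS leq_eqVlt => /orP[/eqP jE|jT]; last first.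
  apply: IH' => // [s x y h|s h]; first by apply: Osat; rewrite inE h orbT.
  by apply: Vz; rewrite inE h orbT.
apply: (step_top tT sT Oo Osat _ zc Vz) => O' i c O'o O'sat ij cc Vc.
by apply: IH' => //; rewrite -jE.
Qed.

End Reduced.

(** * Set partitions, their joins and ranks *)

Section Partitions.
Variables (X : topologicalType) (m : nat).
Local Notation E := 'rV[X]_m.
Implicit Types P Q : {ffun 'I_m -> 'I_m}.

Definition coarser P Q := [forall a, forall b, (P a == P b) ==> (Q a == Q b)].

Lemma coarserP P Q : reflect (forall a b, P a = P b -> Q a = Q b) (coarser P Q).
Proof.
apply: (iffP forallP) => [h a b /eqP Pab|h a].
  by apply/eqP; move/forallP: (h a) => /(_ b); rewrite Pab.
by apply/forallP => b; apply/implyP => /eqP /h ->.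
Qed.

Lemma coarser_diag P Q : coarser P Q -> diag (X := X) Q `<=` diag P.
Proof. by move=> /coarserP h x dx a b /h; exact: dx. Qed.

Definition joinrel P Q := connect (fun a b : 'I_m => (P a == P b) || (Q a == Q b)).

Lemma joinrel_sym P Q a b : joinrel P Q a b = joinrel P Q b a.
Proof.
apply: sym_connect_sym => c e /=; rewrite [P c == _]eq_sym [Q c == _]eq_sym.
by [].
Qed.

Definition join P Q : {ffun 'I_m -> 'I_m} :=
  [ffun a => odflt a [pick b | joinrel P Q a b]].

Lemma join_rel P Q a : joinrel P Q a (join P Q a).
Proof. by rewrite ffunE; case: pickP => [//|/(_ a)]; rewrite [joinrel _ _ _ _]connect0. Qed.

Lemma join_eq P Q a b : (join P Q a == join P Q b) = joinrel P Q a b.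
Proof.
apply/eqP/idP => [h|ab].
  apply: connect_trans (join_rel P Q a) _; rewrite h -/(joinrel P Q _ _) joinrel_sym.
  exact: join_rel.
rewrite !ffunE; have -> : [pick c | joinrel P Q a c] = [pick c | joinrel P Q b c].
  apply: eq_pick => c; apply/idP/idP; last exact: connect_trans.
  by apply: connect_trans; rewrite -/(joinrel P Q _ _) joinrel_sym.
case: pickP => //= h; have := h b; by rewrite [joinrel _ _ _ _]connect0.
Qed.

Lemma coarser_joinl P Q : coarser P (join P Q).
Proof.
by apply/coarserP => a b h; apply/eqP; rewrite join_eq; apply: connect1; rewrite h eqxx.
Qed.

Lemma coarser_joinr P Q : coarser Q (join P Q).
Proof.
by apply/coarserP => a b h; apply/eqP; rewrite join_eq; apply: connect1; rewrite h eqxx orbT.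
Qed.

Lemma diag_join P Q : diag (X := X) (join P Q) = diag P `&` diag Q.
Proof.
apply/seteqP; split=> x.
  by move=> dx; split; [exact: coarser_diag (coarser_joinl P Q) _ dx | exact: coarser_diag (coarser_joinr P Q) _ dx].
move=> [dP dQ] a b /eqP; rewrite join_eq => /connectP[p pp ->].
elim: p a pp => //= c p IH a /andP[/orP[/eqP h|/eqP h] pp]; rewrite -(IH c pp).
  exact: dP.
exact: dQ.
Qed.

Definition reps P : {set 'I_m} := finset (fun a => rep P a == a).

Lemma rk_card P : rk P = #|~: reps P|.
Proof.
rewrite /rk size_filter -sum1_count big_enum_cond -sum1_card; apply: eq_bigl => a.
by rewrite !inE.
Qed.

Lemma rk_reps P : (rk P + #|reps P|)%N = m.
Proof. by rewrite rk_card addnC cardsC card_ord. Qed.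

(* rep P maps the representatives of a coarser partition Q injectively. *)
Lemma rk_coarser P Q : coarser P Q -> (rk P <= rk Q)%N /\ (rk P = rk Q -> coarser Q P).
Proof.
move=> /coarserP PQ.
have inj : {in reps Q &, injective (rep P)}.
  move=> a b; rewrite !inE => /eqP ra /eqP rb h.
  by rewrite -ra -rb; apply: rep_eq; apply: PQ; rewrite -(repP P a) h repP.
have sub : rep P @: reps Q \subset reps P.
  by apply/fintype.subsetP => _ /imsetP[a _ ->]; rewrite inE repK.
have le : (#|reps Q| <= #|reps P|)%N by rewrite -(card_in_imset inj) subset_leq_card.
have hP := rk_reps P; have hQ := rk_reps Q.
split; first by lia.
move=> PQe; have eqc : #|rep P @: reps Q| = #|reps P|.
  by rewrite (card_in_imset inj); lia.
have eqs : rep P @: reps Q = reps P by apply/eqP; rewrite eqEcard sub eqc leqnn.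
apply/coarserP => a b Qab.
have [a' a'Q ra] : exists2 a', a' \in reps Q & rep P a = rep P a'.
  have : rep P a \in reps P by rewrite inE repK.
  by rewrite -eqs => /imsetP[a' ? ?]; exists a'.
have [b' b'Q rb] : exists2 b', b' \in reps Q & rep P b = rep P b'.
  have : rep P b \in reps P by rewrite inE repK.
  by rewrite -eqs => /imsetP[b' ? ?]; exists b'.
have Pa : P a = P a' by rewrite -(repP P a) ra repP.
have Pb : P b = P b' by rewrite -(repP P b) rb repP.
rewrite Pa Pb; congr (P _); move: a'Q b'Q; rewrite !inE => /eqP <- /eqP <-.
by apply: rep_eq; rewrite -(PQ _ _ Pa) -(PQ _ _ Pb).
Qed.

Definition singles P := [seq t <- enum 'I_m | [forall a, (P a == P t) ==> (a == t)]].

Lemma singlesP P t : t \in singles P -> single P t.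
Proof.
rewrite mem_filter => /andP[/forallP h _] a Pat; apply/eqP.
by have := h a; rewrite Pat eqxx.
Qed.

(** A block with at least two elements contains a nonrepresentative, so the number of blocks is at
    most that of the singletons plus the rank; rank and number of blocks add up to [m]. *)
Lemma singles_bound P : (m <= (rk P + size (singles P)).*2)%N.
Proof.
pose sg : {set 'I_m} := finset (fun t => [forall a, (P a == P t) ==> (a == t)]).
have sgE : size (singles P) = #|sg|.
  rewrite size_filter -sum1_count big_enum_cond -sum1_card; apply: eq_bigl => a.
  by rewrite !inE.
have sub : reps P :\: sg \subset rep P @: (~: reps P).
  apply/fintype.subsetP => a; rewrite !inE => /andP[/forallPn[b]].
  rewrite negb_imply => /andP[/eqP Pba ba] /eqP ra; apply/imsetP; exists b.
    by rewrite !inE (rep_eq Pba) ra eq_sym.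
  by rewrite (rep_eq Pba) ra.
have h1 : (#|reps P :\: sg| <= rk P)%N.
  by rewrite rk_card (leq_trans (subset_leq_card sub)) // leq_imset_card.
have h2 : (#|reps P| <= #|sg| + #|reps P :\: sg|)%N.
  rewrite -(cardsID sg (reps P)) leq_add2r subset_leq_card //.
  exact: subsetIr.
have := rk_reps P; rewrite -sgE in h2; lia.
Qed.

End Partitions.

(** * Pushing points to infinity *)

Lemma compact_rV (X : topologicalType) m (K : set X) : compact K ->
  compact [set x : 'rV[X]_m | forall a, K (x ord0 a)].
Proof.
move=> cK; have [[x0]|nX] := pselect (inhabited X).
  pose Xp : ptopologicalType := HB.pack X (isPointed.Build X x0).
  exact: (@rV_compact Xp m (fun=> K) (fun=> cK)).
(* With [X] empty, the space of tuples is empty for positive [m] and a single point for [m = 0]. *)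
have [m0|m0] := posnP m; last first.
  have -> : [set x : 'rV[X]_m | forall a, K (x ord0 a)] = set0.
    apply/seteqP; split=> // x _; apply: nX; constructor.
    exact: (x ord0 (Ordinal m0)).
  exact: compact0.
move=> F PF _; have [x0 _] := @filter_ex _ F PF _ filterT.
have eq_x (y : 'rV[X]_m) : y = x0.
  by apply/rowP => a; have := ltn_ord a; rewrite {2}m0.
exists x0; split; first by move=> a; have := ltn_ord a; rewrite {2}m0.
move=> A B FA xB; have [y Ay] := @filter_ex _ F PF _ FA.
by exists y; split=> //; rewrite (eq_x y); exact: nbhs_singleton.
Qed.

Section Isotopy.
Variables (R : realType) (d : nat) (X : topologicalType) (m : nat).
Local Notation E := 'rV[X]_m.
Variables (e : X -> R -> X) (K : set X) (pt : X).
Hypothesis e_cts : continuous (fun q : X * R => e q.1 q.2).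
Hypothesis e0 : forall x, e x 0 = x.
Hypothesis e_inj : forall t, 0 <= t <= 1 -> injective (e^~ t).
Hypothesis cK : compact K.
Hypothesis eK : forall x, K (e x 1).
Hypothesis e_pt : forall x, e x 1 <> pt.
Implicit Types (P Q : {ffun 'I_m -> 'I_m}) (A : seq {ffun 'I_m -> 'I_m}).

Definition arr A : set E := [set x | forall P, P \in A -> ~ diag P x].

Lemma arr1 P : arr [:: P] = ~` diag P.
Proof.
apply/seteqP; split=> x h; first by apply: h; rewrite inE.
by move=> Q; rewrite inE => /eqP ->.
Qed.

Lemma arr_cons P A : arr (P :: A) = arr [:: P] `&` arr A.
Proof.
apply/seteqP; split=> x.
  move=> h; split=> Q; last by move=> QA; apply: h; rewrite inE QA orbT.
  by rewrite inE => /eqP ->; apply: h; rewrite inE eqxx.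
move=> [h h'] Q; rewrite inE => /orP[/eqP->|]; last exact: h'.
by apply: h; rewrite inE.
Qed.

Lemma arr_join P A : arr [:: P] `|` arr A = arr [seq join P Q | Q <- A].
Proof.
apply/seteqP; split=> x.
  rewrite arr1 => -[nP|h] Q /mapP[Q' Q'A ->]; rewrite diag_join => -[dP dQ].
    exact: nP.
  exact: h Q' Q'A dQ.
move=> h; have [dP|nP] := pselect (diag P x); last by left; rewrite arr1.
right=> Q QA dQ; apply: (h (join P Q)); first exact: map_f.
by rewrite diag_join.
Qed.

Lemma arr_open A : hausdorff_space X -> open (arr A).
Proof.
move=> hX; elim: A => [|P A IH].
  have -> : arr [::] = setT by apply/seteqP.
  exact: openT.
rewrite arr_cons; apply: openI => //; rewrite arr1.
exact/closed_openC/diag_closed.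
Qed.

Definition addpt (s : 'I_m) (x : E) : E :=
  \row_a if a == s then pt else e (x ord0 a) 1.

Lemma e1_continuous : continuous (e^~ 1).
Proof.
move=> x; apply: (@continuous_comp _ _ _ (fun x => (x, 1 : R)) (fun q : X * R => e q.1 q.2)).
  exact: cvg_pair cvg_id (cvg_cst _).
exact: e_cts.
Qed.

Lemma addpt_continuous s : continuous (addpt s).
Proof.
apply: mx_continuous => i a; rewrite (ord1 i) {i}.
case: (eqVneq a s) => [as_|as_].
  rewrite (_ : (fun _ => _) = fun=> pt); first exact: cst_continuous.
  by apply/funext => x; rewrite mxE as_ eqxx.
rewrite (_ : (fun _ => _) = fun x : E => e (x ord0 a) 1); last first.
  by apply/funext => x; rewrite mxE (negPf as_).
move=> x; apply: (@continuous_comp _ _ _ (fun x : E => x ord0 a) (e^~ 1)).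
  exact: mx_coord_continuous.
exact: e1_continuous.
Qed.

Lemma diag_addpt P s x : diag P (addpt s x) -> diag P x.
Proof.
move=> dx a b Pab; have := dx a b Pab; rewrite !mxE.
case: eqP => [as_|_]; case: eqP => [bs|_].
- by rewrite as_ bs.
- by move=> h; case: (@e_pt (x ord0 b)).
- by move=> h; case: (@e_pt (x ord0 a)).
- by apply: e_inj; rewrite lexx ler01.
Qed.

Lemma arr_addpt A s x : arr A x -> arr A (addpt s x).
Proof. by move=> h P PA /diag_addpt; exact: h. Qed.

(** The maps [addpt s] do not commute on points, hence an ordered list; entries may repeat, because
    products found for different groups are concatenated. *)
Fixpoint omega n (l : seq 'I_m) (z : chain R rat E n) : chain R rat E n :=
  if l is s :: l' then omega l' z - push (addpt s) (omega l' z) else z.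

Lemma omega_cat n l l' (z : chain R rat E n) : omega (l ++ l') z = omega l (omega l' z).
Proof. by elim: l => //= s l ->. Qed.

Lemma omegaB n l (z z' : chain R rat E n) : omega l (z - z') = omega l z - omega l z'.
Proof. by elim: l => //= s l ->; rewrite linearB /= opprD addrACA -opprD. Qed.

Lemma omega_bd n l (z : chain R rat E n) : boundary (omega l z) = omega l (boundary z).
Proof.
elim: l => //= s l IH; rewrite boundaryB IH push_boundary ?IH //.
exact: addpt_continuous.
Qed.

Lemma omega_inC n l A (z : chain R rat E n) : inC (arr A) z -> inC (arr A) (omega l z).
Proof.
move=> Az; elim: l => //= s l IH; apply: suppB => //.
by apply: push_inC IH => x; exact: arr_addpt.
Qed.

Lemma omega_rcyc n l A (z : chain R rat E n) : rcyc setT (arr A) z ->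
  rcyc setT (arr A) (omega l z).
Proof. by move=> [_ Uz]; split; [exact: inCT | rewrite omega_bd; exact: omega_inC]. Qed.

Lemma omega_rbnd n l A (z : chain R rat E n) : rbnd setT (arr A) z ->
  rbnd setT (arr A) (omega l z).
Proof.
move=> [_ [f [_ Uf]]]; split; first exact: inCT.
exists (omega l f); split; first exact: inCT.
by rewrite omega_bd -omegaB; exact: omega_inC.
Qed.

Lemma omega_conn n l A B (y : chain R rat E n.+1) z : conn (arr A) (arr B) y z ->
  conn (arr A) (arr B) (omega l y) (omega l z).
Proof.
move=> [f [g [-> Uf Ug]]]; exists (omega l f), (omega l g); split.
- by rewrite omegaB.
- by rewrite omega_bd -omegaB; exact: omega_inC.
- by rewrite omega_bd -omegaB; exact: omega_inC.
Qed.

(** One list must serve all cycles [z], since it is applied later to cycles produced by connecting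
    maps. *)
Definition van A j := exists l, forall z : chain R rat E j,
  rcyc setT (arr A) z -> rbnd setT (arr A) (omega l z).

Hypothesis hX : hausdorff_space X.
Hypothesis eX : forall x : X, euclidean_at R d x.
Hypothesis cX : connected [set: X].

(** Exactness of relative Mayer-Vietoris: two products make the cycle bound modulo each of the two
    complements, and a third one kills the class of one degree higher that maps to it. The operators
    respect cycles, boundaries and [conn], so they may be composed. *)
Lemma mv_van P A j : van [:: P] j -> van A j -> van [seq join P Q | Q <- A] j.+1 ->
  van (P :: A) j.
Proof.
move=> [l1 H1] [l2 H2] [l3 H3]; exists (l3 ++ (l2 ++ l1)) => z zc.
have z1 : rcyc setT (arr [:: P]) z.
  by apply: rcyc_mono zc => // x; rewrite arr_cons => -[].
have z2 : rcyc setT (arr A) z.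
  by apply: rcyc_mono zc => // x; rewrite arr_cons => -[].
pose w := omega (l2 ++ l1) z.
have w1 : rbnd setT (arr [:: P]) w by rewrite /w omega_cat; exact/omega_rbnd/H1.
have w2 : rbnd setT (arr A) w by rewrite /w omega_cat; apply: H2; exact: omega_rcyc.
have [y yw] := conn_ex w1 w2.
have yc := conn_rcyc yw; rewrite arr_join in yc.
rewrite omega_cat arr_cons.
apply: (@conn_rbnd R E (arr [:: P]) (arr A) _ _ _ (omega l3 y)).
- exact: arr_open.
- exact: arr_open.
- by rewrite -arr_cons; exact/omega_rcyc/omega_rcyc.
- exact: omega_conn.
- by rewrite arr_join; exact: H3.
Qed.

(** At a singleton [s], [addpt s] is homotopic on the pair to replacing the s-th coordinate by [pt],
    so each factor of [omega] may be traded for one of [reduce]. *)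
Lemma omega_reduce P l n (z : chain R rat E n) : (forall s, s \in l -> single P s) ->
  rcyc setT (~` diag P) z ->
  rbnd setT (~` diag P) (omega l z - reduce pt l z) /\
  rcyc setT (~` diag P) (reduce pt l z).
Proof.
elim: l => [|s l IH] sl zc /=.
  by rewrite subrr; split=> //; have [] := @rbnd_submod R E setT (~` diag P) n.
have [|H1 H2] := IH _ zc; first by move=> t tl; apply: sl; rewrite inE tl orbT.
have ss : single P s by apply: sl; rewrite inE eqxx.
have pU t : single P t -> forall x : E, (~` diag P) x -> (~` diag P) (setc t pt x).
  by move=> st x; exact: setcU.
split; last first.
  apply: submodB => //; first exact: rcyc_submod.
  apply: push_rcyc => //; [exact: setc_continuous | exact: pU].
set A1 := omega l z; set A2 := reduce pt l z.
have -> : A1 - push (addpt s) A1 - (A2 - proj pt s A2) =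
    (A1 - A2) - push (addpt s) (A1 - A2) - (push (addpt s) A2 - proj pt s A2).
  have alg (V : zmodType) (a b p q r : V) :
      a - p - (b - r) = a - b - (p - q) - (q - r).
    rewrite -[RHS]addrA -[- (p - q) - _]opprD subrKA !opprB [LHS]addrACA [RHS]addrACA.
    by rewrite [- p - b]addrC.
  have -> : push (addpt s) (A1 - A2) = push (addpt s) A1 - push (addpt s) A2.
    exact: linearB.
  exact: alg.
apply: submodB; first exact: rbnd_submod.
  apply: submodB => //; first exact: rbnd_submod.
  apply: push_rbnd => //; first exact: addpt_continuous.
  by move=> x nd /diag_addpt.
(* The isotopy moves the other coordinates while the s-th one stays at [pt]. Off the diagonal it
   stays off: the s-th coordinate is compared with no other one, and the isotopy is injective at
   each time. *)
pose H (x : E) (tau : R) : E := \row_a if a == s then pt else e (x ord0 a) tau.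
have Hc : hcont H setT.
  move=> x tau _ _; change {for (x, tau), continuous (fun q : E * R => H q.1 q.2)}.
  apply: mx_continuous_at => i a; rewrite (ord1 i) {i}.
  case: (eqVneq a s) => [as_|as_].
    rewrite (_ : (fun _ => _) = fun=> pt); first exact: cst_continuous.
    by apply/funext => q; rewrite mxE as_ eqxx.
  rewrite (_ : (fun _ => _) = fun q : E * R => e (q.1 ord0 a) q.2); last first.
    by apply/funext => q; rewrite mxE (negPf as_).
  apply: (@continuous_comp _ _ _ (fun q : E * R => (q.1 ord0 a, q.2)) (fun q : X * R => e q.1 q.2)).
    have c1 : {for (x, tau), continuous (fun q : E * R => q.1 ord0 a)}.
      apply: (@continuous_comp _ _ _ fst (fun x : E => x ord0 a)); first exact: cvg_fst.
      exact: mx_coord_continuous.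
    exact: (cvg_pair c1 (@cvg_snd _ _ _ _ _)).
  exact: e_cts.
have HU (x : E) (tau : R) : setT x -> (~` diag P) x -> 0 <= tau <= 1 -> (~` diag P) (H x tau).
  move=> _ nd t01 dH; apply: nd => a b Pab; have [->//|ab] := eqVneq a b.
  have as_ : a != s.
    by apply: contra ab => /eqP as_; rewrite as_ eq_sym; apply/eqP; apply: ss; rewrite -Pab as_.
  have bs : b != s.
    by apply: contra ab => /eqP bs; rewrite bs; apply/eqP; apply: ss; rewrite Pab bs.
  have := dH a b Pab; rewrite !mxE (negPf as_) (negPf bs); exact: e_inj.
have := homotopy_rbnd (H := H) (A' := setT) Hc (fun _ _ _ _ => I) HU H2.
have -> : H ^~ 0 = setc s pt.
  by apply/funext => x; apply/rowP => a; rewrite !mxE e0.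
by [].
Qed.

Lemma van1 P j : (j < rk P * d + size (singles P))%N -> van [:: P] j.
Proof.
move=> jP; exists (singles P) => z; rewrite arr1 => zc.
have sP s : s \in singles P -> single P s by exact: singlesP.
have [H1 H2] := omega_reduce sP zc.
rewrite -(subrK (reduce pt (singles P) z) (omega _ z)); apply: submodD => //.
  exact: rbnd_submod.
apply: (@reduced_vanish R d X m pt hX eX cX P (singles P)) => //.
- exact/filter_uniq/enum_uniq.
- exact: openT.
- by move=> s; exact: proj_reduce.
Qed.

Lemma van_nil j : van [::] j.
Proof.
exists [::] => z _; apply: rbnd_in; first exact: inCT.
by have -> : arr [::] = setT by apply/seteqP.
Qed.

Lemma van_sub A B j : {subset B <= A} -> (forall P, P \in A -> exists2 Q, Q \in B & coarser Q P) ->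
  van B j -> van A j.
Proof.
move=> BA AB; rewrite /van; suff -> : arr A = arr B by [].
apply/seteqP; split=> x h P PB; first exact/h/BA.
have [Q QB QP] := AB P PB.
by move=> dx; apply: (h Q QB); exact: coarser_diag QP _ dx.
Qed.

Hypothesis d1 : (1 < d)%N.

(* Induction on the number of diagonals.  Each Mayer-Vietoris step loses one
   degree, which is compensated by the growth of the rank under joins with a
   diagonal Q of minimal rank. *)
Lemma van_all A r j : (forall P, P \in A -> r <= rk P)%N -> (j < m./2 + r)%N -> van A j.
Proof.
move: {2}(size A) (leqnn (size A)) => N.
elim: N A r j => [|N IH] A r j.
  by rewrite leqn0 => /nilP -> _ _; exact: van_nil.
move=> sA Ar jr; have [A0|A0] := eqVneq A [::]; first by rewrite A0; exact: van_nil.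
have [Q QA Qmin] : exists2 Q, Q \in A & forall P, P \in A -> (rk Q <= rk P)%N.
  have [Q0 Q0A] : exists Q, Q \in A by case: (A) A0 => // Q ? _; exists Q; rewrite inE eqxx.
  case: (@arg_minnP {ffun 'I_m -> 'I_m} Q0 (fun Q => Q \in A) (fun Q => rk Q) Q0A) => Q QA Qmin.
  by exists Q.
(* Diagonals contained in that of [Q] are redundant. For the remaining ones, minimality of the rank
   of [Q] makes the join strictly larger in rank. *)
pose B := [seq P <- A | ~~ coarser Q P].
have sB : (size B < size A)%N.
  rewrite size_filter ltn_neqAle count_size andbT -all_count.
  apply/allPn; exists Q => //; rewrite negbK; exact/coarserP.
have jQ : (j < m./2 + rk Q)%N by apply: leq_trans jr _; rewrite leq_add2l; exact: Ar.
apply: (@van_sub _ (Q :: B)) => [P|P PA|].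
- by rewrite inE => /orP[/eqP->//|]; rewrite mem_filter => /andP[].
- have [QP|QP] := boolP (coarser Q P); first by exists Q => //; rewrite inE eqxx.
  by exists P; [rewrite inE mem_filter QP PA orbT | exact/coarserP].
apply: mv_van.
(* Here [d] at least 2 enters: [rk Q * d] plus the singletons is at least [rk Q] plus ([rk Q] plus
   the singletons), hence at least [rk Q] plus half of [m]. *)
- apply: van1; have := singles_bound Q; move: jQ d1.
  set s := size _; set k := rk Q => jk d1' b.
  have : (k * 2 <= k * d)%N by rewrite leq_mul2l d1' orbT.
  lia.
- apply: (IH _ (rk Q)) => //; first by rewrite -ltnS (leq_trans sB).
  by move=> P; rewrite mem_filter => /andP[_ PA]; exact: Qmin.
- apply: (IH _ (rk Q).+1); last by rewrite addnS ltnS.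
    by rewrite size_map -ltnS (leq_trans sB).
  move=> _ /mapP[P PB ->]; move: PB; rewrite mem_filter => /andP[nQP PA].
  have [le1 eq1] := rk_coarser (coarser_joinl Q P).
  rewrite ltn_neqAle le1 andbT; apply/eqP => /eq1 jQ'.
  have PQ : coarser P Q.
    apply/coarserP => a b Pab; apply: (coarserP _ _ jQ').
    exact: (coarserP _ _ (coarser_joinr Q P)).
  have [le2 eq2] := rk_coarser PQ.
  by move/negP: nQP; apply; apply: eq2; apply/eqP; rewrite eqn_leq le2 Qmin.
Qed.

(** The long exact sequence of the pair: one product makes the cycle bound in X^m, and another makes
    the bounding chain, a relative cycle of degree [j + 1], homologous to one in the complement. The
    extra degree accounts for the predecessor in the bound. *)
Lemma van_arr A j : (j < (m./2).-1)%N -> exists l, forall z : chain R rat E j,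
  rcyc (arr A) set0 z -> rbnd (arr A) set0 (omega l z).
Proof.
(* The discrete partition has all of X^m as its diagonal, so its complement is empty and absolute
   homology of X^m becomes a case of the relative statements. *)
move=> jm; pose D : {ffun 'I_m -> 'I_m} := [ffun a => a].
have aD : arr [:: D] = set0.
  apply/seteqP; split=> // x; rewrite arr1; apply => a b.
  by rewrite !ffunE => ->.
have [l1 H1] : van [:: D] j by apply: (@van_all _ 0) => //; rewrite addn0; lia.
have [l2 H2] : van A j.+1 by apply: (@van_all _ 0) => //; rewrite addn0; lia.
exists (l2 ++ l1) => z [Az z0].
have [_ [f [_ Uf]]] : rbnd setT (arr [:: D]) (omega l1 z).
  by apply: H1; split; [exact: inCT | rewrite aD].
have {}Uf : omega l1 z = boundary f.
  by apply/eqP; rewrite -subr_eq0; apply/eqP; apply: inC0; rewrite aD in Uf.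
have [|_ [g [_ Ug]]] := H2 f.
  by split; [exact: inCT | rewrite -Uf; exact: omega_inC].
split; first exact: omega_inC.
exists (omega l2 f - boundary g); split=> //.
have -> : omega (l2 ++ l1) z - boundary (omega l2 f - boundary g) = 0.
  have bg : @boundary R rat E j.+1 (boundary g) = 0 := boundary_boundary g.
  by rewrite boundaryB bg subr0 omega_bd -Uf omega_cat subrr.
exact: supp0.
Qed.

(** Expanding the product one factor at a time, each factor contributes one term in the image of
    [addpt s]. *)
Lemma omega_image n l A (z : chain R rat E n) : rcyc (arr A) set0 z ->
  exists L : seq ('I_m * chain R rat E n),
    (forall s c, (s, c) \in L -> rcyc (arr A) set0 c) /\
    z - omega l z = \sum_(sc <- L) push (addpt sc.1) sc.2.
Proof.
move=> zc; have oc l' : rcyc (arr A) set0 (omega l' z).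
  have [Az z0] := zc; split; first exact: omega_inC.
  rewrite omega_bd; have -> : boundary z = 0 by exact: inC0.
  have -> : omega l' (0 : chain R rat E n.-1) = 0.
    by elim: l' => //= s l' ->; rewrite linear0 subr0.
  exact: supp0.
elim: l => [|s l [L [HL E1]]] /=.
  by exists [::]; split=> //; rewrite subrr big_nil.
exists ((s, omega l z) :: L); split.
  by move=> t c; rewrite inE => /orP[/eqP[_ ->]|/HL].
by rewrite big_cons -E1 opprB addrA addrAC addrC addrA.
Qed.

End Isotopy.

(** * Finite generation for complements of diagonals *)

Section FiniteGeneration.
Variables (R : realType) (d : nat) (X : topologicalType) (m : nat).
Local Notation E := 'rV[X]_m.
Variables (e : X -> R -> X) (K : set X).
Hypothesis e_cts : continuous (fun q : X * R => e q.1 q.2).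
Hypothesis e0 : forall x, e x 0 = x.
Hypothesis e_inj : forall t, 0 <= t <= 1 -> injective (e^~ t).
Hypothesis cK : compact K.
Hypothesis eK : forall x, K (e x 1).
Hypothesis hX : hausdorff_space X.
Hypothesis eX : forall x : X, euclidean_at R d x.
Implicit Types (P Q : {ffun 'I_m -> 'I_m}) (A : seq {ffun 'I_m -> 'I_m}).
Local Notation arr A := (@arr X m A).

Definition fgr (U : set E) j := fgb false (@rcyc R E setT U j) (@rbnd R E setT U j).

(** The isotopy is a homotopy of pairs from the identity to a map into the tuples with entries in
    [K]. These form a compact set, near which [pair_fg] supplies finitely many generators. *)
Lemma fgr1 P j : fgr (~` diag P) j.
Proof.
pose H (x : E) (tau : R) : E := \row_a e (x ord0 a) tau.
have Hc : hcont H setT.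
  move=> x tau _ _; change {for (x, tau), continuous (fun q : E * R => H q.1 q.2)}.
  apply: mx_continuous_at => i a; rewrite (ord1 i) {i}.
  rewrite (_ : (fun _ => _) = fun q : E * R => e (q.1 ord0 a) q.2); last first.
    by apply/funext => q; rewrite mxE.
  apply: (@continuous_comp _ _ _ (fun q : E * R => (q.1 ord0 a, q.2)) (fun q : X * R => e q.1 q.2)).
    have c1 : {for (x, tau), continuous (fun q : E * R => q.1 ord0 a)}.
      apply: (@continuous_comp _ _ _ fst (fun x : E => x ord0 a)); first exact: cvg_fst.
      exact: mx_coord_continuous.
    exact: (cvg_pair c1 (@cvg_snd _ _ _ _ _)).
  exact: e_cts.
have HU (x : E) (tau : R) : setT x -> (~` diag P) x -> 0 <= tau <= 1 -> (~` diag P) (H x tau).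
  move=> _ nd t01 dH; apply: nd => a b Pab.
  by have := dH a b Pab; rewrite !mxE; exact: e_inj.
have [O' [_ KO' _ [L [_ HL]]]] := @pair_fg R d X m hX eX P false j
  (fun h => False_ind _ (Bool.diff_false_true h)) [set x : E | forall a, K (x ord0 a)] setT
  (@compact_rV X m K cK) (@subsetT _ _) openT.
exists L; split=> // z zc.
have := homotopy_rbnd (H := H) (A' := setT) Hc (fun _ _ _ _ => I) HU zc.
have -> : push (H ^~ 0) z = z.
  rewrite -[RHS]push_id; congr (push _ z); apply/funext => x; apply/rowP => a.
  by rewrite mxE e0.
have H1c : continuous (H ^~ 1).
  move=> x; apply: (@continuous_comp _ _ _ (fun x => (x, 1 : R)) (fun q : E * R => H q.1 q.2)).
    by apply: (@pair_continuous E E R id (fun=> 1)) => y; [exact: cvg_id | exact: cst_continuous].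
  by have := Hc x 1 I; rewrite lexx ler01; exact.
move=> h; have [|a Ha] := HL (push (H ^~ 1) z).
  have [_ Uz] := zc; split.
    have zT : inC setT z by exact: inCT.
    apply: (push_inC (f := H ^~ 1)) zT => x _.
    by apply: KO' => a; rewrite mxE.
  rewrite push_boundary //; apply: push_inC Uz => x nd.
  by apply: HU => //; rewrite lexx ler01.
exists a; rewrite -(subrKA (push (H ^~ 1) z)); apply: submodD => //.
  exact: rbnd_submod.
by rewrite -opprB; apply: submodN => //; exact: rbnd_submod.
Qed.

Lemma rel_lcomb_lin (V : lmodType rat) (B : V -> Prop) (L : seq V) : submod B ->
  forall (c : rat) z z' a a', B (z - lcomb L a) -> B (z' - lcomb L a') ->
     B (c *: z + z' - lcomb L (fun i => c * a i + a' i)).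
Proof.
move=> [_ sB] c z z' a a' Ba Ba'.
by rewrite lcombP opprD addrACA -scalerBr; exact: sB.
Qed.

Lemma lcomb_zero (V : lmodType rat) (L : seq V) a :
  (forall i, (i < size L)%N -> a i = 0) -> lcomb L a = 0.
Proof. by move=> a0; rewrite /lcomb big1 // => k _; rewrite a0 ?scale0r. Qed.

Lemma fgb_meet (V : lmodType rat) (Z B : V -> Prop) : submod Z -> submod B ->
  fgb false Z B -> fgb false Z (fun z => Z z /\ B z).
Proof.
move=> sZ sB [L [_ HL]].
apply: (@fgb_rel V false (size L) Z _ (fun z a => B (z - lcomb L a))) => //.
- by move=> c z z' a a'; exact: rel_lcomb_lin.
- move=> z a Zz Ba /lcomb_zero L0; split=> //; by rewrite L0 subr0 in Ba.
Qed.

Lemma submodI (V : lmodType rat) (Z B : V -> Prop) : submod Z -> submod B ->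
  submod (fun z => Z z /\ B z).
Proof.
by move=> [Z0 ZP] [B0 BP]; split=> // c x y [Zx Bx] [Zy By]; split; [exact: ZP | exact: BP].
Qed.

(** First cut down to the cycles that bound modulo each complement, at the cost of finitely many
    generators; the rest come from the connecting map, whose source is finitely generated. *)
Lemma mv_fgr P A j : fgr (arr [:: P]) j -> fgr (arr A) j ->
  fgr (arr [seq join P Q | Q <- A]) j.+1 -> fgr (arr (P :: A)) j.
Proof.
move=> fg1 fg2 [L [_ HL]].
have Z1 z : rcyc setT (arr (P :: A)) z -> @rcyc R E setT (arr [:: P]) j z.
  by apply: rcyc_mono => // x; rewrite arr_cons => -[].
have Z2 z : rcyc setT (arr (P :: A)) z -> @rcyc R E setT (arr A) j z.
  by apply: rcyc_mono => // x; rewrite arr_cons => -[].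
have sZ := @rcyc_submod R E setT (arr (P :: A)) j.
have sB1 := @rbnd_submod R E setT (arr [:: P]) j.
have sB2 := @rbnd_submod R E setT (arr A) j.
apply: (@fgb_trans _ _ _ (fun z => rcyc setT (arr (P :: A)) z /\ rbnd setT (arr [:: P]) z)).
  by apply: fgb_meet => //; apply: fgb_mono fg1.
apply: (@fgb_trans _ _ _ (fun z => (rcyc setT (arr (P :: A)) z /\ rbnd setT (arr [:: P]) z)
  /\ rbnd setT (arr A) z)).
  apply: fgb_meet => //; first exact: submodI.
  by apply: fgb_mono fg2 => // z [/Z2].
apply: (@fgb_rel _ false (size L) _ _ (fun z a => exists y,
   conn (arr [:: P]) (arr A) y z /\
   rbnd setT (arr [seq join P Q | Q <- A]) (y - lcomb L a))) => //.
- by apply: submodI => //; exact: submodI.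
- move=> c z z' a a' [y [yz By]] [y' [yz' By']]; exists (c *: y + y'); split.
    exact: connP.
  by apply: rel_lcomb_lin => //; exact: rbnd_submod.
- move=> z [[zc z1] z2]; have [y yz] := conn_ex z1 z2.
  have [|a Ha] := HL y; last by exists a, y.
  by rewrite -arr_join; exact: conn_rcyc yz.
- move=> z a [[zc z1] z2] [y [yz By]] /lcomb_zero L0.
  rewrite L0 subr0 -arr_join in By; rewrite arr_cons.
  apply: (@conn_rbnd R E (arr [:: P]) (arr A) _ _ _ y) => //; try exact: arr_open.
  by rewrite -arr_cons.
Qed.

Lemma fgr_arr A j : fgr (arr A) j.
Proof.
move: {2}(size A) (leqnn (size A)) => N; elim: N A j => [|N IH] [|P A] j //= sA.
- apply: fgb_sub => z _; apply: rbnd_in; first exact: inCT.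
  by have -> : arr [::] = setT by apply/seteqP.
- apply: fgb_sub => z _; apply: rbnd_in; first exact: inCT.
  by have -> : arr [::] = setT by apply/seteqP.
- apply: mv_fgr; [by rewrite arr1; exact: fgr1 | exact: IH |].
  by apply: IH; rewrite size_map.
Qed.

(** The long exact sequence of the pair, with the absolute homology of X^m obtained from the
    discrete partition as in [van_arr]. *)
Lemma fg_homology_arr A j :
  fgb false (@rcyc R E (arr A) set0 j) (@rbnd R E (arr A) set0 j).
Proof.
pose D : {ffun 'I_m -> 'I_m} := [ffun a => a].
have aD : arr [:: D] = set0.
  apply/seteqP; split=> // x; rewrite arr1; apply => a b.
  by rewrite !ffunE => ->.
have fgD : fgr set0 j by rewrite -aD; exact: fgr_arr.
have [L [_ HL]] := fgr_arr A j.+1.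
have sZ := @rcyc_submod R E (arr A) set0 j.
have sB0 := @rbnd_submod R E setT set0 j.
apply: (@fgb_trans _ _ _ (fun z => rcyc (arr A) set0 z /\ rbnd setT set0 z)).
  by apply: fgb_meet => //; apply: fgb_mono fgD => // z; exact: rcyc_mono.
apply: (@fgb_rel _ false (size L) _ _ (fun z a => exists f,
   z = @boundary R rat E j.+1 f /\ rbnd setT (arr A) (f - lcomb L a))) => //.
- exact: submodI.
- move=> c z z' a a' [f [-> Bf]] [f' [-> Bf']]; exists (c *: f + f'); split.
    by rewrite linearP.
  by apply: rel_lcomb_lin => //; exact: rbnd_submod.
- move=> z [[Az z0] [_ [f [_ Uf]]]].
  have zf : z = boundary f by apply/eqP; rewrite -subr_eq0; apply/eqP; exact: inC0.
  have [|a Ha] := HL f; last by exists a, f.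
  by split; [exact: inCT | rewrite -zf].
- move=> z a [[Az z0] _] [f [zf [_ [g [_ Ug]]]]] /lcomb_zero L0.
  rewrite L0 subr0 in Ug; split=> //; exists (f - boundary g); split=> //.
  have bg : @boundary R rat E j.+1 (boundary g) = 0 := boundary_boundary g.
  by rewrite boundaryB bg subr0 -zf subrr; exact: supp0.
Qed.

End FiniteGeneration.

(** * Symmetric products *)

Section SymmetricProduct.
Variables (X : topologicalType) (m : nat).
Local Notation E := 'rV[X]_m.
Local Notation S := (Defs.Sym X m).

Definition symq (u : E) : S := \pi_(quotient_topology {eq_quot @sym_rel X m})%qT u.

Lemma symqP u v : symq u = symq v <-> exists s : 'S_m, v = col_perm s u.
Proof.
split=> [/eqmodP/existsP[s /eqP ->]|[s ->]]; first by exists s.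
by apply/eqmodP/existsP; exists s.
Qed.

Lemma symq_ex (q : S) : exists u, symq u = q.
Proof. by exists (repr q); exact: reprK. Qed.

Lemma symq_perm s u : symq (col_perm s u) = symq u.
Proof. by apply/esym/symqP; exists s. Qed.

Lemma symq_continuous : continuous symq.
Proof. exact: pi_continuous. Qed.

Lemma col_perm_continuous (s : 'S_m) : continuous (col_perm s : E -> E).
Proof.
apply: mx_continuous => i a.
rewrite (_ : (fun _ => _) = fun x : E => x i (s a)); last by apply/funext => x; rewrite mxE.
exact: mx_coord_continuous.
Qed.

Lemma open_sym (W : set S) : open (symq @^-1` W) -> open W.
Proof. by []. Qed.

Lemma symq_open (A : set E) : open A -> open (symq @` A).
Proof.
move=> Ao; apply: open_sym.
have -> : symq @^-1` (symq @` A) = \bigcup_(s in [set: 'S_m]) (col_perm s @^-1` A).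
  apply/seteqP; split=> x.
    by move=> [y Ay /esym/symqP[s ys]]; exists s => //=; rewrite -ys.
  by move=> [s _ /= As]; exists (col_perm s x) => //; exact: symq_perm.
by apply: bigcup_open => s _; apply: open_comp => // x _; exact: col_perm_continuous.
Qed.

Lemma symq_nbhs (x : E) (A : set E) : nbhs x A -> nbhs (symq x) (symq @` A).
Proof.
rewrite nbhsE => -[B [Bo Bx] BA]; apply: (@filterS _ _ _ _ _ (image_subset symq BA)).
by apply: open_nbhs_nbhs; split; [exact: symq_open | exists x].
Qed.

(** The group is finite: separate one point from each permuted copy of the other and intersect the
    neighbourhoods. Images of neighbourhoods are neighbourhoods, as the projection is open. *)
Lemma sym_hausdorff : hausdorff_space X -> hausdorff_space S.
Proof.
move=> hX p q; have [x <-] := symq_ex p; have [y <-] := symq_ex q => cl.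
apply: contrapT => xy.
have hE := @mx_hausdorff X 1 m hX.
have h (s : 'S_m) : exists A : set E, nbhs x A /\ nbhs y [set z | ~ A (col_perm s z)].
  have ne : x != col_perm s y.
    by apply/eqP => xs; apply: xy; rewrite xs; exact: symq_perm.
  have := hE; rewrite open_hausdorff => /(_ _ _ ne)[[A B] /= [Ax By] [Ao Bo /eqP AB]].
  rewrite !inE in Ax By; exists A; split; first by apply: open_nbhs_nbhs; split.
  apply: (@filterS _ _ _ (col_perm s @^-1` B)).
    by move=> z Bz Az; have : (A `&` B) (col_perm s z) by []; rewrite AB.
  exact: (@col_perm_continuous s y B (open_nbhs_nbhs (conj Bo By))).
have [A nA] := choice h.
have nA1 : nbhs x [set z | forall s, A s z].
  have : forall s, nbhs x (A s) by move=> s; have [] := nA s.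
  by move/filter_forall.
have nB1 : nbhs y [set z | forall s, ~ A s (col_perm s z)].
  have : forall s, nbhs y [set z | ~ A s (col_perm s z)] by move=> s; have [] := nA s.
  by move/filter_forall.
have [_ [[z Az <-] [w Bw /symqP[s zs]]]] := cl _ _ (symq_nbhs nA1) (symq_nbhs nB1).
by apply: (Bw s); rewrite -zs; exact: Az.
Qed.

End SymmetricProduct.

Lemma prism_natural (R : realType) (E E' : topologicalType) (f : E -> E')
    (H : E -> R -> E) (H' : E' -> R -> E') n (c : chain R rat E n) :
  continuous f -> (forall x a, f (H x a) = H' (f x) a) ->
  suppt (fun s : singular R E n => adm H s) c ->
  push f (prism H c) = prism H' (push f c).
Proof.
move=> fc fH Hc; rewrite /prism push_sop ?addn1 // [RHS]sop_push; last exact: cts_push.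
by have -> : (fun x a => f (H x a)) = (fun x a => H' (f x) a) by apply/funext => x; apply/funext.
Qed.

Lemma restr_push (R : realType) (E E' : topologicalType) (f : E -> E') n
    (Q : singular R E n -> Prop) (Q' : singular R E' n -> Prop) (c : chain R rat E n) :
  continuous f ->
  (forall (s : singular R E n) (s' : singular R E' n), f \o s =1 s' -> (Q s <-> Q' s')) ->
  restr Q' (push f c) = push f (restr Q c).
Proof.
move=> fc QQ; apply: (@linU_ext _ _ _ (restr Q' \o @push R E E' f n)
  (@push R E E' f n \o restr Q)) => s.
rewrite [LHS]/= [RHS]/= pushU restrU.
have [s' ss' ->] : exists2 s' : singular R E' n, f \o s =1 s' & mksing (f \o s) = << s' >>.
  by apply: mksing_ex => t; exact: (continuous_comp (cts_fun (s := s) t) (fc _)).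
rewrite restrU; have QE := QQ _ _ ss'; case: asboolP => q; case: asboolP => q'.
- by rewrite [RHS]pushU; apply/esym/mksingE.
- by case: q'; apply/QE.
- by case: q; apply/QE.
- by rewrite linear0.
Qed.

Lemma restr_id (T : choiceType) (Q : T -> Prop) (c : {freeg T / rat}) :
  suppt Q c -> restr Q c = c.
Proof.
move=> Qc; apply/esym/eqP; rewrite -subr_eq0; apply/eqP/supp_false.
by have := supp_restrC (P := Q) Qc; apply: sub_supp => x [].
Qed.

Lemma push_mksing_cst (R : realType) (T T' : topologicalType) (f : T -> T') (q : T) n :
  push f (mksing (fun=> q) : chain R rat T n) = mksing (fun=> f q).
Proof.
have [s ss ->] : exists2 s : singular R T n, (fun=> q) =1 s & mksing (fun=> q) = << s >>.
  by apply: mksing_ex; exact: cst_continuous.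
by rewrite pushU; congr mksing; apply/funext => t /=; rewrite -ss.
Qed.

(** * An equivariant contraction around one orbit *)

Section LocalContraction.
Variables (R : realType) (d : nat) (X : topologicalType) (m : nat).
Local Notation E := 'rV[X]_m.
Local Notation symq := (@symq X m).
Variables (p : E) (N : X -> set X) (D : forall y, disc R d y (N y)).
Hypothesis Ddis : forall a b x, dset (D (p ord0 a)) x -> dset (D (p ord0 b)) x ->
  p ord0 a = p ord0 b.

(* The contraction is applied coordinatewise, so that it is equivariant. *)
Definition kmap (x : X) (t : R) : X :=
  if [pick a | `[< dset (D (p ord0 a)) x >]] is Some a
  then dof (D (p ord0 a)) (t *: dto (D (p ord0 a)) x) else x.

Lemma kmapE a x t : dset (D (p ord0 a)) x ->
  kmap x t = dof (D (p ord0 a)) (t *: dto (D (p ord0 a)) x).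
Proof.
move=> ax; rewrite /kmap; case: pickP => [b /asboolP bx|/(_ a)/asboolP//].
by rewrite (Ddis bx ax).
Qed.

Definition kbox (x : E) (t : R) : E := \row_a kmap (x ord0 a) t.
Local Notation box := (boxW p D).
Definition sbox : set (Defs.Sym X m) := symq @` box.

Lemma sboxP x : sbox (symq x) <-> exists s : 'S_m, box (col_perm s x).
Proof.
split=> [[y By /esym/symqP[s yx]]|[s Bx]]; first by exists s; rewrite -yx.
by exists (col_perm s x) => //; exact: symq_perm.
Qed.

Lemma sbox_open : open sbox.
Proof. exact/symq_open/boxW_open. Qed.

Lemma sbox_p : sbox (symq p).
Proof. by exists p => //; exact: boxW_p. Qed.

Lemma kbox_perm (s : 'S_m) x t : kbox (col_perm s x) t = col_perm s (kbox x t).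
Proof. by apply/rowP => a; rewrite !mxE. Qed.

Lemma kbox_contr x t : box x -> kbox x t = contr p D x t.
Proof. by move=> Bx; apply/rowP => a; rewrite !mxE (kmapE _ (Bx a)). Qed.

Lemma kbox_permE (s : 'S_m) x t : box (col_perm s x) ->
  kbox x t = col_perm s^-1%g (contr p D (col_perm s x) t).
Proof.
by move=> Bx; rewrite -(kbox_contr t Bx) kbox_perm -col_permM mulVg col_perm1.
Qed.

Lemma kbox_sbox x t : sbox (symq x) -> sbox (symq (kbox x t)).
Proof.
move=> /sboxP[s Bx]; apply/sboxP; exists s.
by rewrite -kbox_perm kbox_contr //; exact: contrW.
Qed.

Lemma kbox1 x : sbox (symq x) -> kbox x 1 = x.
Proof.
by move=> /sboxP[s Bx]; rewrite (kbox_permE 1 Bx) contr1 // -col_permM mulVg col_perm1.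
Qed.

Lemma kbox0 x : sbox (symq x) -> exists s : 'S_m, kbox x 0 = col_perm s p.
Proof.
by move=> /sboxP[s Bx]; exists s^-1%g; rewrite (kbox_permE 0 Bx) contr0.
Qed.

(** Near a point of the orbit of the box, [kbox] is the contraction [contr] conjugated by a fixed
    permutation. *)
Lemma kbox_cont : hcont kbox (symq @^-1` sbox).
Proof.
move=> x t /sboxP[s Bx] t01.
pose F (q : E * R) := col_perm s^-1%g (contr p D (col_perm s q.1) q.2).
have xF : kbox x t = F (x, t) by exact: kbox_permE.
rewrite xF; suff Fc : F @ (x, t) --> F (x, t).
  apply: cvg_trans Fc; apply: near_eq_cvg.
  have nB : nbhs (x, t) (fst @^-1` (col_perm s @^-1` box)).
    apply: (@cvg_fst _ _ (nbhs x) (nbhs t)); apply: (@col_perm_continuous X m s x).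
    by apply: open_nbhs_nbhs; split; [exact: boxW_open|].
  by apply: filterS nB => q Bq; rewrite /F -kbox_permE.
apply: (@continuous_comp _ _ _ (fun q : E * R => contr p D (col_perm s q.1) q.2)
  (col_perm s^-1%g)); last exact: col_perm_continuous.
apply: (@continuous_comp _ _ _ (fun q : E * R => (col_perm s q.1, q.2))
  (fun q : E * R => contr p D q.1 q.2)); last exact: contr_cont.
have c1 : {for (x, t), continuous (fun q : E * R => col_perm s q.1)}.
  apply: (@continuous_comp _ _ _ fst (col_perm s)); first exact: cvg_fst.
  exact: col_perm_continuous.
exact: (cvg_pair c1 (@cvg_snd _ _ _ _ _)).
Qed.

Definition qbox (q : Defs.Sym X m) (t : R) : Defs.Sym X m := symq (kbox (repr q) t).

Lemma qboxE x t : symq (kbox x t) = qbox (symq x) t.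
Proof.
have /symqP[s rE] : symq x = symq (repr (symq x)) by apply/esym; exact: reprK.
by rewrite /qbox rE kbox_perm symq_perm.
Qed.

(** Continuity descends from [kbox] because the projection is open, so it sends product
    neighbourhoods to product neighbourhoods. *)
Lemma qbox_cont : hcont qbox sbox.
Proof.
move=> q t; have [x <-] := symq_ex q => xW t01 B.
rewrite -qboxE => nB.
have : nbhs (x, t) [set z : E * R | B (symq (kbox z.1 z.2))].
  have nB' : nbhs (kbox x t) (symq @^-1` B) by exact: (symq_continuous nB).
  exact: (kbox_cont xW t01 nB').
move=> [[A C] /= [nA nC] AC].
exists (symq @` A, C) => /=; first by split=> //; exact: symq_nbhs.
by move=> [_ u] /= [[y Ay <-] Cu]; rewrite -qboxE; exact: (AC (y, u)).
Qed.

Lemma qbox_sbox q t : sbox q -> sbox (qbox q t).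
Proof. by have [x <-] := symq_ex q => xW; rewrite -qboxE; exact: kbox_sbox. Qed.

Lemma qbox1 q : sbox q -> qbox q 1 = q.
Proof. by have [x <-] := symq_ex q => xW; rewrite -qboxE kbox1. Qed.

Lemma qbox0 q : sbox q -> qbox q 0 = symq p.
Proof.
have [x <-] := symq_ex q => xW; rewrite -qboxE; have [s ->] := kbox0 xW.
exact: symq_perm.
Qed.

Definition liftable n (c : chain R rat (Defs.Sym X m) n) :=
  exists c' : chain R rat E n, push symq c' = c.

Lemma restrict_lift (W : set (Defs.Sym X m)) n (c : chain R rat (Defs.Sym X m) n) :
  inC W c -> liftable c -> exists2 c' : chain R rat E n, inC (symq @^-1` W) c' & push symq c' = c.
Proof.
move=> Wc [c' c'c]; exists (restr (fun s : singular R E n => forall x, W (symq (s x))) c').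
  have := supp_restr (P := fun s : singular R E n => forall x, W (symq (s x))) (@inCT R E n c').
  by apply: sub_supp => s [].
rewrite -(@restr_push R E _ symq n _ (fun s : singular R _ n => forall x, W (s x))).
- by rewrite c'c; exact: restr_id.
- exact: symq_continuous.
- by move=> s s' ss'; split=> h x; have := h x; rewrite -(ss' x).
Qed.

Lemma liftable_submod n : submod (@liftable n).
Proof.
split=> [|a x y [x' <-] [y' <-]]; first by exists 0; rewrite linear0.
by exists (a *: x' + y'); rewrite linearP.
Qed.

Lemma qbox_adm n (c : chain R rat (Defs.Sym X m) n) : inC sbox c ->
  suppt (fun s : singular R (Defs.Sym X m) n => adm qbox s) c.
Proof. by apply: sub_supp => s; apply: hcont_adm; exact: qbox_cont. Qed.

Lemma kbox_adm n (c : chain R rat E n) : inC (symq @^-1` sbox) c ->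
  suppt (fun s : singular R E n => adm kbox s) c.
Proof. by apply: sub_supp => s; apply: hcont_adm; exact: kbox_cont. Qed.

(** The prism of the contraction bounds [z] up to two liftable errors: a multiple of a constant
    simplex, and the prism of the boundary, which is liftable because the contraction upstairs
    covers the one downstairs. *)
Lemma liftable_acyclic n (z : chain R rat (Defs.Sym X m) n) :
  inC sbox z -> liftable (boundary z) ->
  exists2 e : chain R rat (Defs.Sym X m) n.+1, inC sbox e & liftable (z - boundary e).
Proof.
move=> Wz lz; exists (prism qbox z).
  by apply: prism_supp Wz => q a Wq _; exact: qbox_sbox.
rewrite prismE; last exact: qbox_adm.
have -> : push (qbox^~ 1) z = z.
  by rewrite -[RHS]push_id; apply: (push_ext Wz) => q; exact: qbox1.
rewrite -[X in _ - X]addrA -opprD subKr.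
apply: submodD; first exact: liftable_submod.
  have -> : push (qbox^~ 0) z = push (fun=> symq p) z.
    by apply: (push_ext Wz) => q; exact: qbox0.
  have [a ->] := push_cst (symq p) z.
  by exists (a *: mksing (fun=> p)); rewrite linearZ /= push_mksing_cst.
case: n z Wz lz => [|n] z Wz lz /=.
  by have [] := liftable_submod 0.
have [c' Wc' <-] := restrict_lift (inC_bd Wz) lz.
exists (prism kbox c'); apply: prism_natural => //.
- exact: symq_continuous.
- exact: qboxE.
- exact: kbox_adm.
Qed.

End LocalContraction.

Section Clamp.
Variable R : realType.
Definition clamp (a : R) := Num.max 0 (Num.min 1 a).

Lemma clamp01 a : 0 <= clamp a <= 1.
Proof. by rewrite /clamp le_max lexx /= ge_max ler01 ge_min lexx. Qed.

Lemma clamp_continuous : continuous clamp.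
Proof.
move=> a; apply: continuous_max; first exact: cvg_cst.
by apply: continuous_min; [exact: cvg_cst | exact: cvg_id].
Qed.

Lemma clamp0 : clamp 0 = 0.
Proof. by rewrite /clamp minEle ler10 maxxx. Qed.

Lemma clamp1 : clamp 1 = 1.
Proof. by rewrite /clamp minxx maxEle ler01. Qed.
End Clamp.

Lemma simplex_locally_constant (R : realType) n (T : Type) (g : std_simplex R n -> T) :
  (forall t, \forall u \near t, g t = g u) -> forall t u, g t = g u.
Proof.
move=> gc t u.
(* The segment from [t] to [u], with [clamp] making it a map on the whole connected line that stays
   in the simplex. *)
pose cl := @clamp R; have cl01 := @clamp01 R; have clc := @clamp_continuous R.
pose v (a : R) : 'rV[R]_n.+1 := (1 - cl a) *: \val t + cl a *: \val u.
have vD a : v a \in std_simplex R n.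
  have /andP[c0 c1] := cl01 a; apply/mem_set; split=> [i|].
    by rewrite !mxE addr_ge0 // mulr_ge0 ?subr_ge0 // simplex_ge0.
  under eq_bigr do rewrite !mxE; rewrite big_split /= -!mulr_sumr !simplex_sum1.
  by rewrite !mulr1 subrK.
pose w a := to_simplex (v a).
have wc : continuous w.
  apply: sub_continuous.
  have -> : (fun a => \val (w a)) = v by apply/funext => a; exact: to_simplexK.
  apply: mx_continuous => i j; rewrite (ord1 i) {i}.
  rewrite (_ : (fun _ => _) = fun a => (1 - cl a) * \val t ord0 j + cl a * \val u ord0 j); last first.
    by apply/funext => a; rewrite !mxE.
  move=> a; have c1 : {for a, continuous (fun a => 1 - cl a)}.
    exact: (cvgB (cvg_cst _) (clc a)).
  exact: (cvgD (cvgM c1 (cvg_cst _)) (cvgM (clc a) (cvg_cst _))).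
have -> : t = w 0.
  apply: val_inj; rewrite to_simplexK // /v /cl.
  by rewrite clamp0 subr0 scale1r scale0r addr0.
have -> : u = w 1.
  apply: val_inj; rewrite to_simplexK // /v /cl.
  by rewrite clamp1 subrr scale1r scale0r add0r.
apply: (@connected_rel R (fun a b => g (w a) = g (w b))).
- by apply/connected_intervalP => ? ? ? ? ?.
- by [].
- by move=> x y ->.
- by move=> x y z -> ->.
- by move=> x; exact: (wc x _ (gc (w x))).
Qed.

Lemma simplex_const (R : realType) n (E : topologicalType) (I : finType) (q : I -> E)
    (g : std_simplex R n -> E) : hausdorff_space E -> continuous g ->
  (forall t, exists i, g t = q i) -> forall t u, g t = g u.
Proof.
move=> hE gc gq; apply: simplex_locally_constant => t.
have : forall i, nbhs t [set u | g t <> q i -> g u <> q i].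
  move=> i; have [e|ne] := pselect (g t = q i).
    by apply: filterS filterT => u _ /(_ e).
  have o : open (~` [set q i]).
    by apply: closed_openC; apply: accessible_closed_set1; exact: hausdorff_accessible.
  have : nbhs t (g @^-1` (~` [set q i])) := gc t _ (open_nbhs_nbhs (conj o ne)).
  by apply: filterS => u nu _; exact: nu.
move=> /filter_forall; apply: filterS => u h; have [i gi] := gq u.
by apply: contrapT => ne; apply: (h i); rewrite -?gi.
Qed.

Section InvariantChains.
Variables (R : realType) (d : nat) (X : topologicalType) (m : nat).
Local Notation E := 'rV[X]_m.
Local Notation symq := (@symq X m).

Definition invariant n (c : chain R rat E n) := forall s : 'S_m, push (col_perm s) c = c.
(** An invariant chain can vanish in the quotient without being zero, since two simplices with the
    same image need not lie in one orbit. Boundaries of invariant lifts of cycles are of this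
    kind. *)
Definition inv0 n (c : chain R rat E n) := invariant c /\ push symq c = 0.

Lemma inv0_submod n : submod (@inv0 n).
Proof.
split=> [|a x y [ix x0] [iy y0]].
  by split=> [s|]; rewrite linear0.
by split=> [s|]; rewrite linearP /= ?ix ?iy // x0 y0 scaler0 addr0.
Qed.

Lemma mksing_cst_neq0 (T : topologicalType) (q : T) n :
  mksing (fun=> q) != 0 :> chain R rat T n.
Proof.
have [s _ ->] : exists2 s : singular R T n, (fun=> q) =1 s & mksing (fun=> q) = << s >>.
  by apply: mksing_ex; exact: cst_continuous.
apply/eqP => /(congr1 (coeff s)); rewrite coeffU coeff0 eqxx mulr1 => /eqP.
by rewrite oner_eq0.
Qed.

Section Local.
Variables (p : E) (N : X -> set X) (D : forall y, disc R d y (N y)).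
Hypothesis Ddis : forall a b x, dset (D (p ord0 a)) x -> dset (D (p ord0 b)) x ->
  p ord0 a = p ord0 b.
Hypothesis hX : hausdorff_space X.
Local Notation K := (kbox p D).
Local Notation W := (symq @^-1` sbox p D).

Lemma kbox0_cont n (z : chain R rat E n) : inC W z ->
  suppt (fun s : singular R E n => continuous (K^~ 0 \o s)) z.
Proof.
move=> Wz; have := kbox_adm Ddis Wz; apply: sub_supp => s sa.
by apply: (sa n id (fun=> 0)) => [t|t|_]; [exact: cvg_id | exact: cst_continuous | exact: unit0].
Qed.

Lemma kbox0_inv n (z : chain R rat E n) : inC W z -> inv0 z -> inv0 (push (K^~ 0) z).
Proof.
move=> Wz [iz z0]; split=> [s|]; rewrite push_comp; try exact: kbox0_cont.
  rewrite -[in RHS](iz s) push_comp; last exact/cts_push/col_perm_continuous.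
  by congr (push _ z); apply/funext => x /=; rewrite kbox_perm.
have -> : symq \o K^~ 0 = (qbox p D)^~ 0 \o symq.
  by apply/funext => x /=; rewrite -qboxE.
rewrite -push_comp; last exact/cts_push/symq_continuous.
by rewrite z0 linear0.
Qed.

(** After contraction every simplex takes values in the finite orbit of [p] and is therefore
    constant. The orbit sum and the image in the quotient then see the same single coefficient. *)
Lemma kbox0_orbit n (z : chain R rat E n) : inC W z ->
  exists a : rat, \sum_(s : 'S_m) push (col_perm s) (push (K^~ 0) z) =
      a *: \sum_(s : 'S_m) mksing (fun=> col_perm s p) /\
    push symq (push (K^~ 0) z) = a *: mksing (fun=> symq p).
Proof.
move=> Wz; have Wz' := suppI Wz (kbox0_cont Wz).
apply: (freegs_ind (P := fun z => exists a : rat,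
   \sum_(s : 'S_m) push (col_perm s) (push (K^~ 0) z) =
      a *: \sum_(s : 'S_m) mksing (fun=> col_perm s p) /\
    push symq (push (K^~ 0) z) = a *: mksing (fun=> symq p)) Wz').
  exists 0; rewrite !scale0r; split; last by rewrite !linear0.
  by rewrite big1 // => s _; rewrite !linear0.
move=> a s c [Ws sc] [b [E1 E2]]; exists (a + b).
have [t tE] : exists t : 'S_m, K^~ 0 \o s = fun=> col_perm t p.
  have [t tE] := kbox0 Ddis (Ws (vertex R (ord0 : 'I_n.+1))).
  exists t; apply/funext => x /=; rewrite -tE.
  apply: (@simplex_const R n E 'S_m (fun t => col_perm t p) (K^~ 0 \o s)) => //.
    exact: mx_hausdorff.
  by move=> u; exact: (kbox0 Ddis (Ws u)).
have sE : push (K^~ 0) (<< s >> : chain R rat E n) = mksing (fun=> col_perm t p).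
  by rewrite pushU tE.
split.
  rewrite scalerDl -E1 scaler_sumr.
  under eq_bigr do rewrite linearP linearP /= sE.
  rewrite big_split /=; congr (_ + _); rewrite -!scaler_sumr; congr (_ *: _).
  rewrite (reindex_inj (mulIg t^-1%g)) /=; apply: eq_bigr => u _.
  by rewrite push_mksing_cst -col_permM mulgKV.
rewrite !linearP /= sE push_mksing_cst symq_perm E2.
by rewrite scalerDl.
Qed.

(** Vanishing in the quotient makes that coefficient zero, while for an invariant chain the orbit
    sum is [m!] times the chain; characteristic zero concludes. *)
Lemma kbox0_eq0 n (z : chain R rat E n) : inC W z -> inv0 z -> push (K^~ 0) z = 0.
Proof.
move=> Wz iz; have [i1 y0] := kbox0_inv Wz iz.
have [a [E1 E2]] := kbox0_orbit Wz.
have a0 : a = 0.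
  apply/eqP; move/eqP: E2; rewrite y0 eq_sym scaler_eq0.
  by rewrite (negPf (mksing_cst_neq0 _ _)) orbF.
move: E1; under eq_bigr do rewrite i1.
rewrite a0 scale0r sumr_const card_Sn -scaler_nat => /eqP.
rewrite scaler_eq0 pnatr_eq0 => /orP[|/eqP//].
by rewrite eqn0Ngt fact_gt0.
Qed.

Lemma inv0_acyclic n (z : chain R rat E n) :
  inC W z -> inv0 z -> boundary z = 0 ->
  exists e : chain R rat E n.+1, [/\ inC W e, inv0 e & z = boundary e].
Proof.
move=> Wz iz z0; have Ka := kbox_adm Ddis Wz.
exists (prism K z); split.
- by apply: prism_supp Wz => x a Wx _; exact: kbox_sbox.
- have [i1 s0] := iz; split=> [s|].
    rewrite (@prism_natural R E E (col_perm s) K K) ?i1 //.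
      exact: col_perm_continuous.
    by move=> x a; rewrite kbox_perm.
  rewrite (@prism_natural R E _ symq K (qbox p D)) ?s0 ?linear0 //.
    exact: symq_continuous.
  exact: qboxE.
- rewrite prismE // kbox0_eq0 // z0.
  have -> : push (K^~ 1) z = z.
    by rewrite -[RHS]push_id; apply: (push_ext Wz) => x; exact: kbox1.
  have -> : prism' K (0 : chain R rat E n.-1) = 0 by case: (n) => //= k; rewrite linear0.
  by rewrite !subr0.
Qed.

End Local.
End InvariantChains.

(** * Rational homology of the quotient *)

Section QuotientSurjective.
Variables (R : realType) (d : nat) (X : topologicalType) (m : nat).
Local Notation E := 'rV[X]_m.
Local Notation S := (Defs.Sym X m).
Local Notation symq := (@symq X m).
Hypothesis hX : hausdorff_space X.
Hypothesis eX : forall x : X, euclidean_at R d x.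

Lemma separated_discs (p : E) (O : set E) : nbhs p O ->
  exists (N : X -> set X) (D : forall y, disc R d y (N y)),
    (forall a b x, dset (D (p ord0 a)) x -> dset (D (p ord0 b)) x ->
       p ord0 a = p ord0 b) /\ boxW p D `<=` O.
Proof.
move=> Op; have [N0 nN0 N0O] := box_nbhs Op.
have h (ab : 'I_m * 'I_m) : exists AB : set X * set X,
    [/\ nbhs (p ord0 ab.1) AB.1, nbhs (p ord0 ab.2) AB.2 &
        p ord0 ab.1 <> p ord0 ab.2 -> AB.1 `&` AB.2 = set0].
  have [e|/eqP ne] := pselect (p ord0 ab.1 = p ord0 ab.2).
    by exists (setT, setT); split=> //; exact: filterT.
  have := hX; rewrite open_hausdorff => /(_ _ _ ne)[[A B] /= [Ap Bp] [Ao Bo /eqP AB]].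
  rewrite !inE in Ap Bp.
  by exists (A, B); split=> //; apply: open_nbhs_nbhs; split.
have [F FP] := choice h.
pose N y := N0 y `&` [set z | forall ab,
  (p ord0 ab.1 = y -> (F ab).1 z) /\ (p ord0 ab.2 = y -> (F ab).2 z)].
have nN y : nbhs y (N y).
  apply: filterI => //.
  have : forall ab, nbhs y [set z |
      (p ord0 ab.1 = y -> (F ab).1 z) /\ (p ord0 ab.2 = y -> (F ab).2 z)].
    move=> ab; have [F1 F2 _] := FP ab; apply: filterI.
      have [e|ne] := pselect (p ord0 ab.1 = y); last by apply: filterS filterT => z _ /ne.
      by rewrite -e; apply: filterS F1.
    have [e|ne] := pselect (p ord0 ab.2 = y); last by apply: filterS filterT => z _ /ne.
    by rewrite -e; apply: filterS F2.
  by move/filter_forall.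
have [D _] := discs_exist eX nN.
exists N, D; split.
  move=> a b x /d_sub[_ /(_ (a, b))[/(_ erefl) Fa _]] /d_sub[_ /(_ (a, b))[_ /(_ erefl) Fb]].
  apply: contrapT => ne; have [_ _ /(_ ne) F0] := FP (a, b).
  by have : ((F (a, b)).1 `&` (F (a, b)).2) x by []; rewrite F0.
by move=> x Bx; apply: N0O => a; have [] := d_sub (Bx a).
Qed.

Lemma liftable_vanish (W : set S) k (z : chain R rat S k) : open W ->
  inC W z -> liftable (boundary z) ->
  exists2 e : chain R rat S k.+1, inC W e & liftable (z - boundary e).
Proof.
move=> Wo Wz lz.
pose V := fun n (_ : chain R rat S n) => True.
pose L := fun n (c : chain R rat S n) => liftable c.
have idc : continuous (id : S -> S) by move=> x; exact: cvg_id.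
have sc := @symq_continuous X m.
have Lbd n (c : chain R rat S n) : L n c -> L n.-1 (boundary c).
  by move=> [c' <-]; exists (boundary c'); rewrite push_bd //; exact: cts_push.
have Lsd n (c : chain R rat S n) : L n c -> L n (sd c).
  by move=> [c' <-]; exists (sd c'); rewrite push_sd.
have Lhsd n (c : chain R rat S n) : L n c -> L n.+1 (hsd c).
  by move=> [c' <-]; exists (hsd c'); rewrite push_hsd.
have split n (W1 W2 : set S) (c : chain R rat S n) : open W1 -> open W2 -> V n c ->
    suppt (fun s : singular R S n => small (id @^-1` W1) (id @^-1` W2) s) c ->
    exists c1 c2, [/\ c = c1 + c2, V n c1 /\ inC (id @^-1` W1) c1,
      V n c2 /\ inC (id @^-1` W2) c2 & L n c -> L n c1 /\ L n c2].
  move=> _ _ _ cs; pose Q (s : singular R S n) := forall x, W1 (s x).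
  exists (restr Q c), (c - restr Q c); split; [|split=> //|split=> //|].
  - by rewrite addrC subrK.
  - by have := supp_restr (P := Q) cs; apply: sub_supp => s [].
  - by have := supp_restrC (P := Q) cs; apply: sub_supp => s [[]].
  - move=> Lc; suff L1 : L n (restr Q c).
      by split=> //; apply: submodB => //; exact: liftable_submod.
    move: Lc => [c' <-].
    exists (restr (fun s : singular R E n => forall x, W1 (symq (s x))) c').
    by rewrite -(restr_push (Q' := Q)) // => s s' ss'; split=> h x; have := h x; rewrite -(ss' x).
have [|_ [e [[_ We] Le]]] := @local_to_global_vanish R S S id V L idc (fun n => conj I (fun _ _ _ _ _ => I))
  (@liftable_submod R X m) (fun _ _ _ => I) Lbd (fun _ _ _ => I) Lsd (fun _ _ _ => I) Lhsd
  split (sym_hausdorff hX) W k Wo _ z (conj (conj I Wz) lz); last by exists e.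
move=> i O q _ Oo OW; have [p <-] := symq_ex q => Op.
have [N [D [Ddis DO]]] := @separated_discs p (symq @^-1` O) (sc p _ (open_nbhs_nbhs (conj Oo Op))).
have sO : sbox p D `<=` O by move=> _ [x Bx <-]; exact: DO.
exists (sbox p D); split=> //; [exact: sbox_open | exact: sbox_p |].
apply/fgbT => c [[_ Wc] Lc]; have [e We Le] := liftable_acyclic Ddis Wc Lc.
split; first by split=> //; exact: inC_sub Wc.
by exists e; split=> //; split=> //; exact: inC_sub We.
Qed.

Lemma inv0_vanish (W : set S) k (z : chain R rat E k) : open W ->
  inC (symq @^-1` W) z -> inv0 z -> boundary z = 0 ->
  exists e : chain R rat E k.+1, [/\ inC (symq @^-1` W) e, inv0 e & z = boundary e].
Proof.
move=> Wo Wz iz z0.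
pose V := fun n (c : chain R rat E n) => inv0 c.
pose L := fun n (c : chain R rat E n) => c = 0.
have sc := @symq_continuous X m.
have pc s := @col_perm_continuous X m s.
have Vbd n (c : chain R rat E n) : V n c -> V n.-1 (boundary c).
  move=> [ic c0]; split=> [s|]; rewrite -push_bd ?ic ?c0 ?linear0 //; exact: cts_push.
have Vsd n (c : chain R rat E n) : V n c -> V n (sd c).
  by move=> [ic c0]; split=> [s|]; rewrite push_sd ?ic ?c0 ?linear0.
have Vhsd n (c : chain R rat E n) : V n c -> V n.+1 (hsd c).
  by move=> [ic c0]; split=> [s|]; rewrite push_hsd ?ic ?c0 ?linear0.
have Lsub n : submod (L n).
  by rewrite /L; split=> // a x y -> ->; rewrite scaler0 addr0.
have split n (W1 W2 : set S) (c : chain R rat E n) : open W1 -> open W2 -> V n c ->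
    suppt (fun s : singular R E n => small (symq @^-1` W1) (symq @^-1` W2) s) c ->
    exists c1 c2, [/\ c = c1 + c2, V n c1 /\ inC (symq @^-1` W1) c1,
      V n c2 /\ inC (symq @^-1` W2) c2 & L n c -> L n c1 /\ L n c2].
  move=> _ _ Vc cs; pose Q (s : singular R E n) := forall x, W1 (symq (s x)).
  have V1 : V n (restr Q c).
    have [ic c0] := Vc; split=> [s|].
      rewrite -(restr_push (Q' := Q)) ?ic //.
      by move=> u u' uu'; split=> h x; have := h x; rewrite -(uu' x) /= symq_perm.
    rewrite -(restr_push (Q' := fun s : singular R S n => forall x, W1 (s x))) ?c0 ?linear0 //.
    by move=> u u' uu'; split=> h x; have := h x; rewrite -(uu' x).
  exists (restr Q c), (c - restr Q c); split.
  - by rewrite addrC subrK.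
  - by split=> //; have := supp_restr (P := Q) cs; apply: sub_supp => s [].
  - split; first by apply: submodB => //; exact: inv0_submod.
    by have := supp_restrC (P := Q) cs; apply: sub_supp => s [[]].
  - by move=> ->; rewrite /L linear0 subr0.
have [|_ [e [[ie We] /eqP]]] := @local_to_global_vanish R E S symq V L sc (@inv0_submod R X m)
  Lsub Vbd (fun n c (c0 : c = 0) => etrans (congr1 _ c0) (linear0 _)) Vsd
  (fun n c (c0 : c = 0) => etrans (congr1 _ c0) (linear0 _)) Vhsd
  (fun n c (c0 : c = 0) => etrans (congr1 _ c0) (linear0 _))
  split (sym_hausdorff hX) W k Wo _ z (conj (conj iz Wz) z0); last first.
  by rewrite subr_eq0 => /eqP ze; exists e.
move=> i O q _ Oo OW; have [p <-] := symq_ex q => Op.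
have [N [D [Ddis DO]]] := @separated_discs p (symq @^-1` O) (sc p _ (open_nbhs_nbhs (conj Oo Op))).
have sO : sbox p D `<=` O by move=> _ [x Bx <-]; exact: DO.
exists (sbox p D); split=> //; [exact: sbox_open | exact: sbox_p |].
apply/fgbT => c [[ic Wc] c0]; have [e [We ie ce]] := inv0_acyclic Ddis hX Wc ic c0.
split; first by split=> //; apply: inC_sub Wc => x; exact: sO.
exists e; split; first by split=> //; apply: inC_sub We => x; exact: sO.
by rewrite /L -ce subrr.
Qed.

(** Averaging over the group does not change the image in the quotient; this is the division by
    [m!]. *)
Lemma average n (c : chain R rat E n) (A : set E) : inC A c ->
  (forall s x, A x -> A (col_perm s x)) ->
  exists c', [/\ inC A c', invariant c' & push symq c' = push symq c].
Proof.
move=> Ac sA; have pc s := @col_perm_continuous X m s.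
exists ((m`!%:R)^-1 *: \sum_(s : 'S_m) push (col_perm s) c); split.
- by apply: suppZ; apply: supp_sum => s _; apply: push_supp Ac => x; exact: sA.
- move=> t; rewrite linearZ linear_sum /=; congr (_ *: _).
  rewrite [RHS](reindex_inj (mulgI t)) /=; apply: eq_bigr => s _.
  rewrite push_comp; last exact: cts_push.
  by congr (push _ c); apply/funext => x /=; rewrite col_permM.
- rewrite linearZ linear_sum /=.
  rewrite (eq_bigr (fun=> push symq c)); last first.
    move=> s _; rewrite push_comp; last exact: cts_push.
    by congr (push _ c); apply/funext => x /=; rewrite symq_perm.
  rewrite sumr_const card_Sn -scaler_nat scalerA mulVf ?scale1r //.
  by rewrite pnatr_eq0 eqn0Ngt fact_gt0.
Qed.

(* Over Q, the homology of the preimage of W surjects onto that of W: modulo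
   boundaries a cycle is a combination of liftable simplices, and the boundary
   of an invariant lift is an invariant cycle which dies in the quotient. *)
Lemma lift_cycle (W : set S) k (z : chain R rat S k) : open W -> rcyc W set0 z ->
  exists c : chain R rat E k, rcyc (symq @^-1` W) set0 c /\ rbnd W set0 (z - push symq c).
Proof.
move=> Wo [Wz z0]; have zb : boundary z = 0 by exact: inC0.
have [|e We le] := liftable_vanish Wo Wz.
  by rewrite zb; have [] := @liftable_submod R X m k.-1.
have We' : inC W (z - boundary e) := suppB Wz (inC_bd We).
have [c0 Wc0 c0E] := restrict_lift We' le.
have [|c1 [Wc1 ic1 c1E]] := average Wc0.
  by move=> s x; rewrite /= symq_perm.
have sc := @symq_continuous X m.
have pc s := @col_perm_continuous X m s.
have bb : boundary (boundary e) = 0 by exact: boundary_boundary.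
have ib : inv0 (boundary c1).
  split=> [s|]; rewrite -push_bd ?ic1 //; try exact: cts_push.
  by rewrite c1E c0E boundaryB zb bb subr0.
have [e' [We1 [ie' e'0] e'E]] : exists e' : chain R rat E k,
    [/\ inC (symq @^-1` W) e', inv0 e' & boundary c1 = boundary e'].
  case: k z e c0 c1 Wz z0 zb We le We' Wc0 c0E Wc1 ic1 c1E bb ib => [|k] z e c0 c1 Wz z0 zb We le We' Wc0 c0E Wc1 ic1 c1E bb ib.
    exists 0; split; [exact: supp0 | by have [] := @inv0_submod R X m 0 | by []].
  have bc : boundary (boundary c1) = 0 by exact: boundary_boundary.
  exact: (@inv0_vanish W k (boundary c1) Wo (inC_bd Wc1) ib bc).
exists (c1 - e'); split.
  split; first exact: suppB.
  by rewrite boundaryB e'E subrr; exact: supp0.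
have -> : push symq (c1 - e') = z - boundary e.
  by rewrite linearB /= e'0 subr0 c1E.
by rewrite subKr; exact: rbnd_bd.
Qed.

End QuotientSurjective.

(** * Closures of strata *)

Section MultiplicityLists.
Variable T : eqType.
Implicit Types s t : seq T.

Definition mult_seq s := [seq count_mem x s | x <- undup s].

Lemma perm_mult_seq s t : perm_eq s t -> perm_eq (mult_seq s) (mult_seq t).
Proof.
move=> st; have -> : mult_seq s = [seq count_mem x t | x <- undup s].
  by apply: eq_map => x; have /seq.permP := st; apply.
apply: perm_map; apply: uniq_perm; try exact: undup_uniq.
by move=> x; rewrite !mem_undup (perm_mem st).
Qed.

Lemma mult_seq_cons x s : x \notin s -> mult_seq (x :: s) = 1%N :: mult_seq s.
Proof.
move=> xs; rewrite /mult_seq /= (negPf xs) /= eqxx (count_memPn xs) addn0; congr cons.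
apply/eq_in_map => y; rewrite mem_undup => ys.
by have [e|] := eqVneq x y; [rewrite e ys in xs | rewrite add0n].
Qed.
End MultiplicityLists.

(** Multiplicities depend only on which entries coincide, so tuples with the same pattern lie in the
    same stratum. *)
Lemma mult_seq_map (I T U : eqType) (u : I -> T) (v : I -> U) (s : seq I) :
  (forall a b, u a = u b <-> v a = v b) -> mult_seq (map u s) = mult_seq (map v s).
Proof.
move=> uv; have uvE a b : (u a == u b) = (v a == v b).
  by apply/eqP/eqP => /uv.
(* Duplicates are removed on the level of indices, by a rule that [u] and [v] share. *)
pose fix J s := if s is a :: s' then
  if has (fun b => u a == u b) s' then J s' else a :: J s' else [::].
have Ju t : undup (map u t) = map u (J t).
  elim: t => //= a t ->; have -> : (u a \in map u t) = has (fun b => u a == u b) t.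
    by rewrite -has_pred1 has_map; apply: eq_has => b /=; rewrite eq_sym.
  by case: has.
have Jv t : undup (map v t) = map v (J t).
  elim: t => //= a t ->; have -> : (v a \in map v t) = has (fun b => u a == u b) t.
    by rewrite -has_pred1 has_map; apply: eq_has => b /=; rewrite eq_sym uvE.
  by case: has.
rewrite /mult_seq Ju Jv -!map_comp; apply: eq_map => a /=; rewrite !count_map.
by apply: eq_count => b /=; rewrite uvE.
Qed.

Section Patterns.
Variables (X : topologicalType) (m : nat).
Local Notation E := 'rV[X]_m.
Implicit Types (u : E) (P : {ffun 'I_m -> 'I_m}).

Definition pattern_of P u := forall a b, u ord0 a = u ord0 b <-> P a = P b.

(** The finitely many coincidence patterns of tuples in the stratum. Their diagonals together form
    the preimage of its closure ([sU_arr]). *)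
Definition patterns (mu : seq nat) : seq {ffun 'I_m -> 'I_m} :=
  [seq P <- enum {ffun 'I_m -> 'I_m} |
     `[< exists2 u : E, perm_eq (multiplicities u) mu & pattern_of P u >]].

Lemma patternsP P mu :
  reflect (exists2 u : E, perm_eq (multiplicities u) mu & pattern_of P u)
    (P \in patterns mu).
Proof. by rewrite mem_filter mem_enum andbT; exact: asboolP. Qed.

Lemma pattern_ex u : exists P, pattern_of P u.
Proof.
exists [ffun a => odflt a [pick b | u ord0 b == u ord0 a]] => a b; rewrite !ffunE.
split=> [->|]; first by case: pickP => // /(_ b); rewrite eqxx.
case: pickP => [c /eqP ca|/(_ a)]; last by rewrite eqxx.
by case: pickP => [c' /eqP cb /= cc|/(_ b)]; rewrite ?eqxx // -ca -cb cc.
Qed.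

Lemma multiplicities_map u : multiplicities u = mult_seq [seq u ord0 a | a <- enum 'I_m].
Proof. by []. Qed.

Lemma multiplicities_perm (s : 'S_m) u :
  perm_eq (multiplicities (col_perm s u)) (multiplicities u).
Proof.
apply: perm_mult_seq.
rewrite (eq_map (g := (fun a => u ord0 a) \o s)); last by move=> a; rewrite mxE.
rewrite map_comp; apply: perm_map; apply: uniq_perm.
- by rewrite map_inj_uniq ?enum_uniq //; exact: perm_inj.
- exact: enum_uniq.
- move=> a; rewrite mem_enum; apply/mapP; exists (s^-1%g a); first exact: mem_enum.
  by rewrite permKV.
Qed.

Lemma arr_perm mu (s : 'S_m) (x : E) : @arr X m (patterns mu) x -> @arr X m (patterns mu) (col_perm s x).
Proof.
move=> h P /patternsP[u um uP] dP.
apply: (h [ffun a => P (s^-1%g a)]); last first.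
  by move=> a b; rewrite !ffunE => /dP; rewrite !mxE !permKV.
apply/patternsP; exists (col_perm s^-1%g u).
  exact: perm_trans (multiplicities_perm _ _) um.
by move=> a b; rewrite !mxE !ffunE; exact: uP.
Qed.

Lemma arr_symq mu (x y : E) : symq x = symq y -> @arr X m (patterns mu) x -> @arr X m (patterns mu) y.
Proof. by move=> /symqP[s ->]; exact: arr_perm. Qed.

End Patterns.

Section StratumClosure.
Variables (R : realType) (d : nat) (X : topologicalType).
Hypothesis hX : hausdorff_space X.
Hypothesis eX : forall x : X, euclidean_at R d x.
Hypothesis d0 : (0 < d)%N.

(** A disc of positive dimension contains infinitely many points, here the integer multiples of one
    coordinate vector. *)
Lemma avoid_points (y : X) (N : set X) (L : seq X) : nbhs y N ->
  exists2 x, N x & x \notin L.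
Proof.
move=> Ny; have [D] := disc_exists (eX y) Ny.
pose f (k : nat) := dof D (k%:R *: delta_mx ord0 (Ordinal d0)).
have fI : injective f.
  move=> k l /(congr1 (dto D)); rewrite !d_ofK => /rowP/(_ (Ordinal d0)).
  by rewrite !mxE !eqxx !mulr1 => /eqP; rewrite eqr_nat => /eqP.
have [/allP h|/allPn[x /mapP[k _ ->] xL]] :=
    boolP (all [in L] (map f (iota 0 (size L).+1))); last first.
  by exists (f k) => //; exact: (d_sub (d_of D _)).
have u : uniq (map f (iota 0 (size L).+1)) by rewrite map_inj_uniq // iota_uniq.
by have := uniq_leq_size u h; rewrite size_map size_iota ltnn.
Qed.

Lemma distinct_points (I : finType) (y : I -> X) (N : I -> set X) :
  (forall i, nbhs (y i) (N i)) ->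
  exists h : I -> X, injective h /\ forall i, N i (h i).
Proof.
move=> yN; suff [h hN hI] : exists2 h : I -> X, (forall i, i \in enum I -> N i (h i)) &
    {in enum I &, injective h}.
  by exists h; split=> [i j|i]; [apply: hI | apply: hN]; rewrite mem_enum.
elim: (enum I) => [|a s [h hN hI]]; first by exists y.
have [x Nx xs] := avoid_points (map h s) (yN a).
have [as_|as_] := boolP (a \in s).
  have E i : (i \in a :: s) = (i \in s) by rewrite inE; case: eqP => // ->; rewrite as_.
  by exists h => [i|i j]; rewrite !E; [exact: hN | exact: hI].
have sa i : i \in s -> (i == a) = false.
  by move=> is_; apply/eqP => ia; rewrite -ia is_ in as_.
have hx i : i \in s -> h i <> x.
  by move=> is_ hix; move/negP: xs; apply; rewrite -hix; exact: map_f.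
exists (fun i => if i == a then x else h i).
  move=> i; rewrite inE => /orP[/eqP->|is_]; first by rewrite eqxx.
  by rewrite sa //; exact: hN.
move=> i j; rewrite !inE => /orP[/eqP->|is_] /orP[/eqP->|js] //; rewrite ?eqxx ?sa //.
- by move=> /esym/hx.
- by move=> /hx.
- exact: hI.
Qed.

Section Fixed.
Variables (m : nat) (mu : seq nat).
Local Notation E := 'rV[X]_m.
Local Notation symq := (@symq X m).

Definition sU : set (Defs.Sym X m) := ~` closure (@stratum X m mu).

(** Perturb the common values on the blocks of [P] to distinct nearby points; the perturbed tuple
    has exactly the pattern [P]. *)
Lemma diag_stratum P (y : E) : P \in patterns X m mu -> diag P y ->
  closure (@stratum X m mu) (symq y).
Proof.
move=> /patternsP[u um uP] dP B nB.
have nB' : nbhs y (symq @^-1` B) := symq_continuous nB.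
have [N Ny NB] := box_nbhs nB'.
(* The common value of [y] on the block labelled [k]; labels that do not occur receive an arbitrary
   value. *)
pose z (k : 'I_m) := if [pick a | P a == k] is Some a then y ord0 a else y ord0 k.
have zP a : z (P a) = y ord0 a.
  rewrite /z; case: pickP => [b /eqP|/(_ a)]; last by rewrite eqxx.
  exact: dP.
have [h [hI hN]] := @distinct_points 'I_m z (N \o z) (fun k => Ny (z k)).
pose v : E := \row_a h (P a).
exists (symq v); split; last by apply: NB => a; rewrite mxE -zP; exact: hN.
exists v => //=; have -> // : multiplicities v = multiplicities u.
by apply: mult_seq_map => a b; rewrite !mxE; split=> [/hI/uP//|/uP ->].
Qed.

(** The complement of the finitely many diagonals is open and invariant, so its image is an open set
    that misses the stratum. *)
Lemma stratum_diag (y : E) : closure (@stratum X m mu) (symq y) ->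
  exists2 P, P \in patterns X m mu & diag P y.
Proof.
move=> cl; apply: contrapT => nP.
have ay : @arr X _ (patterns X m mu) y by move=> P PA dP; apply: nP; exists P.
pose Z := symq @` @arr X _ (patterns X m mu).
have Zo : open Z by apply: symq_open; exact: arr_open.
have [|_ [[u um <-] [x ax /esym xu]]] := cl Z.
  by apply: open_nbhs_nbhs; split=> //; exists y.
have {}ax := arr_symq (esym xu) ax.
have [P uP] := pattern_ex u.
apply: (ax P); first by apply/patternsP; exists u.
by move=> a b; exact: (uP a b).2.
Qed.

Lemma sU_arr : symq @^-1` sU = @arr X _ (patterns X m mu).
Proof.
apply/seteqP; split=> x.
  by move=> nx P PA dP; apply: nx; exact: diag_stratum dP.
by move=> ax /stratum_diag[P PA dP]; exact: (ax P PA).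
Qed.

Lemma sU_open : open sU.
Proof. by apply: open_sym; rewrite sU_arr; exact: arr_open. Qed.

End Fixed.

(** * Adding and forgetting a point *)

Section AddForget.
Variables (m : nat) (mu mu' : seq nat).
Hypothesis mu1 : perm_eq mu (1%N :: mu').
Local Notation E := 'rV[X]_m.
Local Notation E1 := 'rV[X]_m.+1.

Lemma multiplicities_col' (u : E1) s : (forall a, u ord0 (lift s a) <> u ord0 s) ->
  perm_eq (multiplicities u) (1%N :: multiplicities (col' s u)).
Proof.
move=> us; rewrite !multiplicities_map -(mult_seq_cons (x := u ord0 s)); last first.
  by apply/mapP => -[a _]; rewrite mxE => /esym/us.
apply: perm_mult_seq.
have -> : u ord0 s :: [seq col' s u ord0 a | a <- enum 'I_m] =
    [seq u ord0 a | a <- s :: map (lift s) (enum 'I_m)].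
  by rewrite /= -map_comp; congr cons; apply: eq_map => a; rewrite mxE.
apply: perm_map; apply: uniq_perm; first exact: enum_uniq.
  rewrite /= map_inj_uniq ?enum_uniq ?andbT; last exact: lift_inj.
  by apply/mapP => -[a _ /eqP]; rewrite (negPf (neq_lift _ _)).
move=> a; rewrite mem_enum !inE; case: (unliftP s a) => [b ->|->]; last by rewrite eqxx.
by rewrite map_f ?mem_enum ?orbT.
Qed.

(** A tuple realising a pattern of [mu'] extends by a fresh point at [s] to one with multiplicities
    [mu]. The extended pattern imposes no equation on the s-th coordinate, so its diagonal already
    contains [x]. *)
Lemma arr_forget s (x : E1) : @arr X _ (patterns X m.+1 mu) x -> @arr X _ (patterns X m mu') (col' s x).
Proof.
move=> h P /patternsP[u um uP] dP.
have [z _ zu] := avoid_points [seq u ord0 a | a <- enum 'I_m] (@filterT _ (nbhs (x ord0 s)) _).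
pose v : E1 := \row_a oapp (u ord0) z (unlift s a).
have vs : v ord0 s = z by rewrite mxE unlift_none.
have vl a : v ord0 (lift s a) = u ord0 a by rewrite mxE liftK.
have uz a : u ord0 a <> z.
  by move=> e; move/negP: zu; apply; rewrite -e; apply/mapP; exists a; rewrite ?mem_enum.
have [Q vQ] := pattern_ex v.
apply: (h Q).
  apply/patternsP; exists v => //.
  have vsl a : v ord0 (lift s a) <> v ord0 s by rewrite vs vl.
  have vc := multiplicities_col' vsl.
  have vu : col' s v = u by apply/rowP => a; rewrite mxE vl.
  rewrite vu in vc; apply: (perm_trans vc); rewrite perm_sym.
  by apply: (perm_trans mu1); rewrite perm_cons perm_sym.
move=> a b /vQ; case: (unliftP s a) => [a' ->|->]; case: (unliftP s b) => [b' ->|->] //.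
- by rewrite !vl => /uP /dP; rewrite !mxE.
- by rewrite vs vl => /uz.
- by rewrite vs vl => /esym /uz.
Qed.

Variables (e1 : X -> X) (pt : X).
Hypothesis e1_inj : injective e1.
Hypothesis e1_pt : forall x, e1 x <> pt.

Definition addfirst (x : E) : E1 := \row_a oapp (fun b => e1 (x ord0 b)) pt (unlift ord0 a).

Lemma addfirst0 x : addfirst x ord0 ord0 = pt.
Proof. by rewrite mxE unlift_none. Qed.

Lemma addfirst_lift x a : addfirst x ord0 (lift ord0 a) = e1 (x ord0 a).
Proof. by rewrite mxE liftK. Qed.

(** The added [pt] differs from all other entries, so in any pattern whose diagonal is met the first
    index stands alone; dropping it gives a pattern of [mu'] met by [x]. *)
Lemma arr_addfirst x : @arr X _ (patterns X m mu') x -> @arr X _ (patterns X m.+1 mu) (addfirst x).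
Proof.
move=> h P /patternsP[u um uP] dP.
have u0 a : u ord0 (lift ord0 a) <> u ord0 ord0.
  by move=> /uP /dP; rewrite addfirst0 addfirst_lift; exact: e1_pt.
have [Q vQ] := pattern_ex (col' ord0 u).
apply: (h Q).
  apply/patternsP; exists (col' ord0 u) => //.
  rewrite -(perm_cons 1%N) perm_sym -(permPl mu1) perm_sym.
  by apply: perm_trans um; rewrite perm_sym; exact: multiplicities_col'.
by move=> a b /vQ; rewrite !mxE => /uP /dP; rewrite !addfirst_lift => /e1_inj.
Qed.

Lemma addfirst_perm (s : 'S_m) x :
  addfirst (col_perm s x) = col_perm (lift_perm ord0 ord0 s) (addfirst x).
Proof.
apply/rowP => a; rewrite [RHS]mxE; case: (unliftP ord0 a) => [b ->|->].
  by rewrite lift_perm_lift !addfirst_lift mxE.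
by rewrite lift_perm_id !addfirst0.
Qed.

Definition addq (q : Defs.Sym X m) : Defs.Sym X m.+1 := symq (addfirst (repr q)).

Lemma addqE x : addq (symq x) = symq (addfirst x).
Proof.
have /symqP[s rE] : symq x = symq (repr (symq x)) by apply/esym; exact: reprK.
by rewrite /addq rE addfirst_perm symq_perm.
Qed.

Lemma addq_continuous : continuous e1 -> continuous addq.
Proof.
move=> ec; apply/continuousP => B Bo; apply: open_sym.
have -> : @symq X m @^-1` (addq @^-1` B) = addfirst @^-1` (@symq X m.+1 @^-1` B).
  by apply/seteqP; split=> x /=; rewrite addqE.
have ac : continuous addfirst.
  apply: mx_continuous => i a; rewrite (ord1 i) {i}.
  case: (unliftP ord0 a) => [b ->|->].
    rewrite (_ : (fun _ => _) = fun x : E => e1 (x ord0 b)); last first.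
      by apply/funext => x; rewrite addfirst_lift.
    by move=> x; exact: (continuous_comp (@mx_coord_continuous X 1 m ord0 b x) (ec _)).
  rewrite (_ : (fun _ => _) = fun=> pt); first exact: cst_continuous.
  by apply/funext => x; rewrite addfirst0.
apply: open_comp; first by move=> x _; exact: ac.
by apply: open_comp => // x _; exact: symq_continuous.
Qed.

End AddForget.
End StratumClosure.

(** * Isotopies into the interior *)

Section PushVector.
Variables (R : realType) (d : nat) (v0 : 'rV[R]_d) (eps : R) (i0 : 'I_d).
Implicit Type v w : 'rV[R]_d.

Definition l1 v := \sum_i `|v ord0 i - v0 ord0 i|.
Definition tent v := Num.max 0 (eps - l1 v).
Definition shift (s : R) v : 'rV[R]_d := v + s *: delta_mx ord0 i0.
(** [tent] changes by at most the length of a shift; half of it is therefore a displacement that is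
    a strict contraction, which makes the push injective and keeps it in the ball. *)
Definition pushv (s : R) v : 'rV[R]_d := shift (s * (tent v / 2)) v.

Lemma l1_continuous : continuous l1.
Proof.
apply: (@continuous_sumR R _ _ _ (fun i (v : 'rV[R]_d) => `|v ord0 i - v0 ord0 i|)) => i v.
apply: (@continuous_comp _ _ _ (fun w : 'rV[R]_d => w ord0 i - v0 ord0 i)
  (fun x : R => `|x|)); last exact: norm_continuous.
exact: (cvgB (@mx_coord_continuous R 1 d ord0 i v) (cvg_cst _)).
Qed.

Lemma tent_continuous : continuous tent.
Proof.
move=> v; apply: (@continuous_comp _ _ _ (fun w => eps - l1 w) (fun a => Num.max 0 a)).
  exact: (cvgB (cvg_cst _) (@l1_continuous v)).
by apply: continuous_max; [exact: cvg_cst | exact: cvg_id].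
Qed.

Lemma l1_coord v i : `|v ord0 i - v0 ord0 i| <= l1 v.
Proof. by rewrite /l1 (bigD1 i) //= lerDl sumr_ge0. Qed.

Lemma l1_shift s v : l1 (shift s v) <= l1 v + `|s|.
Proof.
rewrite /l1 (bigD1 i0) //= [in leRHS](bigD1 i0) //= [leRHS]addrAC.
apply: lerD; last first.
  apply: ler_sum => i /negPf ii; rewrite !mxE eqxx /= ii mulr0 addr0.
  exact: lexx.
by rewrite !mxE !eqxx mulr1 addrAC ler_normD.
Qed.

Lemma tent_ge0 v : 0 <= tent v.
Proof. by rewrite /tent le_max lexx. Qed.

Lemma tent_shift_le s v : tent v <= tent (shift s v) + `|s|.
Proof.
have h := l1_shift s v; have h1 := tent_ge0 (shift s v).
rewrite /tent ge_max; apply/andP; split; first by rewrite addr_ge0.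
rewrite -lerBlDr le_max; apply/orP; right.
by rewrite -addrA lerD2l -opprD lerN2.
Qed.

Lemma shiftD s s' v : shift s (shift s' v) = shift (s' + s) v.
Proof. by rewrite /shift scalerDl addrA. Qed.

Lemma shift0 v : shift 0 v = v.
Proof. by rewrite /shift scale0r addr0. Qed.

Lemma tent_shift s v : `|tent v - tent (shift s v)| <= `|s|.
Proof.
rewrite ler_norml lerBlDl tent_shift_le andbT.
have := tent_shift_le (- s) (shift s v).
by rewrite shiftD subrr shift0 normrN => h; rewrite lerNl opprB lerBlDl.
Qed.

Lemma pushv_inj s : 0 <= s <= 1 -> injective (pushv s).
Proof.
move=> /andP[s0 s1] v w e.
pose r := s * (tent v / 2) - s * (tent w / 2).
have wE : w = shift r v.
  rewrite -[LHS](shift0 w) -(subrr (s * (tent w / 2))) -shiftD -/(pushv s w) -e.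
  by rewrite /pushv shiftD.
have := tent_shift r v; rewrite -wE /r -mulrBr -mulrBl => h.
have {}h : `|tent v - tent w| <= 0.
  have : `|s * ((tent v - tent w) / 2)| <= `|tent v - tent w| / 2.
    rewrite normrM (ger0_norm s0) normrM [`|2^-1|]ger0_norm ?invr_ge0 ?ler0n //.
    by apply: ler_piMl => //; rewrite divr_ge0.
  by move: h; set a := `|tent v - tent w|; set b := `|_| => h1 h2; lra.
move: h; rewrite normr_le0 subr_eq0 => /eqP bE.
by rewrite wE /r bE subrr shift0.
Qed.

Lemma pushv_coord s v : pushv s v ord0 i0 = v ord0 i0 + s * (tent v / 2).
Proof. by rewrite !mxE !eqxx mulr1. Qed.

Lemma pushv_fix s v : s * (tent v / 2) = 0 -> pushv s v = v.
Proof. by rewrite /pushv => ->; rewrite shift0. Qed.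

Lemma l1_pushv s v : 0 <= s <= 1 -> l1 v < eps -> l1 (pushv s v) < eps.
Proof.
move=> /andP[s0 s1] lv; apply: le_lt_trans (l1_shift _ _) _.
have bE : tent v = eps - l1 v by rewrite /tent; apply: max_r; rewrite subr_ge0 ltW.
rewrite normrM (ger0_norm s0) ger0_norm ?divr_ge0 ?tent_ge0 // bE.
have : s * ((eps - l1 v) / 2) <= (eps - l1 v) / 2.
  by rewrite ler_piMl // divr_ge0 // subr_ge0 ltW.
lra.
Qed.

Lemma pushv_continuous : continuous (fun q : R * 'rV[R]_d => pushv q.1 q.2).
Proof.
apply: mx_continuous => i j q; rewrite (ord1 i) {i}.
rewrite (_ : (fun _ => _) = fun q : R * 'rV[R]_d => q.2 ord0 j +
    q.1 * (tent q.2 / 2) * (delta_mx ord0 i0 : 'rV[R]_d) ord0 j); last first.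
  by apply/funext => q'; rewrite !mxE.
have c1 : {for q, continuous (fun q : R * 'rV[R]_d => q.2 ord0 j)}.
  apply: (@continuous_comp _ _ _ snd (fun v : 'rV[R]_d => v ord0 j)); first exact: cvg_snd.
  exact: mx_coord_continuous.
have c2 : {for q, continuous (fun q : R * 'rV[R]_d => tent q.2)}.
  apply: (@continuous_comp _ _ _ snd tent); first exact: cvg_snd.
  exact: tent_continuous.
exact: (cvgD c1 (cvgM (cvgM cvg_fst (cvgM c2 (cvg_cst _))) (cvg_cst _))).
Qed.

Lemma l1_ball_compact : compact [set v | l1 v <= eps /\ 0 <= v ord0 i0].
Proof.
apply: (@subclosed_compact _ _ [set v : 'rV[R]_d | forall i,
    `[v0 ord0 i - eps, v0 ord0 i + eps]%classic (v ord0 i)]).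
- apply: closedI.
    apply: (@closed_comp _ _ l1 [set x | x <= eps]); last exact: closed_le.
    by move=> v _; exact: l1_continuous.
  apply: (@closed_comp _ _ (fun v : 'rV[R]_d => v ord0 i0) [set x | 0 <= x]).
    by move=> v _; exact: mx_coord_continuous.
  exact: closed_ge.
- apply: (@rV_compact R d (fun i => `[v0 ord0 i - eps, v0 ord0 i + eps]%classic)) => i.
  exact: segment_compact.
- move=> v [lv _] i; rewrite /= in_itv /=.
  have := le_trans (l1_coord v i) lv; rewrite ler_norml.
  by rewrite lerBrDl [_ - v0 _ _ <= _]lerBlDl.
Qed.

End PushVector.

(** * Pushing a compact manifold into its interior *)

Section InteriorPush.
Variables (R : realType) (d : nat) (M : topologicalType) (i0 : 'I_d).
Hypothesis i00 : i0 = 0%N :> nat.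
Hypothesis hM : hausdorff_space M.
Local Notation int := (@manifold_interior R d M).

Lemma half_spaceE (v : 'rV[R]_d) : half_space v <-> 0 <= v ord0 i0.
Proof.
split=> [h|h i i_0]; first exact: h.
by have -> : i = i0 by apply: val_inj; rewrite /= i_0 i00.
Qed.

(** The last clause lets a point move only to interior points. Hence interior points stay interior
    and such isotopies can be composed without losing what was achieved. *)
Definition inward (F : M -> R -> M) :=
  [/\ continuous (fun q : M * R => F q.1 q.2), forall x, F x 0 = x,
      forall t, injective (F^~ t) & forall x t, F x t = x \/ int (F x t)].

(** [pushv] in a half-space chart, away from the wall, extended by the identity; [clamp] makes the
    statements hold for all real times. *)
Lemma local_push p : half_euclidean_at R d p ->
  exists2 F, inward F & \forall x \near p, int (F x 1).
Proof.
move=> [U [V [[Uo Up] Vo [h [k [hc kc hk kh]]]]]].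
pose VH := V `&` @half_space R d.
pose h' := ext_open (fun u : set_type U => \val (h u)) 0.
pose k' := ext_open (fun v : set_type VH => \val (k v)) p.
have h'c : forall y, U y -> {for y, continuous h'}.
  apply: ext_open_continuous => // u.
  exact: (continuous_comp (hc u) (@val_continuous _ VH _)).
have k'c : forall v, VH v -> forall N, nbhs (k' v) N -> nbhs v [set w | VH w -> N (k' w)].
  apply: ext_within_continuous => u.
  exact: (continuous_comp (kc u) (@val_continuous _ U _)).
have h'V y : U y -> VH (h' y) by move=> Uy; rewrite /h' (ext_open_in _ _ (mem_set Uy)); exact: set_valP.
have k'U v : VH v -> U (k' v) by move=> Vv; rewrite /k' (ext_open_in _ _ (mem_set Vv)); exact: set_valP.
have h'K y : U y -> k' (h' y) = y.
  by move=> Uy; rewrite /h' /k' (ext_open_in _ _ (mem_set Uy)) ext_openE hk.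
have k'K v : VH v -> h' (k' v) = v.
  by move=> Vv; rewrite /h' /k' (ext_open_in _ _ (mem_set Vv)) ext_openE kh.
have k'sub (A : set 'rV[R]_d) : A `<=` VH -> continuous (fun u : set_type A => k' (\val u)).
  move=> AV u N nN; have VHu := AV _ (set_valP u).
  have : nbhs u (\val @^-1` [set w | VH w -> N (k' w)]) := @val_continuous _ A u _ (k'c _ VHu _ nN).
  by apply: (@filterS _ (nbhs u) (nbhs_filter u)) => w wN; apply: wN; exact/AV/set_valP.
pose pos := [set v : 'rV[R]_d | 0 < v ord0 i0].
have poso : open pos.
  apply: (@open_comp _ _ (fun v : 'rV[R]_d => v ord0 i0) [set x | 0 < x]); last exact: open_gt.
  by move=> v _; exact: mx_coord_continuous.
have VpVH : V `&` pos `<=` VH.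
  by move=> v [Vv v0]; split=> //; apply/half_spaceE; exact: ltW.
(* Off the wall of the half-space the chart restricts to an ordinary Euclidean chart. *)
have k'int w : (V `&` pos) w -> int (k' w).
  move=> Vw; pose U' := U `&` (h' @^-1` pos); pose V' := V `&` pos.
  have f1 (u : set_type U') : h' (\val u) \in V'.
    by have [Uu pu] := set_valP u; apply/mem_set; split=> //; exact: (h'V _ Uu).1.
  have g1 (v : set_type V') : k' (\val v) \in U'.
    have Vv := set_valP v; have VHv := VpVH _ Vv.
    by apply/mem_set; split; [exact: k'U | rewrite /preimage /= k'K //; exact: Vv.2].
  exists U', V'; split.
  - split; last by have := VpVH _ Vw => VHw; split; [exact: k'U | rewrite /preimage /= k'K //; exact: Vw.2].
    apply: open_at => x [Ux px]; apply: filterI; first exact: open_nbhs_nbhs.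
    by apply: h'c => //; apply: open_nbhs_nbhs.
  - exact: openI.
  - exists (fun u => exist (fun v => v \in V') _ (f1 u)), (fun v => exist (fun u => u \in U') _ (g1 v)).
    split.
    + apply: sub_continuous => u /=.
      apply: (@continuous_comp _ _ _ (\val : set_type U' -> M) h'); first exact: val_continuous.
      exact: (h'c _ (set_valP u).1).
    + apply: sub_continuous; exact: k'sub.
    + by move=> u; apply: val_inj => /=; rewrite h'K //; exact: (set_valP u).1.
    + by move=> v; apply: val_inj => /=; rewrite k'K //; exact: VpVH (set_valP v).
pose v0 := h' p.
have [r r0 rP] : exists2 r : R, 0 < r &
    forall w : 'rV[R]_d, (forall i, `|w ord0 i - v0 ord0 i| < r) -> V w.
  by apply: mx_box_nbhs; apply: open_nbhs_nbhs; split=> //; exact: (h'V _ Up).1.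
pose eps := r / 2.
have eps0 : 0 < eps by rewrite divr_gt0.
have epsr : eps < r by rewrite /eps; lra.
have l1V v : l1 v0 v <= eps -> V v.
  move=> lv; apply: rP => i; apply: le_lt_trans epsr.
  exact: le_trans (l1_coord _ _ _) lv.
pose P s v := pushv v0 eps i0 s v.
have PV s v : 0 <= s <= 1 -> VH v -> VH (P s v).
  move=> s01 [Vv /half_spaceE v_0]; split; last first.
    apply/half_spaceE; rewrite pushv_coord addr_ge0 // mulr_ge0 ?divr_ge0 ?tent_ge0 //.
    by case/andP: s01.
  have [lt|ge] := ltP (l1 v0 v) eps; first by apply: l1V; apply: ltW; exact: l1_pushv.
  rewrite /P pushv_fix // /tent max_l ?mul0r ?mulr0 //.
  by rewrite subr_le0.
pose F x (t : R) := if `[< U x >] then k' (P (clamp t) (h' x)) else x.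
have FU x t : U x -> F x t = k' (P (clamp t) (h' x)) by move=> Ux; rewrite /F asboolT.
have FN x t : ~ U x -> F x t = x by move=> Ux; rewrite /F asboolF.
have FUU x t : U x -> U (F x t).
  by move=> Ux; rewrite FU //; apply/k'U/PV; [exact: clamp01 | exact: h'V].
have hF x t : U x -> h' (F x t) = P (clamp t) (h' x).
  by move=> Ux; rewrite FU // k'K //; apply: PV; [exact: clamp01 | exact: h'V].
have Ffix x t : clamp t * (tent v0 eps (h' x) / 2) = 0 -> F x t = x.
  have [Ux|Ux] := pselect (U x); last by rewrite FN.
  by move=> b0; rewrite FU // /P pushv_fix // h'K.
have Fint x t : U x -> 0 < clamp t * (tent v0 eps (h' x) / 2) -> int (F x t).
  move=> Ux b0; rewrite FU //; apply: k'int.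
  have [Vx /half_spaceE hx] := h'V _ Ux.
  have [VP _] := PV (clamp t) _ (clamp01 t) (h'V _ Ux).
  by split=> //; rewrite /pos /= pushv_coord ltr_wpDl.
exists F; first split.
- move=> [x t] /=.
  have [Ux|nUx] := pselect (U x).
    move=> N; change (nbhs (F x t) N -> nbhs (x, t) [set q : M * R | N (F q.1 q.2)]).
    rewrite FU // => nN.
    have VP : VH (P (clamp t) (h' x)) by apply: PV; [exact: clamp01 | exact: h'V].
    have nN' := k'c _ VP _ nN.
    have cP : {for (x, t), continuous (fun q : M * R => P (clamp q.2) (h' q.1))}.
      have c1 : {for (x, t), continuous (fun q : M * R => clamp q.2)}.
        by apply: (@continuous_comp _ _ _ snd (@clamp R)); [exact: cvg_snd | exact: clamp_continuous].
      have c2 : {for (x, t), continuous (fun q : M * R => h' q.1)}.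
        by apply: (@continuous_comp _ _ _ fst h'); [exact: cvg_fst | exact: h'c].
      apply: (@continuous_comp _ _ _ (fun q : M * R => (clamp q.2, h' q.1))
        (fun q : R * 'rV[R]_d => P q.1 q.2)); first exact: (cvg_pair c1 c2).
      exact: pushv_continuous.
    have nU : nbhs (x, t) (fst @^-1` U : set (M * R)).
      apply: (@cvg_fst _ _ (nbhs x) (nbhs t)); exact: open_nbhs_nbhs.
    apply: filterS (filterI nU (cP _ nN')) => q [Uq Nq]; rewrite /= FU //.
    by apply: Nq; apply: PV; [exact: clamp01 | exact: h'V].
  (* The support of the push is compact, hence closed in the Hausdorff space [M]; outside it [F] is
     constant in time, which gives continuity beyond the chart. *)
  pose C := range (fun u : set_type [set v : 'rV[R]_d | l1 v0 v <= eps /\ 0 <= v ord0 i0] =>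
    k' (\val u)).
  have BV : [set v : 'rV[R]_d | l1 v0 v <= eps /\ 0 <= v ord0 i0] `<=` VH.
    by move=> v [lv hv]; split; [exact: l1V | exact/half_spaceE].
  have cC : closed C.
    apply: compact_closed => //; apply: continuous_compact.
      by apply: continuous_subspaceT; exact: k'sub.
    by apply: set_type_compact; exact: l1_ball_compact.
  have xC : ~ C x by move=> [u _ ux]; apply: nUx; rewrite -ux; apply: k'U; exact: BV (set_valP u).
  have FC y s : ~ C y -> F y s = y.
    move=> yC; have [Uy|] := pselect (U y); last exact: FN.
    apply: Ffix; rewrite /tent max_l ?mul0r ?mulr0 // subr_le0 leNgt.
    apply/negP => /ltW lv; apply: yC.
    have yB : h' y \in [set v : 'rV[R]_d | l1 v0 v <= eps /\ 0 <= v ord0 i0].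
      by apply/mem_set; split=> //; apply/half_spaceE; exact: (h'V _ Uy).2.
    by exists (exist (fun w => w \in _) (h' y) yB) => //=; exact: h'K.
  move=> N; change (nbhs (F x t) N -> nbhs (x, t) [set q : M * R | N (F q.1 q.2)]).
  rewrite FC // => nN.
  have nC : nbhs (x, t) (fst @^-1` (N `&` ~` C) : set (M * R)).
    apply: (@cvg_fst _ _ (nbhs x) (nbhs t)); apply: filterI => //.
    by apply: open_nbhs_nbhs; split=> //; exact: closed_openC.
  by apply: filterS nC => q [Nq Cq]; rewrite /= FC.
- by move=> x; apply: Ffix; rewrite clamp0 mul0r.
- move=> t x y e.
  have [Ux|nUx] := pselect (U x); have [Uy|nUy] := pselect (U y).
  + rewrite -(h'K x Ux) -(h'K y Uy); congr k'.
    apply: (@pushv_inj _ _ v0 eps i0 (clamp t)); first exact: clamp01.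
    by rewrite -/(P _ _) -(hF _ _ Ux) -/(P _ _) -(hF _ _ Uy) /= e.
  + by case: (nUy); move: e; rewrite /= [F y t]FN // => <-; exact: FUU.
  + by case: (nUx); move: e; rewrite /= [F x t]FN // => ->; exact: FUU.
  + by move: e; rewrite /= !FN.
- move=> x t; have [Ux|Ux] := pselect (U x); last by left; rewrite FN.
  have : 0 <= clamp t * (tent v0 eps (h' x) / 2).
    by have /andP[c0 _] := clamp01 t; rewrite mulr_ge0 // divr_ge0 // tent_ge0.
  rewrite le_eqVlt => /orP[/eqP e|b0]; [left; exact: Ffix | right; exact: Fint].
- have : nbhs p (U `&` h' @^-1` (tent v0 eps @^-1` [set a | 0 < a])).
    apply: filterI; first exact: open_nbhs_nbhs.
    apply: h'c => //; apply: tent_continuous; apply: open_nbhs_nbhs.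
    split; first exact: open_gt.
    rewrite /tent /= /l1 big1 ?subr0; last by move=> i _; rewrite subrr normr0.
    by rewrite lt_max eps0 orbT.
  apply: filterS => x [Ux b0]; apply: Fint => //.
  by rewrite clamp1 mul1r divr_gt0.
Qed.

Lemma inward_comp F G : inward F -> inward G ->
  inward (fun x t => G (F x t) t) /\
  forall x, int (F x 1) \/ int (G x 1) -> int (G (F x 1) 1).
Proof.
move=> [Fc F0 Fi Ff] [Gc G0 Gi Gf].
have GI x t : int x -> int (G x t) by have [->|] := Gf x t.
split; last first.
  move=> x [Fx|Gx]; first exact: GI.
  by have [->//|Fx] := Ff x 1; exact: GI.
split.
- move=> q; apply: (@continuous_comp _ _ _ (fun q : M * R => (F q.1 q.2, q.2))
    (fun q : M * R => G q.1 q.2)); last exact: Gc.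
  exact: (cvg_pair (Fc q) (@cvg_snd _ _ _ _ _)).
- by move=> x; rewrite F0 G0.
- by move=> t x y /Gi /Fi.
- move=> x t; have [e|Fx] := Ff x t; last by right; exact: GI.
  by rewrite e; exact: Gf.
Qed.

(** Finitely many local pushes cover [M], and their composite moves every point into the interior by
    time 1. *)
Lemma global_push : compact [set: M] -> (forall x : M, half_euclidean_at R d x) ->
  exists2 F, inward F & forall x, int (F x 1).
Proof.
move=> cM hx.
have h (p : M) : exists FB : (M -> R -> M) * set M,
    [/\ inward FB.1, nbhs p FB.2 & forall x, FB.2 x -> int (FB.1 x 1)].
  by have [F iF nF] := local_push (hx p); exists (F, [set x | int (F x 1)]).
have [L LP] := choice h.
have [s [_ sP]] := compact_finite_cover (U := fun p => (L p).2) cM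
  (fun x _ => let: And3 _ n _ := LP x in n).
have [F iF Fs] : exists2 F : M -> R -> M, inward F &
    forall x, (exists2 p, p \in s & (L p).2 x) -> int (F x 1).
  elim: (s) => [|p s' [F iF Fs]].
    exists (fun x _ => x); last by move=> x [].
    by split=> // [q|t x y|x t]; [exact: cvg_fst | exact | left].
  have [iL _ Lp] := LP p; have [iC Cs] := inward_comp iF iL.
  exists (fun x t => (L p).1 (F x t) t) => // x [q]; rewrite inE => /orP[/eqP-> qx|qs qx].
    by apply: Cs; right; exact: Lp.
  by apply: Cs; left; apply: Fs; exists q.
by exists F => // x; apply: Fs; exact: sP.
Qed.

End InteriorPush.

(** The final push maps all of [M], not just its interior, into the interior; the image of the
    compact [M] is the set [K]. As [X] is not compact, some [pt] lies outside it. *)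
Lemma isotopy_exists (R : realType) (d : nat) (X : topologicalType) :
  (0 < d)%N -> ~ compact [set: X] -> interior_of_compact R d X ->
  exists (e : X -> R -> X) (K : set X) (pt : X),
    [/\ continuous (fun q : X * R => e q.1 q.2), forall x, e x 0 = x,
        forall t, injective (e^~ t) &
        [/\ compact K, forall x, K (e x 1) & forall x, e x 1 <> pt]].
Proof.
move=> d0 nX [M [[hM _ hx] cM [f [g [fc gc fg gf]]]]].
have [F [Fc F0 Fi Ff] F1] := global_push (i0 := Ordinal d0) erefl hM cM hx.
pose I := set_type (@manifold_interior R d M).
have Fint (u : I) t : F (\val u) t \in @manifold_interior R d M.
  by apply/mem_set; have [->|] := Ff (\val u) t; first exact: set_valP.
have F1int x : F x 1 \in @manifold_interior R d M by exact/mem_set.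
pose rF (q : X * R) : I := exist (fun y => y \in @manifold_interior R d M) _ (Fint (f q.1) q.2).
pose rk (x : M) : I := exist (fun y => y \in @manifold_interior R d M) _ (F1int x).
pose e x t := g (rF (x, t)).
pose k x := g (rk x).
have ek x : e x 1 = k (\val (f x)) by rewrite /e /k; congr g; apply: val_inj.
have kc : continuous k.
  have rc : continuous rk.
    apply: sub_continuous => x /=.
    apply: (@continuous_comp _ _ _ (fun x => (x, 1 : R)) (fun q : M * R => F q.1 q.2)); last exact: Fc.
    exact: (cvg_pair cvg_id (cvg_cst _)).
  by move=> x; exact: (continuous_comp (rc x) (gc _)).
have cK : compact (range k) by apply: continuous_compact => //; exact: continuous_subspaceT.
have [pt npt] : exists pt, ~ range k pt.
  apply: contrapT => h; apply: nX; have -> // : [set: X] = range k.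
  by apply/seteqP; split=> // x _; apply: contrapT => nx; apply: h; exists x.
exists e, (range k), pt; split.
- have rc : continuous rF.
    apply: sub_continuous => q /=.
    apply: (@continuous_comp _ _ _ (fun q : X * R => (\val (f q.1), q.2))
      (fun q : M * R => F q.1 q.2)); last exact: Fc.
    have c1 : {for q, continuous (fun q : X * R => \val (f q.1))}.
      apply: (@continuous_comp _ _ _ fst (fun x => \val (f x))); first exact: cvg_fst.
      exact: (continuous_comp (fc _) (@val_continuous _ _ _)).
    exact: (cvg_pair c1 (@cvg_snd _ _ _ _ _)).
  have -> : (fun q : X * R => e q.1 q.2) = g \o rF by apply/funext => -[].
  by move=> q; exact: (continuous_comp (rc q) (gc _)).
- move=> x; rewrite /e -[RHS]fg; congr g; apply: val_inj => /=; exact: F0.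
- by move=> t x y /(can_inj gf)/(congr1 \val)/= /Fi/(@val_inj _ _ I)/(can_inj fg).
- split=> // x; first by rewrite ek; exists (\val (f x)).
  by move=> ept; apply: npt; rewrite -ept ek; exists (\val (f x)).
Qed.

(** * Betti numbers *)

Lemma lcomb_linear (V W : lmodType rat) (f : {linear V -> W}) (L : seq V) a :
  f (lcomb L a) = lcomb (map f L) a.
Proof.
rewrite /lcomb linear_sum size_map; apply: eq_bigr => i _.
by rewrite linearZ /= (nth_map 0).
Qed.

Section Transfer.
Variables (R : realType) (E E' : topologicalType) (f : E -> E').
Hypothesis fc : continuous f.
Variables (A : set E) (A' : set E').
Hypothesis fA : forall x, A x -> A' (f x).

Lemma push_cycle n (c : chain R rat E n) : rcyc A set0 c -> rcyc A' set0 (push f c).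
Proof.
move=> [Ac c0]; split; first exact: push_supp Ac.
by rewrite push_bd; [exact: push_supp c0 | exact: cts_push].
Qed.

Lemma push_bound n (c : chain R rat E n) : rbnd A set0 c -> rbnd A' set0 (push f c).
Proof.
move=> [Ac [e [Ae e0]]]; split; first exact: push_supp Ac.
exists (push f e); split; first exact: push_supp Ae.
rewrite push_bd; last exact: cts_push.
by rewrite -linearB; exact: push_supp e0.
Qed.
End Transfer.

Section Spans.
Variables (R : realType) (E : topologicalType) (A : set E) (i : nat).
Local Notation Z := (@rcyc R E A set0 i).
Local Notation B := (@rbnd R E A set0 i).

Definition spans (L : seq (chain R rat E i)) :=
  (forall x, x \in L -> Z x) /\ forall z, Z z -> exists a, B (z - lcomb L a).

(** A relation with nonzero k-th coefficient expresses that generator through the others. *)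
Lemma spans_drop L a k : spans L -> (k < size L)%N -> a k != 0 -> B (lcomb L a) ->
  exists2 L', spans L' & size L' = (size L).-1.
Proof.
move=> [LZ LB] kL ak Ba; case: L LZ LB kL Ba => // x L LZ LB kL Ba.
pose k' : 'I_(size (x :: L)) := Ordinal kL.
pose L' := [seq nth 0 (x :: L) (lift k' j) | j <- enum 'I_(size L)].
have sL' : size L' = size L by rewrite size_map size_enum_ord.
exists L'; last by rewrite sL'.
split=> [y /mapP[j _ ->]|z /LB[b Bb]]; first by apply: LZ; exact: mem_nth.
pose b' j := b j - b k / a k * a j.
have b'k : b' k' = 0 by rewrite /b' /= divfK // subrr.
exists (fun j => b' (bump k j)).
have -> : lcomb L' (fun j => b' (bump k j)) = lcomb (x :: L) b'.
  rewrite [RHS]/lcomb (bigD1_ord k') //= b'k scale0r add0r.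
  rewrite /lcomb sL'; apply: eq_bigr => j _; congr (_ *: _).
  by rewrite (nth_map j) ?size_enum_ord // nth_ord_enum.
have -> : lcomb (x :: L) b' = lcomb (x :: L) b - (b k / a k) *: lcomb (x :: L) a.
  rewrite addrC -scaleNr -lcombP; apply: eq_bigr => j _; congr (_ *: _).
  by rewrite /b' mulNr addrC.
rewrite opprB addrCA; apply: submodD => //; first exact: rbnd_submod.
by apply: submodZ => //; exact: rbnd_submod.
Qed.

End Spans.

Section Betti.
Variables (R : realType) (T : topologicalType) (i : nat).
Local Notation Z := (@rcyc R T setT set0 i).
Local Notation B := (@rbnd R T setT set0 i).
Local Notation H := (homology R rat T i).
Local Notation Q := (Quotient.quot (submod_pred (@rel_boundaries R rat T set0 i))).

Lemma cycleP (c : chain R rat T i) : c \in rel_cycles set0 i <-> Z c.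
Proof.
split; first by move=> /asboolP/asboolP c0; split=> //; exact: inCT.
by move=> [_ c0]; apply/asboolP/asboolP.
Qed.

Lemma homology_eq (u v : Defs.cycle R rat (set0 : set T) i) :
  \pi_Q%qT u = \pi_Q%qT v <-> B (\val u - \val v).
Proof.
have -> : \val u - \val v = \val (u - v) by [].
split.
  move=> /eqP; rewrite -Quotient.idealrBE !inE => -[b /asboolP b0].
  split; first exact: inCT.
  by exists b; split=> //; exact: inCT.
move=> [_ [b [_ b0]]]; apply/eqP; rewrite -Quotient.idealrBE !inE.
by exists b; apply/asboolP.
Qed.

Lemma homology_sum (b : nat) (a : 'I_b -> rat) (c : 'I_b -> Defs.cycle R rat (set0 : set T) i) :
  \sum_k a k *: (\pi_Q%qT (c k) : H) = \pi_Q%qT (\sum_k a k *: c k).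
Proof.
have pi0 : (\pi_Q%qT 0 : H) = 0.
  by apply: (addrI (\pi_Q%qT 0 : H)); rewrite -[LHS](@piD _ _ _) !addr0.
rewrite (big_morph (fun u => \pi_Q%qT u : H) (@piD _ _ _) pi0).
by apply: eq_bigr => k _; rewrite (@pi_scale _ _ _ (a k)).
Qed.

(** A spanning list of least length is a basis: two different expansions of a class would yield a
    relation and a shorter list. *)
Lemma spans_betti b : (exists2 L, @spans R T setT i L & size L = b) ->
  (forall L, @spans R T setT i L -> (b <= size L)%N) -> has_betti R T i b.
Proof.
move=> [L sL <-] Lmin; have [LZ LB] := sL.
pose c (k : 'I_(size L)) : Defs.cycle R rat (set0 : set T) i :=
  exist (fun c => c \in rel_cycles set0 i) (nth 0 L k)
    ((cycleP _).2 (LZ _ (mem_nth 0 (ltn_ord k)))).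
have cE (a : 'I_(size L) -> rat) : \val (\sum_k a k *: c k) = \sum_k a k *: nth 0 L k.
  by rewrite linear_sum; apply: eq_bigr => k _; rewrite linearZ.
exists (fun k => \pi_Q%qT (c k)); elim/quotW => u.
have [a Ba] := LB _ ((cycleP _).1 (valP u)).
exists (\row_k a k); split.
  rewrite homology_sum; apply/homology_eq; rewrite cE.
  rewrite (eq_bigr (fun k : 'I_(size L) => a k *: nth 0 L k)) // => k _.
  by rewrite mxE.
move=> a'; rewrite homology_sum => /homology_eq; rewrite cE => Ba'.
pose a'' j := a j - (if insub j is Some k then a' ord0 k else 0).
have B'' : B (lcomb L a'').
  have -> : lcomb L a'' = (\val u - \sum_k a' ord0 k *: nth 0 L k) - (\val u - lcomb L a).
    rewrite opprB addrC subrKA /lcomb -sumrB.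
    by apply: eq_bigr => k _; rewrite /a'' valK scalerBl.
  by apply: submodB => //; exact: rbnd_submod.
apply/rowP => k; rewrite mxE; apply: contrapT => /eqP ak.
have ak' : a'' k != 0 by rewrite /a'' valK subr_eq0.
have [L' /Lmin] := spans_drop sL (ltn_ord k) ak' B''.
move=> h sL'; have := leq_ltn_trans (leq0n k) (ltn_ord k).
by move: h; rewrite sL'; lia.
Qed.

End Betti.

(** * Homology of a subspace through chains of the ambient space *)

Section Subspace.
Variables (R : realType) (S : topologicalType) (W : set S) (i : nat).
Local Notation T := (set_type W).
Local Notation inj := (\val : T -> S).

Lemma lift_subspace n : exists g : chain R rat S n -> chain R rat T n,
  forall c, inC W c -> push inj (g c) = c.
Proof.
have h (c : chain R rat S n) : exists c' : chain R rat T n, inC W c -> push inj c' = c.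
  have [Wc|nWc] := pselect (inC W c); last by exists 0.
  suff [c' <-] : exists c' : chain R rat T n, push inj c' = c by exists c'.
  apply: (freegs_ind (P := fun c => exists c' : chain R rat T n, push inj c' = c) Wc).
    by exists 0; rewrite linear0.
  move=> a s _ Ws [c' <-].
  have sW t : s t \in W by exact/mem_set.
  pose s' t : T := exist (fun w => w \in W) (s t) (sW t).
  have s'c : continuous s' by apply: sub_continuous => t; exact: (cts_fun (s := s)).
  have [u su _] := mksing_ex s'c.
  exists (a *: << u >> + c'); rewrite linearP; congr (_ *: _ + _).
  by apply: push_cts => t /=; rewrite -su.
by have [g gP] := choice h; exists g.
Qed.

(** The retraction [insubd t0] need not be continuous; [push_comp] asks for continuity of the
    inclusion only, and the composite is the identity. *)
Lemma push_val_inj n (c : chain R rat T n) : push inj c = 0 -> c = 0.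
Proof.
move=> c0; have [[t0]|nT] := pselect (inhabited T); last first.
  apply: supp_false; apply: suppT => s; apply: nT.
  by constructor; exact: (s (vertex R (ord0 : 'I_n.+1))).
rewrite -[LHS]push_id; have -> : (id : T -> T) = (insubd t0 \o inj).
  by apply/funext => t /=; rewrite valKd.
rewrite -push_comp ?c0 ?linear0 //.
exact/cts_push/val_continuous.
Qed.

Lemma push_val_cycle n (c : chain R rat T n) : rcyc W set0 (push inj c) <-> rcyc setT set0 c.
Proof.
split=> [[_ /inC0 c0]|].
  split; first exact: inCT.
  rewrite push_bd in c0; last exact/cts_push/val_continuous.
  by rewrite (push_val_inj c0); exact: supp0.
by apply: push_cycle; [exact: val_continuous | move=> x _; exact: set_valP].
Qed.

Lemma push_val_bound n (c : chain R rat T n) : rbnd W set0 (push inj c) <-> rbnd setT set0 c.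
Proof.
split=> [[_ [e [We /inC0 ce]]]|]; last first.
  by apply: push_bound; [exact: val_continuous | move=> x _; exact: set_valP].
have [g gP] := lift_subspace n.+1; split; first exact: inCT.
exists (g e); split; first exact: inCT.
have -> : c - boundary (g e) = 0; last exact: supp0.
apply: push_val_inj; have bE : boundary (push inj (g e)) = push inj (boundary (g e)).
  by apply: push_bd; exact/cts_push/val_continuous.
by rewrite [LHS]linearB -[X in _ - X]bE gP.
Qed.

Lemma spans_sub L : @spans R S W i L -> exists2 L', @spans R T setT i L' & size L' = size L.
Proof.
move=> [LZ LB]; have [g gP] := lift_subspace i.
have gL : map (@push R T S inj i) (map g L) = L.
  rewrite -map_comp -[RHS]map_id; apply/eq_in_map => x /LZ[Wx _]; exact: gP.
exists (map g L); last by rewrite size_map.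
split=> [_ /mapP[x xL ->]|z zc].
  by apply/push_val_cycle; rewrite gP; [exact: LZ | exact: (LZ _ xL).1].
have [a Ba] := LB _ ((push_val_cycle z).2 zc); exists a.
by apply/push_val_bound; rewrite linearB /= lcomb_linear gL.
Qed.

Lemma spans_sup L : @spans R T setT i L -> @spans R S W i (map (@push R T S inj i) L).
Proof.
move=> [LZ LB]; split=> [_ /mapP[x /LZ xc ->]|z zc]; first exact/push_val_cycle.
have [g gP] := lift_subspace i; have zE := gP _ zc.1.
have [|a Ba] := LB (g z); first by apply/push_val_cycle; rewrite zE.
exists a; rewrite -zE -lcomb_linear -linearB; exact/push_val_bound.
Qed.

Lemma spans_betti_sub b : (exists2 L, @spans R S W i L & size L = b) ->
  (forall L, @spans R S W i L -> (b <= size L)%N) -> has_betti R T i b.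
Proof.
move=> [L sL <-] Lmin; apply: spans_betti; first exact: spans_sub.
by move=> L' /spans_sup /Lmin; rewrite size_map.
Qed.

End Subspace.

(** * The stabilisation map and its surjectivity *)

Section Stability.
Variables (R : realType) (d : nat) (X : topologicalType).
Variables (e : X -> R -> X) (K : set X) (pt : X).
Hypothesis e_cts : continuous (fun q : X * R => e q.1 q.2).
Hypothesis e0 : forall x, e x 0 = x.
Hypothesis e_inj : forall t, 0 <= t <= 1 -> injective (e^~ t).
Hypothesis cK : compact K.
Hypothesis eK : forall x, K (e x 1).
Hypothesis e_pt : forall x, e x 1 <> pt.
Hypothesis hX : hausdorff_space X.
Hypothesis eX : forall x : X, euclidean_at R d x.
Hypothesis cX : connected [set: X].
Hypothesis d1 : (1 < d)%N.
Variable i : nat.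

Let d0 : (0 < d)%N := ltnW d1.
Local Notation sU m mu := (@sU X m mu).

(** Generators upstairs, finite in number by [fg_homology_arr], span the homology of the quotient
    because cycles lift by [lift_cycle]. *)
Lemma spans_stratum m mu : exists L, @spans R _ (sU m mu) i L.
Proof.
have sc := @symq_continuous X m.
have sA (x : 'rV[X]_m) : arr (patterns X m mu) x -> sU m mu (symq x).
  by rewrite -(sU_arr hX eX d0).
have [L [_ LZ LB]] := fgb_gen (@rcyc_submod R _ (arr (patterns X m mu)) set0 i)
  (@rbnd_submod R _ (arr (patterns X m mu)) set0 i)
  (fg_homology_arr e_cts e0 e_inj cK eK hX eX (patterns X m mu) i).
exists (map (@push R _ _ (@symq X m) i) L); split.
  by move=> _ /mapP[x /LZ xc ->]; exact: push_cycle xc.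
move=> z zc; have [c [cc Bc]] := lift_cycle hX eX (@sU_open R d X hX eX d0 m mu) zc.
have [|a Ba] := LB c; first by rewrite -(sU_arr hX eX d0).
exists a; rewrite -(subrKA (push (@symq X m) c)); apply: submodD => //.
  exact: rbnd_submod.
by rewrite -lcomb_linear -linearB; exact: push_bound Ba.
Qed.

(* Adding a point at infinity induces a surjection in homology: by van_arr every
   cycle is homologous to a sum of cycles obtained by inserting pt. *)
Lemma spans_add m mu mu' L : perm_eq mu (1%N :: mu') -> (i < (m.+1./2).-1)%N ->
  @spans R _ (sU m mu') i L ->
  @spans R _ (sU m.+1 mu) i (map (@push R _ _ (@addq X m (e^~ 1) pt) i) L).
Proof.
move=> mu1 im [LZ LB]; pose ad := @addq X m (e^~ 1) pt.
have ei : injective (e^~ 1) by apply: e_inj; rewrite lexx ler01.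
have adc : continuous ad by apply: addq_continuous; exact: (e1_continuous e_cts).
have adU q : sU m mu' q -> sU m.+1 mu (ad q).
  have [x <-] := symq_ex q; rewrite /ad addqE => xU.
  have : arr (patterns X m.+1 mu) (addfirst (e^~ 1) pt x).
    by apply: (arr_addfirst mu1) => //; rewrite -(sU_arr hX eX d0).
  by rewrite -(sU_arr hX eX d0).
split=> [_ /mapP[x /LZ xc ->]|z zc]; first exact: push_cycle xc.
have [c [cc Bc]] := lift_cycle hX eX (@sU_open R d X hX eX d0 m.+1 mu) zc.
rewrite (sU_arr hX eX d0) in cc.
have [l Hl] := van_arr e_cts e0 e_inj e_pt hX eX cX d1 (patterns X m.+1 mu) im.
have [LL [LLc LLE]] := omega_image e_cts e_inj e_pt l cc.
have sc k := @symq_continuous X k.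
pose fg (s : 'I_m.+1) := fun x : 'rV[X]_m.+1 => col' s x.
have fgc s : continuous (fg s).
  apply: mx_continuous => a b; rewrite (_ : (fun _ => _) = fun x : 'rV[X]_m.+1 => x a (lift s b)).
    exact: mx_coord_continuous.
  by apply/funext => x; rewrite mxE.
(* Each term of the lifted cycle has [pt] inserted at some place; forgetting that place and passing
   to the quotient gives a preimage under the stabilisation map. *)
pose w := \sum_(sc <- LL) push (@symq X m) (push (fg sc.1) sc.2).
have wc : rcyc (sU m mu') set0 w.
  rewrite /w big_seq; elim/big_ind: _ => [|x y|[s c'] /LLc c'c].
  - by have [] := @rcyc_submod R _ (sU m mu') set0 i.
  - by apply: submodD; exact: rcyc_submod.
  - apply: (@push_cycle R _ _ _ (sc m) (arr (patterns X m mu'))).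
      by move=> x; rewrite -(sU_arr hX eX d0).
    by apply: push_cycle c'c => // x; exact: (arr_forget eX d0 mu1).
have wE : push ad w = push (@symq X m.+1) (c - omega e pt l c).
  rewrite LLE /w !linear_sum; apply: eq_bigr => -[s c'] _ /=.
  have qc : continuous (@symq X m \o fg s).
    by move=> x; apply: continuous_comp; [exact: fgc | exact: sc].
  rewrite (push_comp _ (cts_push (c := c') (fgc s))) (push_comp _ (cts_push (c := c') qc)).
  rewrite (push_comp _ (cts_push (c := c') (addpt_continuous (pt := pt) (s := s) e_cts))).
  congr (push _ c'); apply/funext => x /=; rewrite /ad addqE.
  (* Inserting [pt] at place [s] or at the front gives tuples that differ by the permutation
     carrying the first index to [s] and keeping the order of the others. *)
  apply/symqP; exists (lift_perm ord0 s 1)^-1%g; apply/rowP => a; rewrite !mxE.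
  case: (unliftP s a) => [b ->|->].
    have -> : (lift_perm ord0 s 1)^-1%g (lift s b) = lift ord0 b.
      by apply: (canLR (permK _)); rewrite lift_perm_lift perm1.
    by rewrite eq_sym (negPf (neq_lift _ _)) liftK /= mxE.
  have -> : (lift_perm ord0 s 1)^-1%g s = ord0.
    by apply: (canLR (permK _)); rewrite lift_perm_id.
  by rewrite eqxx unlift_none.
have [a Ba] := LB _ wc; exists a.
have -> : z - lcomb (map (@push R _ _ ad i) L) a =
    (z - push (@symq X m.+1) c) + push (@symq X m.+1) (omega e pt l c) +
    push ad (w - lcomb L a).
  have -> : push ad (w - lcomb L a) = push ad w - push ad (lcomb L a) by exact: linearB.
  rewrite -(lcomb_linear (@push R _ _ ad i)) wE.
  have -> : push (@symq X m.+1) (c - omega e pt l c) =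
    push (@symq X m.+1) c - push (@symq X m.+1) (omega e pt l c) by exact: linearB.
  set A1 := push _ c; set A2 := push _ (omega _ _ _ _).
  have -> : z - A1 + A2 = z - (A1 - A2) by rewrite opprB addrA addrAC.
  by rewrite subrKA.
have sb := @rbnd_submod R _ (sU m.+1 mu) set0 i.
apply: submodD => //; last exact: push_bound Ba.
apply: submodD => //; apply: (@push_bound R _ _ _ (sc m.+1) (arr (patterns X m.+1 mu))).
  by move=> x; rewrite -(sU_arr hX eX d0).
exact: Hl.
Qed.

Lemma betti_ex m mu : exists b, (exists2 L, @spans R _ (sU m mu) i L & size L = b) /\
  forall L, @spans R _ (sU m mu) i L -> (b <= size L)%N.
Proof.
pose P b := `[< exists2 L, @spans R _ (sU m mu) i L & size L = b >].
have [|b /asboolP Pb bmin] := @ex_minnP P.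
  by have [L sL] := spans_stratum m mu; exists (size L); apply/asboolP; exists L.
by exists b; split=> // L sL; apply: bmin; apply/asboolP; exists L.
Qed.

End Stability.

(** From the place where the least value beyond [J] is attained, the sequence can neither rise nor
    fall. *)
Lemma eventually_constant (b : nat -> nat) J : (forall j, (J <= j)%N -> (b j.+1 <= b j)%N) ->
  exists c N, forall j, (N <= j)%N -> b j = c.
Proof.
move=> bJ; pose P c := `[< exists2 j, (J <= j)%N & b j = c >].
have [|c /asboolP[N JN bN] cmin] := @ex_minnP P; first by exists (b J); apply/asboolP; exists J.
exists c, N => j; elim: j => [|j IH]; first by rewrite leqn0 => /eqP <-.
rewrite leq_eqVlt => /orP[/eqP <-//|Nj].
have Jj : (J <= j)%N by apply: leq_trans JN _.
apply/eqP; rewrite eqn_leq -{1}(IH Nj) bJ //=.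
by apply: cmin; apply/asboolP; exists j.+1 => //; exact: leqW.
Qed.

Theorem corollary3p5 (R : realType) (d : nat) (X : topologicalType)
    (mu : forall x : X, local_homology R d x)
    (n : nat) (lambda : seq nat) (i : nat) :
  (1 < d)%N ->
  connected [set: X] ->
  open_manifold R d X ->
  orientation mu ->
  interior_of_compact R d X ->
  is_partition n lambda ->
  exists b : nat, \forall j \near \oo,
    has_betti R (stratum_closure_compl X (n + j) (add_ones j lambda)) i b.
Proof.
move=> d1 cX [[hX _ eX] nX] _ intX _.
have [e [K [pt [ec e0 ei [cK eK ept]]]]] := isotopy_exists (ltnW d1) nX intX.
have ei' t : 0 <= t <= 1 -> injective (e^~ t) by move=> _; exact: ei.
have [b bP] := choice (fun j =>
  betti_ex ec e0 ei' cK eK hX eX d1 i (n + j) (add_ones j lambda)).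
(* For such [j] the integer half of [n + j + 1] is at least [i + 2], which puts [i] in the range of
   [spans_add]. *)
have bJ j : (i.*2 + 4 <= j)%N -> (b j.+1 <= b j)%N.
  move=> ij; have [[L sL <-] _] := bP j; have [_] := bP j.+1; rewrite addnS => bmin.
  have perm1 : perm_eq (add_ones j.+1 lambda) (1%N :: add_ones j lambda).
    by rewrite /add_ones -[nseq j.+1 1%N]cat1s perm_catCA.
  have im : (i < ((n + j).+1./2).-1)%N by lia.
  by have := bmin _ (spans_add ec e0 ei' ept hX eX cX d1 perm1 im sL); rewrite size_map.
have [c [N cN]] := eventually_constant bJ.
exists c, N => // j /= Nj; have [h1 h2] := bP j; rewrite -(cN j Nj).
exact: spans_betti_sub h1 h2.
Qed.
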